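(* Fix $0<\rho<1$ and let $\{\omega_x,I_{ie_1},J_{je_2}:x\in\mathbb Z_{>0}^2,\ i,j\in\mathbb Z_{>0}\}$ be mutually independent with $\omega_x\sim\mathrm{Exp}(1)$, $I_{ie_1}\sim\mathrm{Exp}(1-\rho)$, $J_{je_2}\sim\mathrm{Exp}(\rho)$. Let $(m,n)=(\lfloor N(1-\rho)^2\rfloor,\lfloor N\rho^2\rfloor)$. (a) For each $0<\delta<1$ we have this upper bound, with a constant $C=C(\rho)$: $$\sup_{0\le t\le1-\delta}\mathbb P^\rho_{0,(m,n)}\{\pi^{0,(m,n)}\text{ does not intersect }A_{rN^{2/3}}(tm,tn)\}\le\frac{C}{r^3}\qquad\text{for }r\ge1\text{ and }N\ge\tfrac1\delta.$$ (b) Fix $0<t<1$. There exist $\delta,\varepsilon>0$ that depend on $\rho$, and $N_0=N_0(\rho,t)<\infty$, such that $$\mathbb P^\rho_{0,(m,n)}\{\pi^{0,(m,n)}\text{ does not intersect }A_{\delta N^{2/3}}(tm,tn)\}\ge\varepsilon\qquad\text{for }N\ge N_0.$$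
   Context: $e_1=(1,0)$, $e_2=(0,1)$; $\mathrm{Exp}(\lambda)$ is the exponential distribution with rate $\lambda$. $A_r(x)=\{y\in\mathbb R^2:x_i\le y_i\le x_i+r,\ i=1,2\}$ is the closed square with side length $r$ and lower left corner $x=(x_1,x_2)$. With the convention that the weight at $ie_1$ is $I_{ie_1}$, at $je_2$ is $J_{je_2}$, at $x\in\mathbb Z_{>0}^2$ is $\omega_x$, and at the origin is $0$, $G^\rho_{0,(m,n)}$ is the maximal sum of weights along up-right lattice paths from $0$ to $(m,n)$ with increments in $\{e_1,e_2\}$, and $\pi^{0,(m,n)}=(\pi_k^{0,(m,n)})_{k=0}^{m+n}$ is the (almost surely unique) maximizing path (geodesic). $\mathbb P^\rho_{0,(m,n)}$ denotes the probability measure of this (increment-stationary) last-passage percolation process with parameter $\rho$ in the rectangle $[0,(m,n)]$. $N$ is a scaling parameter.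
   Formalization: In (b), δ may depend on t as well as on ρ, while ε depends on ρ only; with both depending on ρ alone the claim fails, since for fixed δ the probability of missing the square tends to 0 as t→1. *)

(* Defs.v *)
From HB Require Import structures.
From mathcomp Require Import all_boot all_order all_algebra.
From mathcomp Require Import all_classical all_reals all_analysis.
From mathcomp Require Import zify.

Set Implicit Arguments.
Unset Strict Implicit.
Unset Printing Implicit Defensive.

Import Order.TTheory GRing.Theory Num.Theory.
Import numFieldNormedType.Exports.
Local Open Scope classical_set_scope.
Local Open Scope ring_scope.

(* Up-right lattice paths from the origin to (m, n). Such a path never leaves
   the rectangle [0, m] x [0, n], so its sites can be taken in
   'I_m.+1 * 'I_n.+1, which makes the set of paths finite. *)

Definition lattice_path (m n : nat) :=
  {ffun 'I_(m + n).+1 -> 'I_m.+1 * 'I_n.+1}.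

Definition site m n (p : lattice_path m n) (k : 'I_(m + n).+1) : nat * nat :=
  (nat_of_ord (p k).1, nat_of_ord (p k).2).

Definition unit_step (x y : nat * nat) : bool :=
  (y == (x.1.+1, x.2)) || (y == (x.1, x.2.+1)).

Definition up_right m n (p : lattice_path m n) : bool :=
  [&& site p ord0 == (0%N, 0%N), site p ord_max == (m, n) &
      [forall k : 'I_(m + n),
         unit_step (site p (widen_ord (leqnSn _) k)) (site p (lift ord0 k))]].

Definition path_weight (R : realType) (W : nat * nat -> R) m n
    (p : lattice_path m n) : R :=
  \sum_(k < (m + n).+1) W (site p k).

Definition right_then_up m n : lattice_path m n :=
  [ffun k : 'I_(m + n).+1 => (inord (minn k m), inord (k - m))].

Lemma up_right_right_then_up m n : up_right (right_then_up m n).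
Proof.
have siteE k : site (right_then_up m n) k = (minn k m, (k - m)%N).
  rewrite /site ffunE /= !inordK //; last by rewrite ltnS geq_minr.
  by have := ltn_ord k; lia.
apply/and3P; split.
- by rewrite siteE /= min0n sub0n.
- by rewrite siteE /=; apply/eqP; congr (_, _); lia.
- apply/forallP => k; rewrite !siteE /unit_step /= /bump /=.
  by rewrite !xpair_eqE; lia.
Qed.

(* The last-passage value and the geodesic for the weights W. The path chosen
   among the maximizers is immaterial when the maximizer is unique; the
   reference path right_then_up only witnesses that there is one. *)

Definition geodesic (R : realType) (W : nat * nat -> R) (m n : nat) :
    lattice_path m n :=
  [arg max_(p > right_then_up m n | up_right p) path_weight W p]%O.

Definition last_passage (R : realType) (W : nat * nat -> R) (m n : nat) : R :=
  path_weight W (geodesic W m n).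

Lemma up_right_geodesic (R : realType) (W : nat * nat -> R) m n :
  up_right (geodesic W m n).
Proof.
by rewrite /geodesic; case: arg_maxP => //; exact: up_right_right_then_up.
Qed.

Lemma last_passage_max (R : realType) (W : nat * nat -> R) m n
    (p : lattice_path m n) :
  up_right p -> path_weight W p <= last_passage W m n.
Proof.
rewrite /last_passage /geodesic.
by case: arg_maxP => [|q _ qmax /qmax //]; exact: up_right_right_then_up.
Qed.

Definition path_sites (R : realType) m n (p : lattice_path m n) :
    set (R * R) :=
  range (fun k => ((site p k).1%:R, (site p k).2%:R)).

Definition closed_square (R : realType) (r : R) (x : R * R) : set (R * R) :=
  [set y | x.1 <= y.1 <= x.1 + r /\ x.2 <= y.2 <= x.2 + r].

Definition mutually_independent d (T : measurableType d) (R : realType)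
    (P : probability T R) (K : choiceType) (D : set K) (X : K -> T -> R) :=
  forall (s : seq K) (B : K -> set R),
    uniq s -> (forall i, i \in s -> D i) -> (forall i, measurable (B i)) ->
    P (\bigcap_(i in [set` s]) X i @^-1` B i) =
    (\prod_(i <- s) P (X i @^-1` B i))%E.

Definition exponentially_distributed d (T : measurableType d) (R : realType)
    (P : probability T R) (X : {RV P >-> R}) (rate : R) :=
  forall B : set R, measurable B ->
    distribution P X B = exponential_prob rate B.

(* I i and J j stand for the boundary weights at (i, 0) and (0, j). The values
   I 0, J 0 and omega x for x on the axes are never used. *)
Definition weight d (T : measurableType d) (R : realType)
    (P : probability T R) (omega : nat * nat -> {RV P >-> R})
    (I J : nat -> {RV P >-> R}) (x : nat * nat) : T -> R :=
  match x with
  | (0%N, 0%N) => cst 0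
  | (i, 0%N) => I i
  | (0%N, j) => J j
  | _ => omega x
  end.

(* The family of all omega_x, I_{i e_1} and J_{j e_2} is indexed by the
   nonnegative lattice points other than the origin, where it is weight. *)
Definition increment_stationary d (T : measurableType d) (R : realType)
    (P : probability T R) (rho : R) (omega : nat * nat -> {RV P >-> R})
    (I J : nat -> {RV P >-> R}) : Prop :=
  [/\ mutually_independent P [set x : nat * nat | x != (0%N, 0%N)]
        (weight omega I J),
      forall i j, (0 < i)%N -> (0 < j)%N ->
        exponentially_distributed (omega (i, j)) 1,
      forall i, (0 < i)%N -> exponentially_distributed (I i) (1 - rho) &
      forall j, (0 < j)%N -> exponentially_distributed (J j) rho].

(* The event that the geodesic from the origin to
   (m, n) = (floor (N (1 - rho)^2), floor (N rho^2)) does not intersect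
   A_r (t m, t n). *)
Definition geodesic_misses d (T : measurableType d) (R : realType)
    (P : probability T R) (omega : nat * nat -> {RV P >-> R})
    (I J : nat -> {RV P >-> R}) (rho N t r : R) : set T :=
  let m := Num.truncn (N * (1 - rho) ^+ 2) in
  let n := Num.truncn (N * rho ^+ 2) in
  [set w | @path_sites R m n (geodesic (fun x => weight omega I J x w) m n)
           `&` closed_square r (t * m%:R, t * n%:R) = set0].

(* Main.v *)
(* The passage time has an explicit exponential moment off the stationary line:
   if the axes carry rates [al] and [be], then
     E exp ((al + be - 1) G) = (be / (1 - al))^n (al / (1 - be))^m,
   by an exponential tilt of one axis and the Burke property. Chernoff bounds with
   this identity control G to order N^(1/3). Leaving the axis after k sites means
   that the path through (k, 0) is optimal; a tilt of size k/N makes this cost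
   exp (- c k^3 / N^2), and by the Burke property the same holds for the process
   seen from the corner of the square, which the geodesic misses only if its exit
   from the two rays through that corner is late. This gives (a). For (b), tilt the
   first K ~ C N^(2/3) weights of the axis through the corner by ~ C N^(-1/3). The
   likelihood ratio has a bounded second moment, and under the tilted measure the
   passage time exceeds what any path leaving this axis early can collect, so the
   square is missed with a probability that is bounded below. *)

Require Import Defs.
From HB Require Import structures.
From mathcomp Require Import all_boot all_order all_algebra.
From mathcomp Require Import all_classical all_reals all_analysis.
From mathcomp Require Import measurable_realfun.
From mathcomp Require Import zify ring lra.

Set Implicit Arguments.
Unset Strict Implicit.
Unset Printing Implicit Defensive.

Import Order.TTheory GRing.Theory Num.Theory.
Import numFieldNormedType.Exports.
Local Open Scope classical_set_scope.
Local Open Scope ring_scope.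

(** * Last-passage times *)

(** On the stationary line the exponent [al + be - 1] vanishes, so tail bounds need a changed rate
    on the horizontal axis. The price of the change is controlled by one deterministic dichotomy: a
    path leaves the axis before [(k, 0)] and does not see the weights beyond, or it passes through
    [(k, 0)]. The exponent [k^3 / N^2] is a balance. With axis rate [1 - rho - s] the passage time
    stays below [N] with probability at most about [exp (- N s^3 / 2)], while a path through
    [(k, 0)], compared with rate [1 - rho - u], pays [exp (- a (u - s))] per axis site. With
    [a = u = 2 s = be k / N] both exponents are multiples of [k^3 / N^2]. For [k] of order
    [r N^(2/3)] this is [r^3], so (a) first appears as a bound [exp (- c r^3)]. In (b) everything is
    written in the cube root [h] of the scale. A tilt of size [S / h] over order [h^2] sites raises
    the passage time by order [S^2 h]. For large [S] this beats the fluctuations, which are of order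
    [h], and the width of the square is then chosen so small that an early exit gains only [h]. *)

Fixpoint lpp (R : realType) (W : nat * nat -> R) (m : nat) : nat -> R :=
  match m with
  | 0 => fix col n := if n is n'.+1 then col n' + W (0%N, n) else 0
  | m'.+1 => fix col n :=
      if n is n'.+1 then Num.max (lpp W m' n) (col n') + W (m, n)
      else lpp W m' 0%N + W (m, 0%N)
  end.

Arguments lpp : simpl never.

Section deterministic.
Variable R : realType.
Implicit Types (W : nat * nat -> R) (m n a b k : nat).

(** [lpp] does not count the weight at its starting point. A passage time in the environment shifted
    to [x] thus omits the weight at [x], and concatenating paths adds passage times without double
    counting. *)
Definition shift (x : nat * nat) W : nat * nat -> R :=
  fun y => W ((x.1 + y.1)%N, (x.2 + y.2)%N).

Lemma shiftE x W y : shift x W y = W ((x.1 + y.1)%N, (x.2 + y.2)%N).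
Proof. by []. Qed.

Lemma lpp00 W : lpp W 0 0 = 0. Proof. by []. Qed.

Lemma lpp0S W n : lpp W 0 n.+1 = lpp W 0 n + W (0, n.+1)%N.
Proof. by []. Qed.

Lemma lppS0 W m : lpp W m.+1 0 = lpp W m 0 + W (m.+1, 0)%N.
Proof. by []. Qed.

Lemma lppSS W m n :
  lpp W m.+1 n.+1 =
  Num.max (lpp W m n.+1) (lpp W m.+1 n) + W (m.+1, n.+1)%N.
Proof. by []. Qed.

Lemma lpp_right W m n : lpp W m n + W (m.+1, n)%N <= lpp W m.+1 n.
Proof. by case: n => [|n] //; rewrite lppSS lerD2r le_max lexx. Qed.

Lemma lpp_up W m n : lpp W m n + W (m, n.+1)%N <= lpp W m n.+1.
Proof. by case: m => [|m] //; rewrite lppSS lerD2r le_max lexx orbT. Qed.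

Lemma lpp_ind2 (P : nat -> nat -> Prop) :
  P 0%N 0%N -> (forall n, P 0%N n -> P 0%N n.+1) ->
  (forall m, P m 0%N -> P m.+1 0%N) ->
  (forall m n, P m n.+1 -> P m.+1 n -> P m.+1 n.+1) -> forall m n, P m n.
Proof.
move=> P00 P0S PS0 PSS; elim=> [|m IHm]; elim=> [|n IHn]; auto.
Qed.

Lemma lpp_superadd W a b m n :
  lpp W a b + lpp (shift (a, b) W) m n <= lpp W (a + m) (b + n).
Proof.
move: m n; apply: lpp_ind2 => [|n IH|m IH|m n IH1 IH2].
- by rewrite !addn0 addr0.
- rewrite lpp0S addrA addnS; apply: le_trans (lpp_up _ _ _).
  by rewrite shiftE /= addnS lerD2r.
- rewrite lppS0 addrA addnS; apply: le_trans (lpp_right _ _ _).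
  by rewrite shiftE /= addnS lerD2r.
- rewrite lppSS addrA -lerBrDr shiftE /= addr_maxr ge_max !addnS !lerBrDr.
  apply/andP; split.
  + by apply: le_trans (lpp_right _ _ _); rewrite lerD2r -addnS.
  + by apply: le_trans (lpp_up _ _ _); rewrite lerD2r -addnS.
Qed.

Lemma le_lpp W W' m n :
  (forall x, x != (0, 0)%N -> (x.1 <= m)%N -> (x.2 <= n)%N -> W x <= W' x) ->
  lpp W m n <= lpp W' m n.
Proof.
move: m n; apply: lpp_ind2 => [//|n IH|m IH|m n IH1 IH2] H.
- by rewrite !lpp0S lerD ?H// IH// => x x0 ? ?; apply: H => //; lia.
- by rewrite !lppS0 lerD ?H// IH// => x x0 ? ?; apply: H => //; lia.
- rewrite !lppSS lerD ?H// ge_max !le_max IH1 ?IH2 ?orbT// => x x0 ? ?;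
  by apply: H => //; lia.
Qed.

Lemma eq_lpp W W' m n :
  (forall x, x != (0, 0)%N -> (x.1 <= m)%N -> (x.2 <= n)%N -> W x = W' x) ->
  lpp W m n = lpp W' m n.
Proof.
by move=> H; apply/eqP; rewrite eq_le !le_lpp// => x ? ? ?; rewrite H.
Qed.

Lemma lpp_ge0 W m n : (forall x, 0 <= W x) -> 0 <= lpp W m n.
Proof.
move=> W0; move: m n; apply: lpp_ind2 => [//|n IH|m IH|m n IH1 IH2].
- by rewrite lpp0S addr_ge0.
- by rewrite lppS0 addr_ge0.
- by rewrite lppSS addr_ge0// le_max IH1.
Qed.

Lemma lpp_transpose W m n :
  lpp (fun x => W (x.2, x.1)) n m = lpp W m n.
Proof.
move: m n; apply: lpp_ind2 => [//|n IH|m IH|m n IH1 IH2].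
- by rewrite lpp0S -IH.
- by rewrite lppS0 -IH.
- by rewrite !lppSS IH1 IH2 maxC.
Qed.

Lemma lpp_axis W k : lpp W k 0 = \sum_(i < k) W (i.+1, 0)%N.
Proof. by elim: k => [|k IH]; rewrite ?big_ord0// big_ord_recr /= -IH. Qed.

(* A path either leaves the horizontal axis before (k, 0), or it visits
   (k, 0). *)
Lemma lpp_exit W W' k m n : (0 < k)%N -> (k <= m)%N ->
  (forall x, (x.1 < k)%N || (0 < x.2)%N -> W x = W' x) ->
  lpp W m n <=
  Num.max (lpp W' m n) (lpp W k 0 + lpp (shift (k, 0%N) W) (m - k) n).
Proof.
move=> k0 km WW'.
have small a b : (a < k)%N -> lpp W a b = lpp W' a b.
  by move=> ak; apply: eq_lpp => x _ xa _; rewrite WW'// (leq_ltn_trans xa).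
have sup a b : (k <= a)%N ->
    lpp W k 0 + lpp (shift (k, 0%N) W) (a - k) b <= lpp W a b.
  by move=> ka; rewrite -[in leRHS](subnKC ka) -[in leRHS](add0n b);
    exact: lpp_superadd.
suff H a b : (k <= a)%N -> lpp W a b <=
    Num.max (lpp W' a b) (lpp W k 0 + lpp (shift (k, 0%N) W) (a - k) b).
  exact: H.
move: a b; apply: lpp_ind2 => [ka|b IH ka|a IH ka|a b IH1 IH2 ka].
- by move: (leq_trans k0 ka).
- by move: (leq_trans k0 ka).
- rewrite le_max; apply/orP; right; rewrite -{1}(subnKC ka).
  elim: (a.+1 - k)%N => [|d IHd]; first by rewrite addn0 lpp00 addr0.
  by rewrite addnS !lppS0 addrA shiftE /= addnS lerD2r.
- have step (A B C B' C' w : R) : A <= Num.max B C -> B + w <= B' ->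
      C + w <= C' -> A + w <= Num.max B' C'.
    move=> ABC BB CC; rewrite -lerBrDr (le_trans ABC)// ge_max !lerBrDr !le_max.
    by rewrite BB CC orbT.
  have wE : W (a.+1, b.+1)%N = W' (a.+1, b.+1)%N by rewrite WW'// orbT.
  rewrite lppSS -lerBrDr ge_max !lerBrDr; apply/andP; split; last first.
    apply: step (IH2 ka) _ _; first by rewrite wE lpp_up.
    rewrite -addrA lerD2l; apply: le_trans (lpp_up _ _ _).
    by rewrite lerD2l shiftE /= subnKC.
  (* In column [k] itself the left neighbour lies where the two environments agree, so [small] takes
     the place of the induction hypothesis. *)
  move: ka; rewrite leq_eqVlt => /orP[/eqP ka|ka].
    by rewrite small ?ka// le_max wE lpp_right.
  apply: step (IH1 ka) _ _; first by rewrite wE lpp_right.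
  rewrite -addrA lerD2l subSn//; apply: le_trans (lpp_right _ _ _).
  by rewrite lerD2l shiftE /= addnS subnKC.
Qed.

Lemma path_sum_le_lpp W (q : nat -> nat * nat) d :
  (forall l, (l < d)%N -> unit_step (q l) (q l.+1)) ->
  [/\ ((q 0).1 <= (q d).1)%N, ((q 0).2 <= (q d).2)%N,
      (((q d).1 - (q 0).1) + ((q d).2 - (q 0).2) = d)%N &
      \sum_(l < d) W (q l.+1) <=
        lpp (shift (q 0%N) W) ((q d).1 - (q 0%N).1) ((q d).2 - (q 0%N).2)].
Proof.
elim: d => [|d IH] st; first by rewrite big_ord0 !subnn.
have [|h1 h2 h3 h4] := IH; first by move=> l ld; apply: st; rewrite ltnW.
have := st d (leqnn _).
rewrite big_ord_recr /= => /orP[/eqP qE|/eqP qE]; rewrite qE /=; split; try lia.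
- rewrite subSn//; apply: le_trans (lpp_right _ _ _).
  by rewrite lerD// shiftE /= addnS !subnKC.
- rewrite [in X in lpp _ _ X]subSn//; apply: le_trans (lpp_up _ _ _).
  by rewrite lerD// shiftE /= addnS !subnKC.
Qed.

Lemma optimal_path W m n : exists q : nat -> nat * nat,
  [/\ q 0%N = (0, 0)%N, q (m + n)%N = (m, n),
      forall l, (l < m + n)%N -> unit_step (q l) (q l.+1) &
      \sum_(l < m + n) W (q l.+1) = lpp W m n].
Proof.
(* [ext q d x] follows [q] up to time [d] and then sits at [x]: it appends the last site to an
   optimal path of the better predecessor. *)
pose ext (q : nat -> nat * nat) d x l := if (l <= d)%N then q l else x.
have extE q d x y : q d = y -> unit_step y x ->
    (forall l, (l < d)%N -> unit_step (q l) (q l.+1)) ->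
    [/\ ext q d x 0%N = q 0%N, ext q d x d.+1 = x,
      forall l, (l < d.+1)%N -> unit_step (ext q d x l) (ext q d x l.+1) &
      \sum_(l < d.+1) W (ext q d x l.+1) = \sum_(l < d) W (q l.+1) + W x].
  move=> qd yx st; split; rewrite /ext ?leq0n ?ltnn//.
    move=> l; rewrite ltnS leq_eqVlt => /orP[/eqP ->|ld].
      by rewrite eqxx ltnn qd.
    by rewrite ld orbT st.
  rewrite big_ord_recr /= ltnn; congr (_ + _); apply: eq_bigr => l _.
  by rewrite ltn_ord.
move: m n; apply: lpp_ind2 => [|n|m|m n].
- by exists (fun=> (0, 0)%N); split => //; rewrite big_ord0.
- move=> [q [q0 qd st qs]].
  have [|e1 e2 e3 e4] := extE q (0 + n)%N (0, n.+1)%N _ qd _ st.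
    by rewrite /unit_step /= eqxx ?orbT.
  exists (ext q (0 + n)%N (0, n.+1)%N).
  by split; rewrite ?e1 ?addnS// e4 qs.
- move=> [q [q0 qd st qs]].
  have [|e1 e2 e3 e4] := extE q (m + 0)%N (m.+1, 0)%N _ qd _ st.
    by rewrite /unit_step /= eqxx.
  exists (ext q (m + 0)%N (m.+1, 0)%N).
  by split; rewrite ?e1 ?addSn// e4 qs.
- move=> [q [q0 qd st qs]] [q' [q0' qd' st' qs']].
  rewrite lppSS.
  have [le|le] := leP (lpp W m n.+1) (lpp W m.+1 n).
    have [|e1 e2 e3 e4] := extE q' (m.+1 + n)%N (m.+1, n.+1)%N _ qd' _ st'.
      by rewrite /unit_step /= eqxx ?orbT.
    exists (ext q' (m.+1 + n)%N (m.+1, n.+1)%N).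
    by split; rewrite ?e1 ?addnS// e4 qs'.
  have [|e1 e2 e3 e4] := extE q (m + n.+1)%N (m.+1, n.+1)%N _ qd _ st.
    by rewrite /unit_step /= eqxx.
  exists (ext q (m + n.+1)%N (m.+1, n.+1)%N).
  by split; rewrite ?e1 ?addSn// e4 qs.
Qed.

Lemma site_steps m n (p : lattice_path m n) : up_right p ->
  [/\ site p (inord 0) = (0, 0)%N, site p (inord (m + n)) = (m, n) &
   forall l, (l < m + n)%N -> unit_step (site p (inord l)) (site p (inord l.+1))].
Proof.
case/and3P => /eqP p0 /eqP pmax /forallP st; split.
- by rewrite -p0; congr site; apply: val_inj; rewrite /= inordK.
- by rewrite -pmax; congr site; apply: val_inj; rewrite /= inordK.
- move=> l lmn; have := st (Ordinal lmn).
  congr (unit_step (site p _) (site p _)); apply: val_inj => /=.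
    by rewrite inordK// ltnS ltnW.
  by rewrite /bump/= inordK.
Qed.

Lemma path_weightE W m n (p : lattice_path m n) : up_right p ->
  W (0, 0)%N = 0 ->
  path_weight W p = \sum_(l < m + n) W (site p (inord l.+1)).
Proof.
move=> /and3P[/eqP p0 _ _] W0; rewrite /path_weight big_ord_recl p0 W0 add0r.
apply: eq_bigr => i _; congr (W (site p _)); apply: val_inj => /=.
by rewrite /bump/= inordK// ltnS.
Qed.

Lemma lpp_le_last_passage W m n : W (0, 0)%N = 0 ->
  lpp W m n <= last_passage W m n.
Proof.
move=> W0; have [q [q0 qd st qs]] := optimal_path W m n.
(* The steps still to come only increase the coordinates, so every site stays in the rectangle and
   [inord] below loses nothing. *)
have bnd l : (l <= m + n)%N -> ((q l).1 <= m)%N /\ ((q l).2 <= n)%N.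
  move=> lmn.
  have [|h1 h2 _ _] := @path_sum_le_lpp W (fun i => q (l + i)%N) (m + n - l).
    by move=> i il; rewrite addnS; apply: st; lia.
  by move: h1 h2; rewrite addn0 subnKC// qd.
pose p : lattice_path m n :=
  [ffun k : 'I_(m + n).+1 => (inord (q k).1, inord (q k).2)].
have sE (k : 'I_(m + n).+1) : site p k = q k.
  have [|h1 h2] := bnd k; first by rewrite -ltnS.
  by rewrite /site ffunE /= !inordK ?ltnS//; case: (q k).
have up : up_right p.
  apply/and3P; split; rewrite ?sE ?q0 ?qd//.
  by apply/forallP => k; rewrite !sE /= /bump /= add1n st.
apply: le_trans (last_passage_max _ up).
rewrite path_weightE// -qs; apply: ler_sum => i _.
by rewrite sE inordK// ltnS.
Qed.

(** The geodesic weighs at least [lpp W m n], and its pieces before and after the site weigh at most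
    the two passage times on the right. *)
Lemma geodesic_through W m n (k : 'I_(m + n).+1) a b : W (0, 0)%N = 0 ->
  site (geodesic W m n) k = (a, b) ->
  [/\ (a <= m)%N, (b <= n)%N &
     lpp W m n <= lpp W a b + lpp (shift (a, b) W) (m - a) (n - b)].
Proof.
move=> W0 pk.
have up := up_right_geodesic W m n.
have [s0 s1 st] := site_steps up.
have kmn : (k <= m + n)%N by rewrite -ltnS.
have pk' : site (geodesic W m n) (inord k) = (a, b).
  by rewrite -pk; congr site; apply: val_inj; rewrite /= inordK.
have [|h1 h2 _ h4] := @path_sum_le_lpp W
    (fun i => site (geodesic W m n) (inord i)) k.
  by move=> l lk; apply: st; apply: leq_trans kmn.
have [|i1 i2 _ i4] := @path_sum_le_lpp W
    (fun i => site (geodesic W m n) (inord (k + i))) (m + n - k).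
  by move=> l lk; rewrite addnS; apply: st; lia.
move: h4 i1 i2 i4; rewrite !addn0 subnKC// s0 s1 pk' /= !subn0 => h4 i1 i2 i4.
split => //; apply: le_trans (lpp_le_last_passage _ _ W0) _.
rewrite /last_passage path_weightE//.
rewrite -(big_mkord xpredT
  (fun l => W (site (geodesic W m n) (inord l.+1)))).
rewrite (@big_cat_nat _ _ _ k)//=; apply: lerD.
  by rewrite big_mkord; apply: le_trans h4 _; apply: le_lpp => x _ _ _;
    rewrite shiftE !add0n; case: x.
rewrite -{1}(add0n k) big_addn big_mkord; apply: le_trans i4.
by apply: ler_sum => i _; rewrite addnS (addnC k).
Qed.

(* The first site of the path in the quadrant based at (a, b) lies on the
   boundary of the quadrant. *)
Lemma up_right_enters m n (p : lattice_path m n) a b k : up_right p ->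
  (a <= m)%N -> (b <= n)%N ->
  (forall l x, site p l = x ->
     ~ [&& (a <= x.1)%N, (x.1 <= a + k)%N, (b <= x.2)%N & (x.2 <= b + k)%N]) ->
  exists l, (exists2 c, (a + k < c)%N & site p l = (c, b)) \/
            (exists2 c, (b + k < c)%N & site p l = (a, c)).
Proof.
move=> up am bn miss; have [s0 s1 st] := site_steps up.
pose Q l := (a <= (site p (inord l)).1)%N && (b <= (site p (inord l)).2)%N.
have exQ : exists l, Q l by exists (m + n)%N; rewrite /Q s1 am bn.
have [l Ql lmin] := ex_minnP exQ.
have lmn : (l <= m + n)%N by apply: lmin; rewrite /Q s1 am bn.
exists (inord l); have := miss (inord l) _ erefl.
move: Ql; rewrite /Q; case pE : (site p (inord l)) => [x y] /= /andP[ax bxy] hm.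
suff : x = a \/ y = b.
  case => E; subst; [right; exists y|left; exists x] => //;
  by move: hm => /negP; lia.
case: l lmin lmn pE => [|l] lmin lmn pE {hm}.
  by move: pE; rewrite s0 => -[? ?]; lia.
have : ~~ Q l by apply/negP => /lmin; rewrite ltnn.
rewrite /Q; have := st l lmn; rewrite pE.
by case: (site p (inord l)) => u v /orP[] /eqP[? ?] /=; lia.
Qed.

(* The boundary weights of the process seen from (a, b). *)
Definition rebase W a b (x : nat * nat) : R :=
  match x with
  | (0%N, 0%N) => 0
  | (i.+1, 0%N) => lpp W (a + i).+1 b - lpp W (a + i) b
  | (0%N, j.+1) => lpp W a (b + j).+1 - lpp W a (b + j)
  | _ => W ((a + x.1)%N, (b + x.2)%N)
  end.

Lemma lpp_rebase W a b m n :
  lpp (rebase W a b) m n = lpp W (a + m) (b + n) - lpp W a b.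
Proof.
move: m n; apply: lpp_ind2 => [|n IH|m IH|m n IH1 IH2].
- by rewrite !addn0 subrr.
- by rewrite lpp0S IH !addn0 addnS /=; ring.
- by rewrite lppS0 IH !addn0 addnS /=; ring.
- by rewrite lppSS IH1 IH2 !addnS lppSS /= !addnS -addr_maxl addrAC.
Qed.

Lemma rebaseD W a b a' b' :
  rebase (rebase W a b) a' b' =1 rebase W (a + a') (b + b').
Proof.
have subK (x y z : R) : x - z - (y - z) = x - y by ring.
move=> [[|i] [|j]] //=.
- by rewrite !lpp_rebase subK !addnS !addnA.
- by rewrite !lpp_rebase subK !addnS !addnA.
- rewrite -!addnA; case E1 : (a' + i.+1)%N => [|u]; first by rewrite addnS in E1.
  by case E2 : (b' + j.+1)%N => [|v] //; rewrite addnS in E2.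
Qed.

(** The environments agree off the axes of the quadrant. On an axis the rebased weight is an
    increment of passage times, which dominates the original weight. A path value beyond the corner
    can therefore only grow when it is read in the rebased process. *)
Lemma shift_le_rebase W a b i j m n :
  lpp (shift ((a + i)%N, (b + j)%N) W) m n <= lpp (shift (i, j) (rebase W a b)) m n.
Proof.
apply: le_lpp => -[x y] xy0 _ _; rewrite !shiftE /=.
case E1 : (i + x)%N => [|u]; case E2 : (j + y)%N => [|v] /=.
- by move: xy0; rewrite xpair_eqE; lia.
- rewrite (_ : (a + i + x = a)%N); last by lia.
  rewrite (_ : (b + j + y = (b + v).+1)%N); last by lia.
  by rewrite lerBrDr addrC lpp_up.
- rewrite (_ : (b + j + y = b)%N); last by lia.
  rewrite (_ : (a + i + x = (a + u).+1)%N); last by lia.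
  by rewrite lerBrDr addrC lpp_right.
- by rewrite -!addnA E1 E2.
Qed.

End deterministic.

(** * Exponential families and their tilts *)

Section densities.
Context d (T : measurableType d) (R : realType).
Local Open Scope ereal_scope.

Import HBNNSimple.

(** Both sides are monotone limits along simple functions increasing to [f]; on the indicator of a
    level set the identity is the hypothesis on [nu]. *)
Lemma ge0_integral_density (mu nu : {measure set T -> \bar R}) (h : T -> R)
    (f : T -> \bar R) :
  measurable_fun setT h -> (forall x, 0 <= h x)%R ->
  (forall A, measurable A -> nu A = \int[mu]_(x in A) (h x)%:E) ->
  measurable_fun setT f -> (forall x, 0 <= f x) ->
  \int[nu]_x f x = \int[mu]_x (f x * (h x)%:E).
Proof.
move=> mh h0 nuE mf f0; pose g := EFin \o h.
have mg : measurable_fun setT g by exact/measurable_EFinP.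
have g0 x : 0 <= g x by rewrite lee_fin.
pose a := nnsfun_approx (@measurableT _ T) mf.
have -> : \int[nu]_x f x = lim (\int[nu]_x (EFin \o a n) x @[n --> \oo]).
  have fE x : f x = lim ((EFin \o a n) x @[n --> \oo]).
    by apply/esym/cvg_lim => //; exact: cvg_nnsfun_approx.
  under eq_integral => x _ do rewrite fE.
  apply: monotone_convergence => //.
  - by move=> n; exact/measurable_EFinP.
  - by move=> n x _ //=; rewrite lee_fin.
  - by move=> x _ m n mn; rewrite lee_fin; exact/lefP/nd_nnsfun_approx.
have -> : \int[mu]_x (f x * (h x)%:E) =
    lim (\int[mu]_x ((EFin \o a n) \* g) x @[n --> \oo]).
  have fE x : f x * (h x)%:E = lim (((EFin \o a n) \* g) x @[n --> \oo]).
    by apply/esym/cvg_lim => //; apply: cvgeZr => //; exact: cvg_nnsfun_approx.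
  under eq_integral => x _ do rewrite fE.
  apply: monotone_convergence => [//| | |].
  - by move=> n; apply/emeasurable_funM => //; exact/measurable_EFinP.
  - by move=> n x _ /=; rewrite mule_ge0 ?lee_fin.
  - move=> x _ m n mn/=; rewrite lee_wpmul2r ?lee_fin//.
    exact/lefP/nd_nnsfun_approx.
suff suf n : \int[nu]_x (EFin \o a n) x = \int[mu]_x ((EFin \o a n) x * g x).
  by under eq_fun do rewrite suf.
transitivity (\int[nu]_x
   (\sum_(y \in range (a n)) (y * \1_(a n @^-1` [set y]) x)%:E)).
  by apply: eq_integral => t tE; rewrite /= fimfunE -fsumEFin.
have mi r : measurable_fun setT (fun x => (r * \1_(a n @^-1` [set r]) x)%:E).
  by apply: (measurable_comp measurableT) => //; exact: measurable_funM.
rewrite ge0_integral_fsum//; last by move=> m y Ey; exact: nnfun_muleindic_ge0.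
transitivity (\int[mu]_x (\sum_(y \in range (a n))
    (y * \1_(a n @^-1` [set y]) x)%:E * g x)); last first.
  under eq_integral => x xE.
    rewrite -ge0_mule_fsuml => [|y]; last exact: nnfun_muleindic_ge0.
    rewrite fsumEFin // -(fimfunE _ x); over.
  by [].
rewrite ge0_integral_fsum//; last 2 first.
  - by move=> y; exact: emeasurable_funM.
  - by move=> m y Ey; rewrite mule_ge0 ?nnfun_muleindic_ge0.
apply: eq_fsbigr => r rhn.
under eq_integral do rewrite EFinM.
rewrite integralZl_indic_nnsfun// integral_indic// setIT.
under [RHS]eq_integral do rewrite EFinM -muleA.
rewrite ge0_integralZl//.
- congr (_ * _); rewrite nuE//.
  under [RHS]eq_integral do rewrite muleC.
  rewrite [RHS](eq_integral (g \_ (a n @^-1` [set r]))); last first.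
    by move=> x xE; rewrite epatch_indic.
  by rewrite -integral_mkcond.
- by apply: emeasurable_funM => //; exact/measurable_EFinP.
- by move=> t _; rewrite mule_ge0 ?lee_fin.
- by move: rhn; rewrite inE => -[t _ <-]; rewrite lee_fin.
Qed.

Lemma exists_density (mu : {measure set T -> \bar R}) (h : T -> R) :
  measurable_fun setT h -> (forall x, 0 <= h x)%R ->
  \int[mu]_x (h x)%:E = 1 ->
  exists Q : probability T R,
    forall A, measurable A -> Q A = \int[mu]_(x in A) (h x)%:E.
Proof.
move=> mh h0 h1; pose nu (A : set T) := \int[mu]_(x in A) (h x)%:E.
have nu0 : nu set0 = 0 by rewrite /nu integral_set0.
have nuge0 A : 0 <= nu A by apply: integral_ge0 => x _; rewrite lee_fin.
have nusa : semi_sigma_additive nu.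
  move=> /= F mF tF mUF; rewrite /nu; apply: cvg_toP.
    apply: ereal_nondecreasing_is_cvgn => m n mn.
    by apply: lee_sum_nneg_natr => // k _ _; exact: nuge0.
  rewrite ge0_integral_bigcup//=.
  - exact/measurable_funTS/measurable_EFinP.
  - by move=> x _; rewrite lee_fin.
pose nuM := isMeasure.Build _ _ _ nu nu0 nuge0 nusa.
pose nu' : {measure set T -> \bar R} := HB.pack nu nuM.
have nu1 : nu' setT = 1 by [].
pose nuP := Measure_isProbability.Build _ _ _ nu' nu1.
pose Q : probability T R := HB.pack nu nuM nuP.
by exists Q.
Qed.

(** [Q] is the conditional probability given [A]. Independence of several variables from a further
    event is treated by passing to [Q], where a statement about fewer variables applies. *)
Lemma exists_cond (P : probability T R) (A : set T) : measurable A ->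
  P A != 0 ->
  exists Q : probability T R,
    forall B, measurable B -> P (B `&` A) = Q B * P A.
Proof.
move=> mA PA0; have PAfin : P A \is a fin_num by rewrite fin_num_measure.
have fPA0 : fine (P A) != 0%R by rewrite fine_eq0.
pose h x := ((fine (P A))^-1 * \1_A x)%R.
have c0 : (0 <= (fine (P A))^-1)%R by rewrite invr_ge0 fine_ge0.
have mh : measurable_fun setT h by exact: measurable_funM.
have h0 x : (0 <= h x)%R by rewrite mulr_ge0.
have hE B : measurable B ->
    \int[P]_(x in B) (h x)%:E = (fine (P A))^-1%:E * P (A `&` B).
  move=> mB; under eq_integral do rewrite EFinM.
  rewrite ge0_integralZl_EFin ?integral_indic//.
  by apply: measurable_funTS; apply/measurable_EFinP.
have [|Q QE] := @exists_density P h mh h0.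
  by rewrite hE// setIT -(fineK PAfin) -EFinM mulVf.
exists Q => B mB; rewrite QE// hE// muleC muleA -{1}(fineK PAfin).
by rewrite -EFinM mulfV// mul1e setIC.
Qed.

End densities.

(** * Laws on the line and the plane determined by tails *)

Section laws.
Context (R : realType).
Local Open Scope ereal_scope.

Lemma exists_law d (T : measurableType d) (P : probability T R) (X : T -> R) :
  measurable_fun setT X ->
  exists Q : probability R R, forall B, measurable B -> Q B = P (X @^-1` B).
Proof.
move=> mX.
pose X' : {mfun T >-> R} := HB.pack X (isMeasurableFun.Build _ _ _ _ X mX).
by exists (distribution P X').
Qed.

Lemma eq_measure_rays (m1 m2 : {measure set R -> \bar R}) :
  m1 setT < +oo ->
  (forall x : R, m1 `]x, +oo[%classic = m2 `]x, +oo[%classic) ->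
  forall A, measurable A -> m1 A = m2 A.
Proof.
move=> m1fin m12 A mA.
apply: (measure_unique (@RGenOInfty.G R) (fun k => `](- k%:R)%R, +oo[%classic)) => //.
- exact: RGenOInfty.measurableE.
- move=> _ _ [x ->] [y ->]; exists (Num.max x y).
  by apply/seteqP; split => z /=; rewrite !in_itv/= !andbT gt_max;
    [move=> [-> ->]|move=> /andP[]].
- by move=> k; exists (- k%:R)%R.
- rewrite -subTset => x _; exists (Num.truncn `|x|).+1 => //=.
  rewrite in_itv/= andbT ltrNl; apply: le_lt_trans (truncnS_gt _).
  by rewrite ler_normr lexx orbT.
- by move=> _ [x ->].
- move=> k; apply: le_lt_trans m1fin.
  by apply: le_measure; rewrite ?inE.
Qed.

Lemma product_law d (T : measurableType d) (P : probability T R)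
    (E1 E2 : probability R R) (X Y : T -> R) :
  measurable_fun setT X -> measurable_fun setT Y ->
  (forall A B, measurable A -> measurable B ->
     P (X @^-1` A `&` Y @^-1` B) = E1 A * E2 B) ->
  forall E, measurable E -> P [set w | E (X w, Y w)] = (E1 \x E2) E.
Proof.
move=> mX mY XY E mE.
have mXY : measurable_fun setT (fun w => (X w, Y w)).
  exact: measurable_fun_pair.
pose Z : {mfun T >-> (R * R)%type} :=
  HB.pack (fun w => (X w, Y w)) (isMeasurableFun.Build _ _ _ _ _ mXY).
apply/esym; exact: (@product_measure_unique _ _ _ _ _ E1 E2 (distribution P Z)).
Qed.

(** The rays form a pi-system generating the Borel sets, and the extension is made one variable at a
    time: with the event of the other variable fixed, both sides are finite measures. *)
Lemma indep_of_rays d (T : measurableType d) (P : probability T R)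
    (E1 E2 : probability R R) (X Y : T -> R) :
  measurable_fun setT X -> measurable_fun setT Y ->
  (forall x y : R, P (X @^-1` `]x, +oo[%classic `&` Y @^-1` `]y, +oo[%classic) =
     E1 `]x, +oo[%classic * E2 `]y, +oo[%classic) ->
  forall A B, measurable A -> measurable B ->
    P (X @^-1` A `&` Y @^-1` B) = E1 A * E2 B.
Proof.
move=> mX mY XY.
have mpre (Z : T -> R) A : measurable_fun setT Z -> measurable A ->
    measurable (Z @^-1` A).
  by move=> mZ mA; rewrite -[_ @^-1` _]setTI; exact: mZ.
pose push (Z : T -> R) (mZ : measurable_fun setT Z) : {mfun T >-> R} :=
  HB.pack Z (isMeasurableFun.Build _ _ _ _ Z mZ).
have fn (Q : probability R R) A : measurable A ->
    exists r : {nonneg R}, r%:num%:E = Q A.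
  move=> mA; have QA : Q A \is a fin_num by rewrite fin_num_measure.
  have r0 : (0 <= fine (Q A))%R by exact: fine_ge0.
  by exists (NngNum r0); rewrite /= fineK.
have step1 A y : measurable A ->
    P (X @^-1` A `&` Y @^-1` `]y, +oo[%classic) = E1 A * E2 `]y, +oo[%classic.
  move=> mA; have [//|r rE] := fn E2 `]y, +oo[%classic.
  have mYy : measurable (Y @^-1` `]y, +oo[%classic) by exact: mpre.
  rewrite -rE muleC.
  apply: (@eq_measure_rays
    (pushforward (mrestr P mYy) (push X mX)) (mscale r E1)) => //.
    change (P (setT `&` Y @^-1` `]y, +oo[%classic) < +oo).
    by rewrite setTI ltey_eq fin_num_measure.
  by move=> x; rewrite [LHS]XY -rE muleC.
move=> A B mA mB; have [//|r rE] := fn E1 A.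
have mXA : measurable (X @^-1` A) by exact: mpre.
rewrite -rE setIC.
apply: (@eq_measure_rays
  (pushforward (mrestr P mXA) (push Y mY)) (mscale r E2)) => //.
  change (P (setT `&` X @^-1` A) < +oo).
  by rewrite setTI ltey_eq fin_num_measure.
move=> y.
have yE : P (Y @^-1` `]y, +oo[%classic `&` X @^-1` A) =
    r%:num%:E * E2 `]y, +oo[%classic by rewrite setIC step1// rE.
exact: yE.
Qed.

End laws.

(** * The exponential law *)

Section exponential.
Context (R : realType).
Local Open Scope ereal_scope.
Implicit Types (r x y t al be : R).

(* Lebesgue measure lives on a copy of R with another display; [id] transports
   the exponential law to R itself. *)
Let lebesgueT : measurableType _ := measurableTypeR R.
Let toR : lebesgueT -> R := id.
Let mtoR : measurable_fun setT toR.
Proof. by move=> _ A mA; rewrite setTI. Qed.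

Lemma exists_exponential r : (0 < r)%R -> exists Q : probability R R,
  forall B, measurable B -> Q B = exponential_prob r B.
Proof.
move=> r0.
have [||Q' Q'E] := @exists_density _ lebesgueT R lebesgue_measure
  (exponential_pdf r) _ _ (integral_exponential_pdf r0).
- exact: measurable_exponential_pdf.
- by move=> x; rewrite exponential_pdf_ge0// ltW.
have [Q QE] := exists_law Q' mtoR.
by exists Q => B mB; rewrite QE// Q'E.
Qed.

Lemma ge0_integral_exponential r (Q : probability R R) (f : R -> \bar R) :
  (0 < r)%R -> (forall B, measurable B -> Q B = exponential_prob r B) ->
  measurable_fun setT f -> (forall x, 0 <= f x) ->
  \int[Q]_x f x =
  \int[@lebesgue_measure R]_x (f x * (exponential_pdf r x)%:E).
Proof.
move=> r0 QE mf f0.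
have [||Q' Q'E] := @exists_density _ lebesgueT R lebesgue_measure
  (exponential_pdf r) _ _ (integral_exponential_pdf r0).
- exact: measurable_exponential_pdf.
- by move=> x; rewrite exponential_pdf_ge0// ltW.
pose toR' : {mfun lebesgueT >-> R} :=
  HB.pack toR (isMeasurableFun.Build _ _ _ _ toR mtoR).
rewrite (eq_measure_integral (pushforward Q' toR')); last first.
  by move=> A mA _; rewrite [LHS]QE//; apply: esym; exact: Q'E.
rewrite ge0_integral_pushforward//.
apply: (@ge0_integral_density _ lebesgueT R lebesgue_measure Q'
  (exponential_pdf r)) => //.
- exact: measurable_exponential_pdf.
- by move=> x; rewrite exponential_pdf_ge0// ltW.
Qed.

Lemma exponential_prob_lt0 r : exponential_prob r `]-oo, 0%R[ = 0.
Proof.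
apply: integral0_eq => x /=; rewrite in_itv/= => x0.
by rewrite lt0_exponential_pdf.
Qed.

Lemma exponential_prob_gt r x : (0 < r)%R -> (0 <= x)%R ->
  exponential_prob r `]x, +oo[ = (expR (- r * x))%:E.
Proof.
move=> r0 x0; have [Q QE] := exists_exponential r0.
rewrite -QE// -setCitvl probability_setC//.
have -> : `]-oo, x]%classic = `]-oo, 0%R[ `|` `[0%R, x] :> set R.
  apply/seteqP; split => z /=; rewrite !in_itv/=.
    by move=> zx; case: (ltP z 0%R) => z0; [left|right].
  by case=> [z0|/andP[]//]; exact: (le_trans (ltW z0)).
have -> : Q (`]-oo, 0%R[ `|` `[0%R, x]) = Q `]-oo, 0%R[%classic + Q `[0%R, x]%classic.
  rewrite measureU//; apply/seteqP; split => z //=.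
  by rewrite !in_itv/= => -[z0 /andP[z0' _]]; move: z0; rewrite ltNge z0'.
rewrite !QE// exponential_prob_lt0 add0e.
move: x0; rewrite le_eqVlt => /predU1P[<-|x0].
  rewrite /exponential_prob set_itv1 integral_set1 sube0.
  by rewrite mulr0 expR0.
rewrite exponential_prob_itv0c//.
by rewrite -!EFinB subKr.
Qed.

Lemma mulIe (a b p : \bar R) : p \is a fin_num -> p != 0 ->
  a * p = b * p -> a = b.
Proof.
move=> pfin p0 /(congr1 (fun z => z * (fine p)^-1%:E)).
have fp0 : fine p != 0%R by rewrite fine_eq0.
by rewrite -!muleA -{1 3}(fineK pfin) -EFinM mulfV// !mule1.
Qed.

End exponential.

(** * The Burke property at a single vertex *)

Section vertex.
Context d (T : measurableType d) (R : realType) (P : probability T R).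
Local Open Scope ereal_scope.
Implicit Types (x y t : R).

Let mpre (Z : T -> R) A : measurable_fun setT Z -> measurable A ->
  measurable (Z @^-1` A).
Proof. by move=> mZ mA; rewrite -[_ @^-1` _]setTI; exact: mZ. Qed.

Lemma exponential_diff (al be t : R) (U V : T -> R) :
  (0 < al)%R -> (0 < be)%R -> (al + be = 1)%R -> (0 <= t)%R ->
  measurable_fun setT U -> measurable_fun setT V ->
  (forall A B, measurable A -> measurable B ->
    P (U @^-1` A `&` V @^-1` B) = exponential_prob al A * exponential_prob be B) ->
  P [set w | (t < U w - V w)%R] = (be * expR (- al * t))%:E.
Proof.
move=> al0 be0 albe t0 mU mV UV.
have [Ea EaE] := exists_exponential al0.
have [Eb EbE] := exists_exponential be0.
pose E := [set z : R * R | (t < z.2 - z.1)%R].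
have mE : measurable E.
  rewrite (_ : E = (fun z : R * R => z.2 - z.1)%R @^-1` `]t, +oo[); last first.
    by apply/seteqP; split => z /=; rewrite in_itv/= andbT.
  rewrite -[_ @^-1` _]setTI; apply: measurable_funB => //.
rewrite -[LHS]/(P [set w | E (V w, U w)]).
rewrite (@product_law _ _ _ _ Eb Ea)//; last first.
  by move=> A B mA mB; rewrite setIC (UV _ _ mB mA) (EaE _ mB) (EbE _ mA) muleC.
have secE v : xsection E v = `](v + t)%R, +oo[%classic.
  apply/seteqP; split => u; rewrite /xsection/= inE /E/= in_itv/= andbT.
    by rewrite ltrBrDl.
  by rewrite ltrBrDl.
rewrite [LHS](ge0_integral_exponential be0 EbE)//.
(* Given [V = v], the tail of [U] at [v + t] contributes [exp (- al v)]. Since [al + be = 1], its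
   product with the density of rate [be] is [be] times the density of rate 1. *)
- transitivity (\int[@lebesgue_measure R]_v ((be * expR (- al * t))%:E *
                                  (exponential_pdf 1 v)%:E)).
    apply: eq_integral => v _; have [v0|v0] := ltP v 0%R.
      by rewrite !lt0_exponential_pdf// !mule0.
    rewrite /= secE EaE// exponential_prob_gt ?addr_ge0//.
    rewrite -!EFinM !exponential_pdfE///=.
    congr EFin; rewrite mul1r -mulrA -expRD mulrCA -expRD; congr (_ * expR _)%R.
    by rewrite (_ : be = 1 - al)%R; [ring|rewrite -albe addrC addKr].
  rewrite ge0_integralZl//.
  + by rewrite integral_exponential_pdf// mule1.
  + by apply/measurable_EFinP; exact: measurable_exponential_pdf.
  + by move=> v _; rewrite lee_fin exponential_pdf_ge0.
  + by rewrite lee_fin mulr_ge0 ?expR_ge0// ltW.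
- exact: measurable_fun_xsection.
Qed.

Section triple.
Variables (al be : R) (U V W : T -> R).
Hypotheses (al0 : (0 < al)%R) (be0 : (0 < be)%R) (albe : (al + be = 1)%R).
Hypotheses (mU : measurable_fun setT U) (mV : measurable_fun setT V)
  (mW : measurable_fun setT W).
Hypothesis UVW : forall A B C, measurable A -> measurable B -> measurable C ->
  P (U @^-1` A `&` V @^-1` B `&` W @^-1` C) =
  exponential_prob al A * exponential_prob be B * exponential_prob 1 C.

Let D w := (U w - V w)%R.
Let mD : measurable_fun setT D. Proof. exact: measurable_funB. Qed.

Let expT (r : R) : (0 < r)%R -> exponential_prob r setT = 1.
Proof.
by move=> r0; have [Q QE] := exists_exponential r0; rewrite -QE// probability_setT.
Qed.

Let PW C : measurable C -> P (W @^-1` C) = exponential_prob 1 C.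
Proof.
move=> mC; have := UVW (@measurableT _ R) (@measurableT _ R) mC.
by rewrite !preimage_setT !setTI => ->; rewrite !expT// !mul1e.
Qed.

Let PUV A B : measurable A -> measurable B ->
  P (U @^-1` A `&` V @^-1` B) = exponential_prob al A * exponential_prob be B.
Proof.
move=> mA mB; have := UVW mA mB (@measurableT _ R).
by rewrite !preimage_setT !setIT => ->; rewrite !expT// !mule1.
Qed.

(** Conditionally on [W] in [C] the pair [(U, V)] keeps its product law, so the difference keeps its
    law. *)
Lemma diff_indep A C : measurable A -> measurable C ->
  P (W @^-1` C `&` D @^-1` A) = exponential_prob 1 C * P (D @^-1` A).
Proof.
move=> mA mC; have mWC : measurable (W @^-1` C) by exact: mpre.
have mDA : measurable (D @^-1` A) by exact: mpre.
have [Ea EaE] := exists_exponential al0.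
have [Eb EbE] := exists_exponential be0.
have [PC0|PC0] := eqVneq (P (W @^-1` C)) 0.
  rewrite -PW// PC0 mul0e; apply/eqP; rewrite eq_le measure_ge0 andbT -PC0.
  by apply: le_measure; rewrite ?inE//; exact: measurableI.
have [Q QE] := exists_cond mWC PC0.
have QUV A' B : measurable A' -> measurable B ->
    Q (U @^-1` A' `&` V @^-1` B) = Ea A' * Eb B.
  move=> mA' mB; apply: (mulIe _ PC0); first by rewrite fin_num_measure.
  rewrite -QE; last by apply: measurableI; exact: mpre.
  by rewrite UVW// EaE// EbE// PW.
have mE : measurable [set z : R * R | A (z.1 - z.2)%R].
  by rewrite -[X in measurable X]setTI; apply: measurable_funB.
have QD : Q (D @^-1` A) = P (D @^-1` A).
  rewrite (product_law mU mV QUV mE).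
  by rewrite -(@product_law _ _ _ P Ea Eb U V)// => A' B mA' mB; rewrite PUV// EaE// EbE.
by rewrite setIC QE// QD muleC PW.
Qed.

(** Split by the size of [W]. If [W > x], both inequalities hold. If [W <= x], the first one says
    [U - V > x - W], which makes [V - U] negative and reduces the second one to [y < W]. Integrating
    the second piece over [W] completes [exp (- x)] to the product. *)
Lemma vertex_rays_le x y : (0 <= y)%R -> (y <= x)%R ->
  P [set w | (x < W w + Num.max (U w - V w) 0)%R /\
             (y < W w + Num.max (V w - U w) 0)%R] =
  (expR (- al * x) * expR (- be * y))%:E.
Proof.
move=> y0 yx; have x0 : (0 <= x)%R := le_trans y0 yx.
have [E1 E1E] := exists_exponential (@ltr01 R).
have [Eb EbE] := exists_exponential be0.
have [De DeE] := exists_law P mD.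
pose E := [set z : R * R | (y < z.1 <= x)%R /\ (x - z.1 < z.2)%R].
have mE : measurable E.
  rewrite (_ : E = ((fun z : R * R => z.1) @^-1` `]y, x]) `&`
      ((fun z : R * R => z.1 + z.2)%R @^-1` `]x, +oo[)); last first.
    apply/seteqP; split => z /=; rewrite !in_itv/= andbT.
      by move=> [h1 h2]; split => //; lra.
    by move=> [h1 h2]; split => //; lra.
  apply: measurableI; rewrite -[_ @^-1` _]setTI.
    exact: measurable_fst.
  by apply: measurable_funD.
have -> : [set w | (x < W w + Num.max (U w - V w) 0)%R /\
             (y < W w + Num.max (V w - U w) 0)%R] =
    (W @^-1` `]x, +oo[) `|` [set w | E (W w, D w)].
  apply/seteqP; split => w /=; rewrite /E /D/= in_itv/= andbT.
    move=> []; have [xW _ _|Wx] := ltP x (W w); first by left.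
    by have [h|h] := leP (U w - V w)%R 0%R; have [h'|h'] := leP (V w - U w)%R 0%R;
       move=> ? ?; right; split; lra.
  move=> [xW|[/andP[h1 h2] h3]].
    by rewrite !ltr_wpDr ?le_max ?lexx ?orbT// (le_lt_trans yx).
  split; last by rewrite ltr_wpDr ?le_max ?lexx ?orbT.
  by rewrite -ltrBlDl lt_max h3.
have mEW : measurable [set w | E (W w, D w)].
  by rewrite -[X in measurable X]setTI; apply: measurable_fun_pair.
have mWx : measurable (W @^-1` `]x, +oo[) by exact: mpre.
have -> : P (W @^-1` `]x, +oo[ `|` [set w | E (W w, D w)]) =
    P (W @^-1` `]x, +oo[) + P [set w | E (W w, D w)].
  rewrite measureU//; apply/seteqP; split => w //=.
  rewrite in_itv/= andbT => -[xW [/andP[_ Wx] _]].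
  by move: xW; rewrite ltNge Wx.
rewrite PW// exponential_prob_gt//.
rewrite (@product_law _ _ _ P E1 De)//; last first.
  by move=> A B mA mB; rewrite diff_indep// E1E// DeE.
rewrite [X in _ + X](ge0_integral_exponential _ E1E)//; last first.
  exact: measurable_fun_xsection.
transitivity ((expR (-1 * x))%:E +
    \int[@lebesgue_measure R]_v ((expR (- al * x))%:E *
    ((EFin \o exponential_pdf be) \_ `]y, x]%classic) v)).
  congr (_ + _); apply: eq_integral => v _; rewrite patchE /=.
  have -> : xsection E v = if v \in `]y, x]%classic then `](x - v)%R, +oo[%classic
                           else set0.
    apply/seteqP; split => u; rewrite /xsection/= inE /E/=.
      by move=> [h1 h2]; rewrite ifT ?inE/= ?in_itv/= ?andbT.
    by case: ifPn; rewrite ?inE//= !in_itv/= andbT.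
  case: ifPn => [|_]; last by rewrite /= measure0 mul0e mule0.
  rewrite inE/= in_itv/= => /andP[yv vx].
  rewrite DeE// (_ : _ @^-1` _ = [set w | (x - v < U w - V w)%R]); last first.
    by apply/seteqP; split => w /=; rewrite in_itv/= andbT.
  rewrite (@exponential_diff al be)// ?subr_ge0//.
  have v0 : (0 <= v)%R by rewrite (le_trans y0)// ltW.
  rewrite -!EFinM !exponential_pdfE///=; congr EFin.
  rewrite mul1r -mulrA -expRD mulrCA -expRD; congr (_ * expR _)%R.
  by rewrite (_ : be = 1 - al)%R; [ring|rewrite -albe addrC addKr].
rewrite ge0_integralZl//; last 2 first.
- apply/(measurable_restrictT _ _).1 => //; apply: measurable_funTS.
  by apply/measurable_EFinP; exact: measurable_exponential_pdf.
- by move=> v _; apply: erestrict_ge0 => u _; rewrite lee_fin exponential_pdf_ge0// ltW.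
rewrite -integral_mkcond -/(exponential_prob be `]y, x]%classic).
have -> : exponential_prob be `]y, x]%classic =
    (expR (- be * y) - expR (- be * x))%:E.
  have : exponential_prob be `]y, +oo[ = exponential_prob be `]y, x] +
         exponential_prob be `]x, +oo[.
    rewrite -!EbE// -[RHS]measureU//.
      congr (Eb _); apply/seteqP; split => z /=; rewrite !in_itv/= !andbT.
        by move=> yz; have [zx|xz] := leP z x; [left; rewrite yz|right].
      by case=> [/andP[]//|]; exact: le_lt_trans.
    apply/seteqP; split => z //=; rewrite !in_itv/= andbT => -[/andP[_ zx]].
    by rewrite ltNge zx.
  rewrite !exponential_prob_gt// EFinB => ->.
  by rewrite addeK// .
rewrite -EFinM -EFinD; congr EFin; rewrite mulrBr.
rewrite (_ : expR (-1 * x) = expR (- al * x) * expR (- be * x))%R.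
  by rewrite addrC subrK.
by rewrite -expRD -mulrDl -opprD albe.
Qed.

End triple.

Lemma vertex_rays (al be : R) (U V W : T -> R) x y :
  (0 < al)%R -> (0 < be)%R -> (al + be = 1)%R ->
  measurable_fun setT U -> measurable_fun setT V -> measurable_fun setT W ->
  (forall A B C, measurable A -> measurable B -> measurable C ->
    P (U @^-1` A `&` V @^-1` B `&` W @^-1` C) =
    exponential_prob al A * exponential_prob be B * exponential_prob 1 C) ->
  (0 <= x)%R -> (0 <= y)%R ->
  P [set w | (x < W w + Num.max (U w - V w) 0)%R /\
             (y < W w + Num.max (V w - U w) 0)%R] =
  (expR (- al * x) * expR (- be * y))%:E.
Proof.
move=> al0 be0 albe mU mV mW UVW x0 y0; have [yx|xy] := leP y x.
  exact: vertex_rays_le.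
have VUW B A C : measurable B -> measurable A -> measurable C ->
    P (V @^-1` B `&` U @^-1` A `&` W @^-1` C) =
    exponential_prob be B * exponential_prob al A * exponential_prob 1 C.
  move=> mB mA mC; rewrite (setIC (_ @^-1` _)) (UVW _ _ _ mA mB mC).
  by rewrite (muleC (exponential_prob al A)).
have beal : (be + al = 1)%R by rewrite addrC.
have := vertex_rays_le be0 al0 beal mV mU mW VUW x0 (ltW xy).
rewrite mulrC => <-.
by congr (P _); apply/seteqP; split => w [].
Qed.

Lemma exponential_prob_ray (r x : R) : (0 < r)%R ->
  exponential_prob r `]x, +oo[ = (expR (- r * Num.max x 0))%:E.
Proof.
move=> r0; have [x0|x0] := ltP x 0%R; last exact: exponential_prob_gt.
have [Q QE] := exists_exponential r0.
rewrite -QE// mulr0 expR0; apply/eqP; rewrite eq_le probability_le1//=.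
have -> : 1 = Q `]0%R, +oo[%classic.
  by rewrite QE// exponential_prob_gt// mulr0 expR0.
apply: le_measure; rewrite ?inE// => z /=; rewrite !in_itv/= !andbT.
exact: lt_trans.
Qed.

(** Joint tails determine the law, and [vertex_rays] gives them at nonnegative thresholds. A
    negative threshold may be replaced by 0 on the event [O] that both outputs are positive, which
    has probability one. *)
Lemma burke_vertex (al be : R) (U V W : T -> R) :
  (0 < al)%R -> (0 < be)%R -> (al + be = 1)%R ->
  measurable_fun setT U -> measurable_fun setT V -> measurable_fun setT W ->
  (forall A B C, measurable A -> measurable B -> measurable C ->
    P (U @^-1` A `&` V @^-1` B `&` W @^-1` C) =
    exponential_prob al A * exponential_prob be B * exponential_prob 1 C) ->
  forall A B, measurable A -> measurable B ->
  P ((fun w => W w + Num.max (U w - V w) 0)%R @^-1` A `&`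
     (fun w => W w + Num.max (V w - U w) 0)%R @^-1` B) =
  exponential_prob al A * exponential_prob be B.
Proof.
move=> al0 be0 albe mU mV mW UVW A B mA mB.
have [Ea EaE] := exists_exponential al0.
have [Eb EbE] := exists_exponential be0.
set U' := (fun w => W w + Num.max (U w - V w) 0)%R.
set V' := (fun w => W w + Num.max (V w - U w) 0)%R.
have mU' : measurable_fun setT U'.
  by apply: measurable_funD => //; apply: measurable_maxr => //; exact: measurable_funB.
have mV' : measurable_fun setT V'.
  by apply: measurable_funD => //; apply: measurable_maxr => //; exact: measurable_funB.
rewrite -(EaE _ mA) -(EbE _ mB).
apply: (indep_of_rays mU' mV') => // x y; rewrite EaE// EbE//.
rewrite !exponential_prob_ray// -EFinM.
rewrite -(vertex_rays al0 be0 albe mU mV mW UVW) ?le_max ?lexx ?orbT//.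
pose O := [set w | (0 < U' w)%R /\ (0 < V' w)%R].
have mO : measurable O.
  rewrite (_ : O = U' @^-1` `]0%R, +oo[ `&` V' @^-1` `]0%R, +oo[).
    by apply: measurableI; exact: mpre.
  by apply/seteqP; split => w; rewrite /O/= !in_itv/= !andbT.
have PO : P O = 1.
  have := vertex_rays al0 be0 albe mU mV mW UVW (lexx 0%R) (lexx 0%R).
  by rewrite !mulr0 expR0 mulr1.
have PI E : measurable E -> P E = P (E `&` O).
  move=> mE; rewrite -[in LHS](setIT E) -(setvU O) setIUr.
  have -> : P (E `&` ~` O `|` E `&` O) = P (E `&` ~` O) + P (E `&` O).
    rewrite measureU//.
    - by apply: measurableI => //; exact: measurableC.
    - exact: measurableI.
    - by rewrite setIACA setICl setI0.
  have -> : P (E `&` ~` O) = 0; last by rewrite add0e.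
  apply/eqP; rewrite eq_le measure_ge0 andbT.
  have <- : P (~` O) = 0 by rewrite probability_setC// PO subee.
  apply: le_measure; rewrite ?inE//; last exact: measurableC.
  by apply: measurableI => //; exact: measurableC.
have mE (x' y' : R) : measurable [set w | (x' < U' w)%R /\ (y' < V' w)%R].
  rewrite (_ : [set w | _] = U' @^-1` `]x', +oo[ `&` V' @^-1` `]y', +oo[).
    by apply: measurableI; exact: mpre.
  by apply/seteqP; split => w; rewrite /=!in_itv/= !andbT.
rewrite (_ : _ `&` _ = [set w | (x < U' w)%R /\ (y < V' w)%R]); last first.
  by apply/seteqP; split => w; rewrite /=!in_itv/= !andbT.
rewrite PI// [RHS]PI//; congr (P _); apply/seteqP; split => w [[h1 h2] [h3 h4]].
  by split => //=; rewrite !gt_max; split; apply/andP.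
by move: h1 h2; rewrite !gt_max => /andP[h1 _] /andP[h2 _]; split.
Qed.

End vertex.

(** * Families of independent exponential variables *)

Section independence.
Context d (T : measurableType d) (R : realType).
Local Open Scope ereal_scope.

(** Measurability and sure nonnegativity hold at all indices, independence and the laws only on [D].
    The index set can thus shrink while the family remains a total function. *)
Definition independent_exponentials (P : probability T R) (K : choiceType)
    (D : set K) (r : K -> R) (X : K -> T -> R) : Prop :=
  [/\ forall i, measurable_fun setT (X i),
      forall i w, (0 <= X i w)%R,
      mutually_independent P D X &
      forall i, D i -> (0 < r i)%R /\
        forall B, measurable B -> P (X i @^-1` B) = exponential_prob (r i) B].

Let mpre (Z : T -> R) A : measurable_fun setT Z -> measurable A ->
  measurable (Z @^-1` A).
Proof. by move=> mZ mA; rewrite -[_ @^-1` _]setTI; exact: mZ. Qed.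

Section lemmas.
Variables (P : probability T R) (K : choiceType).
Implicit Types (D : set K) (r : K -> R) (X : K -> T -> R) (s : seq K).

Let box X s (B : K -> set R) := \bigcap_(l in [set` s]) X l @^-1` B l.

Lemma measurable_box X s B : (forall i, measurable_fun setT (X i)) ->
  (forall i, measurable (B i)) -> measurable (box X s B).
Proof.
move=> mX mB; apply: fin_bigcap_measurable => // i _; exact: mpre.
Qed.

(** Coordinate [i] is split off whether or not it occurs in [s]; if it does not, its constraint is
    the whole line, which costs no probability. This avoids a case distinction each time one
    coordinate is singled out. *)
Lemma box_split X Y s B i : (forall l, l != i -> l \in s -> X l = Y l) ->
  box X s B = X i @^-1` (if i \in s then B i else setT) `&`
              box Y [seq l <- s | l != i] B.
Proof.
move=> XY; apply/seteqP; split => w.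
  move=> H; split; first by rewrite /=; case: ifPn => // si; exact: H.
  move=> l /=; rewrite mem_filter => /andP[li ls].
  by rewrite -XY//; exact: H.
move=> [/= Hi H] l /= ls; have [li|li] := eqVneq l i.
  by move: Hi; rewrite -li ls.
by rewrite /= XY//; apply: H; rewrite /= mem_filter li.
Qed.

Lemma prod_split (F : K -> \bar R) s i : uniq s ->
  \prod_(l <- s) F l = (if i \in s then F i else 1) *
                       \prod_(l <- [seq l <- s | l != i]) F l.
Proof.
move=> us; case: ifPn => si; first by rewrite (bigD1_seq i)// big_filter.
rewrite mul1e; congr (\big[_/_]_(l <- _) _).
by apply/esym/all_filterP/allP => l ls; apply: contraNneq si => <-.
Qed.

Lemma independent_exponentials_box D r X s B :
  independent_exponentials P D r X -> uniq s -> (forall i, i \in s -> D i) ->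
  (forall i, measurable (B i)) ->
  P (box X s B) = \prod_(i <- s) exponential_prob (r i) (B i).
Proof.
move=> [_ _ iX lX] us sD mB; rewrite iX//.
by apply: eq_big_seq => i /sD /lX[_ ->].
Qed.

Lemma independent_exponentialsP D r X :
  (forall i, measurable_fun setT (X i)) -> (forall i w, (0 <= X i w)%R) ->
  (forall i, D i -> (0 < r i)%R) ->
  (forall s B, uniq s -> (forall i, i \in s -> D i) ->
    (forall i, measurable (B i)) ->
    P (box X s B) = \prod_(i <- s) exponential_prob (r i) (B i)) ->
  independent_exponentials P D r X.
Proof.
move=> mX X0 r0 H.
have lX i B : D i -> measurable B -> P (X i @^-1` B) = exponential_prob (r i) B.
  move=> Di mB; have := H [:: i] (fun=> B).
  rewrite big_seq1 => <-//.
    congr (P _); apply/seteqP; split => w /=; first by move=> ? l /=; rewrite inE => /eqP ->.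
    by move=> /(_ i); apply; rewrite /= inE.
  by move=> j; rewrite inE => /eqP ->.
split => //.
- move=> s B us sD mB; rewrite -[LHS]/(P (box X s B)) H//.
  by apply: eq_big_seq => i /sD Di; rewrite lX.
- by move=> i Di; split; [exact: r0|move=> B mB; exact: lX].
Qed.

Lemma independent_exponentials_sub D D' r X : D' `<=` D ->
  independent_exponentials P D r X -> independent_exponentials P D' r X.
Proof.
move=> D'D [mX X0 iX lX]; split => //; last by move=> i /D'D; exact: lX.
by move=> s B us sD mB; apply: iX => // i /sD /D'D.
Qed.

Lemma independent_exponentials_rate D r r' X : (forall i, D i -> r i = r' i) ->
  independent_exponentials P D r X -> independent_exponentials P D r' X.
Proof. by move=> rr' [mX X0 iX lX]; split => // i Di; rewrite -rr'//; exact: lX. Qed.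

Lemma exponential_prob_setT (r : R) : (0 < r)%R -> exponential_prob r setT = 1.
Proof.
by move=> r0; have [Q QE] := exists_exponential r0; rewrite -QE// probability_setT.
Qed.

Lemma exponential_of_rays (r : R) (Y : T -> R) : (0 < r)%R ->
  measurable_fun setT Y ->
  (forall x : R, P (Y @^-1` `]x, +oo[) = (expR (- r * Num.max x 0))%:E) ->
  forall B, measurable B -> P (Y @^-1` B) = exponential_prob r B.
Proof.
move=> r0 mY tl B mB.
have [Q QE] := exists_law P mY; have [E EE] := exists_exponential r0.
rewrite -QE// -EE//; apply: eq_measure_rays => //.
  by rewrite ltey_eq fin_num_measure.
move=> x.
have Qx : Q `]x, +oo[%classic = (expR (- r * Num.max x 0))%:E by rewrite QE.
have Ex : E `]x, +oo[%classic = (expR (- r * Num.max x 0))%:E.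
  by rewrite EE// exponential_prob_ray.
exact: etrans Qx (esym Ex).
Qed.

Lemma independent_exponentials_map D r r' X (f : K -> R -> R) :
  (forall i, measurable_fun setT (f i)) -> (forall i w, (0 <= f i (X i w))%R) ->
  (forall i, measurable_fun setT (X i)) -> mutually_independent P D X ->
  (forall i, D i -> (0 < r' i)%R /\ forall x : R,
    P [set w | (x < f i (X i w))%R] = (expR (- r' i * Num.max x 0))%:E) ->
  independent_exponentials P D r' (fun i w => f i (X i w)).
Proof.
move=> mf f0 mX iX tl; split => //.
- by move=> i; apply: measurableT_comp.
- move=> s B us sD mB; rewrite -(iX s (fun i => f i @^-1` B i))// => i.
  by rewrite -[_ @^-1` _]setTI; exact: mf.
- move=> i /tl[ri0 tli]; split => //; apply: exponential_of_rays => //.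
    by apply: measurableT_comp.
  move=> x; rewrite -tli; congr (P _).
  by apply/seteqP; split => w; rewrite /= in_itv/= andbT.
Qed.

Lemma independent_exponentials_scale D r X (c : K -> R) :
  (forall i, 0 < c i)%R -> independent_exponentials P D r X ->
  independent_exponentials P D (fun i => r i / c i)%R (fun i w => c i * X i w)%R.
Proof.
move=> c0 [mX X0 iX lX].
apply: (@independent_exponentials_map _ r _ X (fun i x => c i * x)%R) => //.
- by move=> i; exact: measurable_funM.
- by move=> i w; rewrite mulr_ge0// ltW.
- move=> i Di; have [ri0 li] := lX i Di; split; first exact: divr_gt0.
  move=> x; rewrite (_ : [set w | _] = X i @^-1` `](x / c i)%R, +oo[); last first.
    by apply/seteqP; split => w; rewrite /= in_itv/= andbT ltr_pdivrMr// mulrC.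
  rewrite li// exponential_prob_ray//; congr (expR _)%:E.
  rewrite -!mulNr -!mulrA; congr (_ * _)%R.
  by rewrite maxr_pMr ?invr_ge0 ?ltW// mulr0 mulrC.
Qed.

Lemma independent_exponentials_pos D r X :
  (forall i, measurable_fun setT (X i)) -> mutually_independent P D X ->
  (forall i, D i -> (0 < r i)%R /\
     forall B, measurable B -> P (X i @^-1` B) = exponential_prob (r i) B) ->
  independent_exponentials P D r (fun i w => Num.max (X i w) 0)%R.
Proof.
move=> mX iX lX.
apply: (@independent_exponentials_map _ r _ X (fun=> fun x => Num.max x 0)%R) => //.
- by move=> i; exact: measurable_maxr.
- by move=> i w; rewrite le_max lexx orbT.
- move=> i /lX[ri0 li]; split => // x.
  have [x0|x0] := ltP x 0%R.
    rewrite mulr0 expR0 -[RHS](probability_setT P); congr (P _).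
    by apply/seteqP; split => // w _ /=; rewrite lt_max x0 orbT.
  rewrite -exponential_prob_gt// -li//; congr (P _).
  by apply/seteqP; split => w; rewrite /= in_itv/= andbT lt_max// (ltNge x 0%R) x0 orbF.
Qed.

End lemmas.

Lemma independent_exponentials_reindex (P : probability T R) (K K' : choiceType)
    (phi : K' -> K) (D : set K) (D' : set K') (r : K -> R) (X : K -> T -> R) :
  (forall i, D' i -> D (phi i)) -> {in D' &, injective phi} ->
  independent_exponentials P D r X ->
  independent_exponentials P D' (r \o phi) (X \o phi).
Proof.
move=> D'D inj [mX X0 iX lX]; split => //=; last by move=> i /D'D; exact: lX.
move=> s B us sD mB.
have [s0|[i0 _]] : s = [::] \/ exists i0 : K', i0 \in s.
- by case: (s) => [|i0 s']; [left|right; exists i0; rewrite inE eqxx].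
- by rewrite s0 big_nil set_nil bigcap_set0 probability_setT.
have injs : {in s &, injective phi}.
  by move=> i j si sj; apply: inj; rewrite inE; exact: sD.
(* [B'] transports [B] along [phi] by looking up positions in [map phi s]. The lookup needs the
   default value [i0], hence the separate treatment of the empty sequence. *)
pose B' j := B (nth i0 s (index j (map phi s))).
have B'E i : i \in s -> B' (phi i) = B i.
  move=> si; congr B; apply: injs => //.
    by apply: mem_nth; rewrite -(size_map phi) index_mem map_f.
  by rewrite -[LHS](nth_map i0 (phi i0)) ?nth_index ?map_f// -(size_map phi) index_mem map_f.
transitivity (\prod_(j <- map phi s) P (X j @^-1` B' j)); last first.
  by rewrite big_map; apply: eq_big_seq => i si; rewrite B'E.
have us' : uniq (map phi s) by rewrite map_inj_in_uniq.
have sD' j : j \in map phi s -> D j by move=> /mapP[i si ->]; apply/D'D/sD.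
have mB' j : measurable (B' j) by exact: mB.
rewrite -(iX _ _ us' sD' mB').
congr (P _); apply/seteqP; split => w H /= j /=.
  by move=> /mapP[i si ->]; rewrite B'E//; exact: H.
by move=> js; rewrite -B'E//; apply: H; rewrite /= map_f.
Qed.

End independence.

(** * Burke flips and exponential tilts of a family *)

Section transformations.
Context d (T : measurableType d) (R : realType).
Local Open Scope ereal_scope.

Let mpre (Z : T -> R) A : measurable_fun setT Z -> measurable A ->
  measurable (Z @^-1` A).
Proof. by move=> mZ mA; rewrite -[_ @^-1` _]setTI; exact: mZ. Qed.

Local Notation box X s B := (\bigcap_(l in [set` s]) X l @^-1` B l).

Section flip.
Variables (P : probability T R) (K : choiceType) (D : set K) (r : K -> R).
Variables (X : K -> T -> R) (i j k : K).
Hypothesis HX : independent_exponentials P D r X.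
Hypotheses (Di : D i) (Dj : D j) (Dk : D k).
Hypotheses (ij : i != j) (ik : i != k) (jk : j != k).
Hypotheses (rij : (r i + r j = 1)%R) (rk : (r k = 1)%R).

(** One vertex of the lattice: [i] and [j] hold the incoming increments and [k] the bulk weight. The
    outgoing increments are stored at the same two indices. *)
Definition flip (l : K) : T -> R :=
  if l == i then fun w => (X k w + Num.max (X i w - X j w) 0)%R
  else if l == j then fun w => (X k w + Num.max (X j w - X i w) 0)%R
  else X l.

Let flipi : flip i = fun w => (X k w + Num.max (X i w - X j w) 0)%R.
Proof. by rewrite /flip eqxx. Qed.

Let flipj : flip j = fun w => (X k w + Num.max (X j w - X i w) 0)%R.
Proof. by rewrite /flip eq_sym (negbTE ij) eqxx. Qed.

(** Conditioning on a box of the other coordinates leaves the triple at [i], [j], [k] with its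
    product law, so [burke_vertex] applies under the conditional probability. *)
Let flip_box (s : seq K) (B : K -> set R) A C : uniq s ->
  (forall l, l \in s -> [/\ D l, l != i, l != j & l != k]) ->
  (forall l, measurable (B l)) -> measurable A -> measurable C ->
  P (flip i @^-1` A `&` (flip j @^-1` C `&` box X s B)) =
  exponential_prob (r i) A * (exponential_prob (r j) C * P (box X s B)).
Proof.
move=> us sD mB mA mC; have [mX X0 iX lX] := HX.
have mbox : measurable (box X s B) by exact: measurable_box.
have mfi : measurable_fun setT (flip i).
  rewrite flipi; apply: measurable_funD => //.
  by apply: measurable_maxr => //; exact: measurable_funB.
have mfj : measurable_fun setT (flip j).
  rewrite flipj; apply: measurable_funD => //.
  by apply: measurable_maxr => //; exact: measurable_funB.
have mAC : measurable (flip i @^-1` A `&` flip j @^-1` C).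
  by apply: measurableI; exact: mpre.
rewrite setIA; have [P0|P0] := eqVneq (P (box X s B)) 0.
  rewrite P0 !mule0; apply/eqP; rewrite eq_le measure_ge0 andbT -P0.
  by apply: le_measure; rewrite ?inE//; exact: measurableI.
have [Q QE] := exists_cond mbox P0.
rewrite (QE _ mAC) muleA; congr (_ * _); rewrite flipi flipj.
have [[ri0 _] [rj0 _]] := (lX _ Di, lX _ Dj).
apply: burke_vertex => // A' C' E' mA' mC' mE'.
have PB0 : P (box X s B) \is a fin_num by rewrite fin_num_measure.
apply: (mulIe PB0 P0); rewrite -QE; last first.
  by apply: measurableI; [apply: measurableI|]; exact: mpre.
pose B' l := if l == i then A' else if l == j then C' else
             if l == k then E' else B l.
have mB' l : measurable (B' l) by rewrite /B'; do 3 case: ifP => // _.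
have B'i : B' i = A' by rewrite /B' eqxx.
have B'j : B' j = C' by rewrite /B' eq_sym (negbTE ij) eqxx.
have B'k : B' k = E'.
  by rewrite /B' eq_sym (negbTE ik) eq_sym (negbTE jk) eqxx.
have B's l : l \in s -> B' l = B l.
  by move=> /sD[_ li lj lk]; rewrite /B' (negbTE li) (negbTE lj) (negbTE lk).
have us' : uniq [:: i, j, k & s].
  rewrite /= us !inE !negb_or ij ik jk /= !andbT.
  by apply/and3P; split; apply/negP => /sD[_]; rewrite eqxx.
have sD' l : l \in [:: i, j, k & s] -> D l.
  by rewrite !inE => /or4P[/eqP ->|/eqP ->|/eqP ->|/sD[]].
have -> : X i @^-1` A' `&` X j @^-1` C' `&` X k @^-1` E' `&` box X s B =
          box X [:: i, j, k & s] B'.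
  apply/seteqP; split => w.
    move=> [[[h1 h2] h3] h4] l /=; rewrite !inE => /or4P[/eqP ->|/eqP ->|/eqP ->|ls].
    - by rewrite B'i.
    - by rewrite B'j.
    - by rewrite B'k.
    - by rewrite B's//; exact: h4.
  move=> H; split; first split; first split.
  - by have := H i; rewrite B'i; apply; rewrite /= !inE eqxx.
  - by have := H j; rewrite B'j; apply; rewrite /= !inE eqxx orbT.
  - by have := H k; rewrite B'k; apply; rewrite /= !inE eqxx !orbT.
  - by move=> l /= ls; rewrite -B's//; apply: H; rewrite /= !inE ls !orbT.
rewrite (independent_exponentials_box HX us' sD' mB').
rewrite !big_cons B'i B'j B'k rk !muleA; congr (_ * _).
have sD'' l : l \in s -> D l by move=> /sD[].
rewrite (independent_exponentials_box HX us sD'' mB).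
by apply: eq_big_seq => l ls; rewrite B's.
Qed.

(** The index [k] leaves the family because its weight is absorbed into both outgoing increments. *)
Lemma independent_exponentials_flip :
  independent_exponentials P (D `\ k) r flip.
Proof.
have [mX X0 iX lX] := HX.
apply: independent_exponentialsP.
- move=> l; rewrite /flip; case: ifP => _; last case: ifP => _ //.
    apply: measurable_funD => //.
    by apply: measurable_maxr => //; exact: measurable_funB.
  apply: measurable_funD => //.
  by apply: measurable_maxr => //; exact: measurable_funB.
- move=> l w; rewrite /flip; case: ifP => _; last case: ifP => _ //.
    by rewrite addr_ge0// le_max lexx orbT.
  by rewrite addr_ge0// le_max lexx orbT.
- by move=> l [/lX[]].
move=> s B us sD mB.
have rT l A (b : bool) : D l -> exponential_prob (r l) (if b then A else setT) =
    if b then exponential_prob (r l) A else 1.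
  by move=> /lX[rl0 _]; case: b => //; exact: exponential_prob_setT.
rewrite (@box_split _ _ _ _ flip flip _ _ i)// [in RHS](prod_split _ i us).
set s1 := [seq l <- s | l != i].
have us1 : uniq s1 by rewrite filter_uniq.
rewrite (@box_split _ _ _ _ flip X _ _ j)//; last first.
  move=> l lj; rewrite mem_filter => /andP[li _].
  by rewrite /flip (negbTE li) (negbTE lj).
rewrite [in RHS](prod_split _ j us1).
set s2 := [seq l <- s1 | l != j].
have us2 : uniq s2 by rewrite filter_uniq.
have s2D l : l \in s2 -> [/\ D l, l != i, l != j & l != k].
  rewrite !mem_filter => /and3P[lj li /sD[Dl lk]]; split => //.
  by apply/eqP => lk'; apply: lk.
have s2D' l : l \in s2 -> D l by move=> /s2D[].
rewrite flip_box//; try by case: ifP.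
by rewrite (independent_exponentials_box HX us2 s2D' mB) !rT.
Qed.

End flip.

Section tilt.

Lemma integral_independent (P : probability T R) (Y : T -> R) (r : R) (E : set T)
    (g : R -> R) : (0 < r)%R ->
  measurable_fun setT Y -> measurable E ->
  (forall A, measurable A ->
    P (Y @^-1` A `&` E) = exponential_prob r A * P E) ->
  measurable_fun setT g -> (forall x, 0 <= g x)%R ->
  \int[P]_(w in E) (g (Y w))%:E =
  (\int[@lebesgue_measure R]_x (g x * exponential_pdf r x)%:E) * P E.
Proof.
move=> r0 mY mE YE mg g0; have [Q QE] := exists_exponential r0.
pose Y' : {mfun T >-> R} := HB.pack Y (isMeasurableFun.Build _ _ _ _ Y mY).
have PE : P E \is a fin_num by rewrite fin_num_measure.
have [p pE] : exists p : {nonneg R}, p%:num%:E = P E.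
  have pE0 : (0 <= fine (P E))%R by rewrite fine_ge0.
  by exists (NngNum pE0); rewrite /= fineK.
have mgY : measurable_fun setT (fun w => (g (Y w))%:E).
  by apply/measurable_EFinP; exact: measurableT_comp.
have mge : measurable_fun setT (EFin \o g) by exact/measurable_EFinP.
transitivity (\int[mrestr P mE]_w (g (Y w))%:E).
  rewrite [RHS](@ge0_integral_density _ T R P (mrestr P mE) (\1_E))//.
  - rewrite [LHS]integral_mkcond; apply: eq_integral => w _.
    by rewrite patchE indicE; case: ifP => _; rewrite ?mule1 ?mule0.
  - by move=> A mA; rewrite integral_indic// setIC.
  - by move=> w; rewrite lee_fin.
transitivity (\int[pushforward (mrestr P mE) Y']_x (g x)%:E).
  by rewrite ge0_integral_pushforward// => x _; rewrite lee_fin.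
rewrite (eq_measure_integral (mscale p Q)); last first.
  move=> A mA _.
  have QA : Q A * P E = P (Y @^-1` A `&` E) by rewrite QE// YE.
  by rewrite -[LHS]QA -pE muleC.
rewrite ge0_integral_mscale//; last by move=> x _; rewrite lee_fin.
rewrite muleC -pE; congr (_ * _).
by rewrite (ge0_integral_exponential r0 QE).
Qed.

Variables (K : choiceType).
Implicit Types (P : probability T R) (D : set K) (r : K -> R) (X : K -> T -> R).

(** The density [(r - a) / r * exp (a x)] turns the law of rate [r] into that of rate [r - a], and
    the product formula on boxes shows that the other coordinates keep their laws and their
    independence. The sign of [a] is free, so this covers decreasing weights as well. *)
Lemma independent_exponentials_tilt1 P D r X (a : R) i :
  independent_exponentials P D r X -> D i -> (a < r i)%R ->
  exists Q : probability T R,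
    independent_exponentials Q D (fun l => if l == i then r i - a else r l)%R X /\
    forall f : T -> R, measurable_fun setT f -> (forall w, 0 <= f w)%R ->
      \int[Q]_w (f w)%:E =
      \int[P]_w (f w * ((r i - a) / r i * expR (a * X i w)))%:E.
Proof.
move=> HX Di ari; have [mX X0 iX lX] := HX.
have [ri0 li] := lX _ Di.
have ra0 : (0 < r i - a)%R by rewrite subr_gt0.
pose g x := ((r i - a) / r i * expR (a * x))%R.
have mg : measurable_fun setT g.
  apply: measurable_funM; first exact: measurable_cst.
  exact: (measurableT_comp (@measurable_expR R) (@mulrl_measurable R setT a)).
have g0 x : (0 <= g x)%R by rewrite mulr_ge0 ?expR_ge0// divr_ge0// ltW.
have gpdf x : (g x * exponential_pdf (r i) x = exponential_pdf (r i - a) x)%R.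
  have [x0|x0] := ltP x 0%R; first by rewrite !lt0_exponential_pdf// mulr0.
  rewrite !exponential_pdfE//= /g mulrACA -expRD divfK ?gt_eqF//.
  by congr (_ * expR _)%R; ring.
have key E A : measurable E -> measurable A ->
    (forall A', measurable A' ->
      P (X i @^-1` A' `&` E) = exponential_prob (r i) A' * P E) ->
    \int[P]_(w in X i @^-1` A `&` E) (g (X i w))%:E =
    exponential_prob (r i - a) A * P E.
  move=> mE mA XE.
  have mgA : measurable_fun setT (fun x => g x * \1_A x)%R by exact: measurable_funM.
  have gA0 x : (0 <= g x * \1_A x)%R by rewrite mulr_ge0.
  transitivity (\int[P]_(w in E) (g (X i w) * \1_A (X i w))%:E).
    rewrite integral_mkcondl; apply: eq_integral => w _.
    rewrite patchE indicE (_ : (X i w \in A) = (w \in X i @^-1` A)).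
      by case: ifP => _; rewrite ?mulr1 ?mulr0.
    by apply/idP/idP; rewrite !inE.
  rewrite (integral_independent ri0 (mX i) mE XE mgA gA0); congr (_ * _).
  rewrite /exponential_prob [RHS]integral_mkcond; apply: eq_integral => x _.
  rewrite patchE mulrAC gpdf indicE.
  by case: ifP => _; rewrite ?mulr1 ?mulr0.
pose h w := g (X i w).
have mh : measurable_fun setT h by exact: measurableT_comp.
have h0 w : (0 <= h w)%R by exact: g0.
have h1 : \int[P]_w (h w)%:E = 1.
  have := key setT setT (@measurableT _ _) (@measurableT _ _).
  rewrite preimage_setT setIT => ->.
    by rewrite exponential_prob_setT// probability_setT mule1.
  by move=> A' mA'; rewrite setIT li// probability_setT mule1.
have [Q QE] := exists_density mh h0 h1.
exists Q; split; last first.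
  move=> f mf f0; rewrite (@ge0_integral_density _ T R P Q h)//.
  by apply/measurable_EFinP.
apply: independent_exponentialsP => //.
  by move=> l /lX[rl0 _]; case: eqP.
move=> s B us sD mB.
rewrite (@box_split _ _ _ _ X X _ _ i)// [in RHS](prod_split _ i us) eqxx.
set s1 := [seq l <- s | l != i].
have us1 : uniq s1 by rewrite filter_uniq.
have s1D l : l \in s1 -> D l by rewrite mem_filter => /andP[_ /sD].
have mbox : measurable (box X s1 B) by exact: measurable_box.
have mA : measurable (if i \in s then B i else setT) by case: ifP.
rewrite QE; last by apply: measurableI => //; exact: mpre.
rewrite key//.
  rewrite (independent_exponentials_box HX us1 s1D mB); congr (_ * _).
    by case: ifP => // _; rewrite exponential_prob_setT.
  apply: eq_big_seq => l; rewrite mem_filter => /andP[nli _].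
  by rewrite (negbTE nli).
move=> A' mA'; rewrite (independent_exponentials_box HX us1 s1D mB).
pose B' l := if l == i then A' else B l.
have mB' l : measurable (B' l) by rewrite /B'; case: ifP.
have us' : uniq (i :: s1) by rewrite /= us1 mem_filter eqxx.
have sD' l : l \in i :: s1 -> D l by rewrite inE => /predU1P[->//|/s1D].
have := independent_exponentials_box HX us' sD' mB'.
rewrite big_cons {2}/B' eqxx (@box_split _ _ _ _ X X _ _ i)// inE eqxx /= {1}/B' !eqxx.
have E1 : [seq l <- s1 | l != i] = s1 by rewrite filter_id.
have B's l : l \in s1 -> B' l = B l.
  by rewrite mem_filter /B' => /andP[/negbTE ->].
rewrite E1.
have -> : box X s1 B' = box X s1 B.
  by apply: eq_bigcapr => l /= ls; rewrite B's.
by move=> ->; congr (_ * _); apply: eq_big_seq => l ls; rewrite B's.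
Qed.

Lemma independent_exponentials_tilt P D r X (a : R) (s : seq K) :
  independent_exponentials P D r X -> uniq s ->
  (forall i, i \in s -> D i /\ (a < r i)%R) ->
  exists Q : probability T R,
    independent_exponentials Q D (fun l => if l \in s then r l - a else r l)%R X /\
    forall f : T -> R, measurable_fun setT f -> (forall w, 0 <= f w)%R ->
      \int[Q]_w (f w)%:E =
      \int[P]_w (f w * \prod_(i <- s) ((r i - a) / r i * expR (a * X i w)))%:E.
Proof.
move=> HX; elim: s => [|i s IH] /=.
  move=> _ _; exists P; split => // f mf f0.
  by apply: eq_integral => w _; rewrite big_nil mulr1.
move=> /andP[si us] sD.
have [Q [HQ QE]] := IH us (fun l (ls : l \in s) => sD l (@mem_behead K (i :: s) l ls)).
have [Di ari] := sD i (mem_head _ _).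
have ari' : (a < if i \in s then r i - a else r i)%R by rewrite (negbTE si).
have [Q' [HQ' Q'E]] := independent_exponentials_tilt1 HQ Di ari'.
exists Q'; split.
  apply: independent_exponentials_rate HQ' => l Dl /=.
  by rewrite inE (negbTE si); case: eqP => [->|//].
have [mX X0 iX lX] := HX; have [ri0 _] := lX _ Di.
move=> f mf f0; rewrite Q'E// (negbTE si) QE.
- by apply: eq_integral => w _; rewrite big_cons -!mulrA.
- apply: measurable_funM => //; apply: measurable_funM; first exact: measurable_cst.
  by apply: (measurableT_comp (@measurable_expR R)); exact: measurable_funM.
- by move=> w; rewrite mulr_ge0// mulr_ge0 ?expR_ge0// divr_ge0 ?subr_ge0// ltW.
Qed.

End tilt.
End transformations.

(** * Stationarity and exponential moments *)

Section stationarity.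
Context d (T : measurableType d) (R : realType).
Implicit Types (P : probability T R) (W : nat * nat -> T -> R) (m n : nat).

Definition rect m n : set (nat * nat) :=
  [set x | [&& x != (0, 0)%N, (x.1 <= m)%N & (x.2 <= n)%N]].

Definition boundary_rate (al be : R) (x : nat * nat) : R :=
  if x.2 == 0%N then al else if x.1 == 0%N then be else 1.

Definition passage W m n (w : T) : R := lpp (W^~ w) m n.

Definition rebased W a b (x : nat * nat) (w : T) : R := rebase (W^~ w) a b x.

Lemma measurable_passage W m n : (forall x, measurable_fun setT (W x)) ->
  measurable_fun setT (passage W m n).
Proof.
move=> mW; move: m n; apply: lpp_ind2 => [|n IH|m IH|m n IH1 IH2].
- exact: measurable_cst.
- exact: (measurable_funD IH (mW _)).
- exact: (measurable_funD IH (mW _)).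
- exact: (measurable_funD (measurable_maxr IH1 IH2) (mW _)).
Qed.

Lemma measurable_rebased W a b x : (forall x, measurable_fun setT (W x)) ->
  measurable_fun setT (rebased W a b x).
Proof.
move=> mW; case: x => [[|i] [|j]]; rewrite /rebased /=.
- exact: measurable_cst.
- exact: (measurable_funB (measurable_passage a (b + j).+1 mW)
                           (measurable_passage a (b + j) mW)).
- exact: (measurable_funB (measurable_passage (a + i).+1 b mW)
                           (measurable_passage (a + i) b mW)).
- exact: mW.
Qed.

Lemma rebased_ge0 W a b x w : (forall x w, 0 <= W x w) -> 0 <= rebased W a b x w.
Proof.
move=> W0; case: x => [[|i] [|j]]; rewrite /rebased //= subr_ge0.
  by apply: le_trans (lpp_up _ _ _); rewrite lerDl.
by apply: le_trans (lpp_right _ _ _); rewrite lerDl.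
Qed.

Lemma independent_exponentials_eq P (K : choiceType) (D : set K) (r : K -> R)
    (X Y : K -> T -> R) :
  (forall i, measurable_fun setT (Y i)) -> (forall i w, 0 <= Y i w) ->
  (forall i, D i -> X i = Y i) -> independent_exponentials P D r X ->
  independent_exponentials P D r Y.
Proof.
move=> mY Y0 XY [mX X0 iX lX]; split => //; last by move=> i Di; rewrite -XY//; exact: lX.
move=> s B us sD mB.
have -> : \bigcap_(i in [set` s]) Y i @^-1` B i =
          \bigcap_(i in [set` s]) X i @^-1` B i.
  by apply: eq_bigcapr => i /= /sD /XY ->.
rewrite iX//; apply: eq_big_seq => i /sD /XY ->//.
Qed.

Section shift_by_one.
Variables (P : probability T R) (al be : R) (W : nat * nat -> T -> R).
Hypothesis albe : al + be = 1.

(** The family after column 1 has been processed up to height [j]: [(1, 0)] holds the horizontal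
    increment at height [j], and [(0, i)] with [0 < i <= j] holds the vertical increment along
    column 1. The set [left] drops the bulk weights of column 1 consumed on the way. *)
Let mix j (x : nat * nat) : T -> R :=
  match x with
  | (1%N, 0%N) => fun w => passage W 1 j w - passage W 0 j w
  | (0%N, i.+1) => if (i < j)%N then
      fun w => passage W 1 i.+1 w - passage W 1 i w else W x
  | _ => W x
  end.

Let left m n j := [set x | rect m n x /\ ~~ ((x.1 == 1%N) && (0 < x.2 <= j)%N)].

(** Each induction step is one flip at the vertex [(1, j + 1)], whose incoming increments are stored
    at [(1, 0)] and [(0, j + 1)]. *)
Let mix_independent m n j : (j <= n)%N ->
  independent_exponentials P (rect m.+1 n) (boundary_rate al be) W ->
  independent_exponentials P (left m.+1 n j) (boundary_rate al be) (mix j).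
Proof.
move=> jn HW; elim: j jn => [|j IH] jn.
  have -> : mix 0 = W.
    apply/funext => -[[|[|i]] [|k]] //=; apply/funext => w.
    by rewrite /passage lppS0 !lpp00 add0r subr0.
  apply: independent_exponentials_sub HW.
  by move=> x [].
have /(_ (ltnW jn)) H := IH.
have H1 : left m.+1 n j (1, 0)%N by split; rewrite /rect/=.
have H2 : left m.+1 n j (0, j.+1)%N by split; rewrite /rect//=; lia.
have H3 : left m.+1 n j (1, j.+1)%N by split; rewrite /rect//=; lia.
have := @independent_exponentials_flip _ _ _ _ _ _ _ _ (1, 0)%N (0, j.+1)%N
  (1, j.+1)%N H H1 H2 H3 isT isT isT albe erefl.
have max1 (L J B w : R) :
    w + Num.max (B - L - J) 0 = Num.max (L + J) B + w - (L + J).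
  by case: (leP (B - L - J) 0) => ?; case: (leP (L + J) B) => ?; lra.
have max2 (L J B w : R) :
    w + Num.max (J - (B - L)) 0 = Num.max (L + J) B + w - B.
  by case: (leP (J - (B - L)) 0) => ?; case: (leP (L + J) B) => ?; lra.
have -> : flip (mix j) (1, 0)%N (0, j.+1)%N (1, j.+1)%N = mix j.+1.
  apply/funext => x; rewrite /flip; case: eqP => [->|x1].
    by apply/funext => w; rewrite /= ltnn /passage lppSS lpp0S max1.
  case: eqP => [->|x2].
    by apply/funext => w; rewrite /= ltnn ltnSn /passage lppSS lpp0S max2.
  case: x x1 x2 => [[|[|i]] [|k]] //= _ kj.
  rewrite [in RHS]ltnS [in RHS]leq_eqVlt; case: eqP => [kj'|_ //].
  by case: kj; rewrite kj'.
apply: independent_exponentials_sub => x [xr xj]; split.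
  by split => //; move: xj; lia.
by move=> xE; move: xj; rewrite xE /= leqnn.
Qed.

Lemma rebased_right m n :
  independent_exponentials P (rect m.+1 n) (boundary_rate al be) W ->
  independent_exponentials P (rect m n) (boundary_rate al be) (rebased W 1 0).
Proof.
move=> HW; have [mW W0 _ _] := HW.
(* [phi] skips column 1: its bulk weights are consumed, and the increment kept at [(1, 0)] now sits
   on the top side of the rectangle. *)
pose phi (x : nat * nat) := if x.1 == 0%N then x else (x.1.+1, x.2).
have := @independent_exponentials_reindex _ _ _ P _ _ phi _ (rect m n) _ _ _ _
  (mix_independent (leqnn n) HW).
have D1 x : rect m n x -> left m.+1 n n (phi x).
  by case: x => [[|i] j]; rewrite /rect /left /phi /rect/=; lia.
have D2 : {in rect m n &, injective phi}.
  by move=> [[|i] j] [[|i'] j'] _ _; rewrite /phi //= => -[] // -> ->.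
move=> /(_ D1 D2) /(@independent_exponentials_rate _ _ _ _ _ _ _ (boundary_rate al be)) H.
have {}H := H _.
apply: independent_exponentials_eq (H _).
- by move=> x; exact: measurable_rebased.
- by move=> x w; exact: rebased_ge0.
- move=> [[|i] [|j]] //.
  + rewrite /rect /= => jn; apply/funext => w.
    by rewrite /phi /= jn /rebased /= /passage !add0n.
  + rewrite /rect /= => jn; apply/funext => w.
    rewrite /phi /= /rebased /=. by rewrite add1n lppS0 addrAC subrr add0r.
- by move=> [[|i] [|j]].
Qed.

End shift_by_one.

Definition transposed W (x : nat * nat) : T -> R := W (x.2, x.1).

Lemma passage_transposed W m n w : passage (transposed W) n m w = passage W m n w.
Proof. exact: (lpp_transpose (W^~ w)). Qed.

Lemma independent_exponentials_transposed P (al be : R) W m n :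
  independent_exponentials P (rect m n) (boundary_rate al be) W ->
  independent_exponentials P (rect n m) (boundary_rate be al) (transposed W).
Proof.
move=> HW; pose tr (x : nat * nat) := (x.2, x.1).
have trinj : {in rect n m &, injective tr} by move=> [a b] [a' b'] _ _ [-> ->].
have tr_rect x : rect n m x -> rect m n (tr x).
  by case: x => [[|i] [|j]]; rewrite /rect/=; lia.
have := independent_exponentials_reindex tr_rect trinj HW.
by apply: independent_exponentials_rate => -[[|i] [|j]].
Qed.

Lemma rebased_up P (al be : R) W m n : al + be = 1 ->
  independent_exponentials P (rect m n.+1) (boundary_rate al be) W ->
  independent_exponentials P (rect m n) (boundary_rate al be) (rebased W 0 1).
Proof.
move=> albe HW; have [mW W0 _ _] := HW.
have beal : be + al = 1 by rewrite addrC.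
have := independent_exponentials_transposed
  (rebased_right beal (independent_exponentials_transposed HW)).
apply: independent_exponentials_eq.
- by move=> x; exact: measurable_rebased.
- by move=> x w; exact: rebased_ge0.
- move=> [[|i] [|j]] // _; apply/funext => w; rewrite /transposed /rebased /=;
  by rewrite -!(lpp_transpose (W^~ w)).
Qed.

(* The Burke property. *)
Lemma rebased_stationary P (al be : R) W a b m n : al + be = 1 ->
  independent_exponentials P (rect (a + m) (b + n)) (boundary_rate al be) W ->
  independent_exponentials P (rect m n) (boundary_rate al be) (rebased W a b).
Proof.
move=> albe; elim: b n => [|b IHb] n HW.
  elim: a m HW => [|a IHa] m HW; have [mW W0 _ _] := HW.
    apply: independent_exponentials_eq HW.
    - by move=> x; exact: measurable_rebased.
    - by move=> x w; exact: rebased_ge0.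
    - move=> [[|i] [|j]] // _; apply/funext => w; rewrite /rebased /=.
      + by rewrite !add0n lpp0S addrAC subrr add0r.
      + by rewrite !add0n lppS0 addrAC subrr add0r.
  rewrite addSnnS in HW; have := rebased_right albe (IHa _ HW).
  congr (independent_exponentials _ _ _ _).
  apply/funext => x; apply/funext => w; rewrite /rebased rebaseD.
  by rewrite addn1 addn0.
have [mW W0 _ _] := HW.
rewrite addSnnS in HW; have := rebased_up albe (IHb _ HW).
congr (independent_exponentials _ _ _ _).
apply/funext => x; apply/funext => w; rewrite /rebased rebaseD.
by rewrite addn1 addn0.
Qed.

End stationarity.

(** * Exponential moments of passage times *)

Section moment_generating_function.
Context d (T : measurableType d) (R : realType).
Local Open Scope ereal_scope.
Implicit Types (P : probability T R) (W : nat * nat -> T -> R) (m n : nat).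

Lemma measurable_expRM (a : R) (f : T -> R) : measurable_fun setT f ->
  measurable_fun setT (fun w => expR (a * f w)%R).
Proof.
move=> mf; apply: (measurableT_comp (@measurable_expR R)).
by apply: measurable_funM => //; exact: measurable_cst.
Qed.

Lemma measurable_sum_seq (K : choiceType) (X : K -> T -> R) (s : seq K) :
  (forall i, measurable_fun setT (X i)) ->
  measurable_fun setT (fun w => \sum_(i <- s) X i w)%R.
Proof. by move=> mX; exact: measurable_sum. Qed.

(** An exponential of a sum over [s] is traded for new rates on [s]: what remains is an average of
    [f] under [Q]. The common rate turns the normalization into a single power. *)
Lemma tilt_sum P (K : choiceType) (D : set K) (r : K -> R) (X : K -> T -> R)
    (s : seq K) (a al : R) :
  independent_exponentials P D r X -> uniq s -> (0 < al)%R -> (a < al)%R ->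
  (forall i, i \in s -> D i /\ r i = al) ->
  exists Q : probability T R,
    independent_exponentials Q D (fun l => if l \in s then al - a else r l)%R X /\
    forall f : T -> R, measurable_fun setT f -> (forall w, 0 <= f w)%R ->
      \int[P]_w (expR (a * \sum_(i <- s) X i w) * f w)%:E =
      ((al / (al - a)) ^+ size s)%:E * \int[Q]_w (f w)%:E.
Proof.
move=> HX us al0 aal sD; have [mX X0 _ _] := HX.
have ala0 : (0 < al - a)%R by rewrite subr_gt0.
have [|Q [HQ QE]] := @independent_exponentials_tilt _ _ _ _ _ _ _ _ a s HX us.
  by move=> i /sD[? ->].
exists Q; split.
  apply: independent_exponentials_rate HQ => i Di.
  by case: ifP => // /sD[_ ->].
have mS : measurable_fun setT (fun w => expR (a * \sum_(i <- s) X i w))%R.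
  by apply: measurable_expRM; exact: measurable_sum_seq.
have prodE w : (\prod_(i <- s) ((r i - a) / r i * expR (a * X i w)) =
    ((al - a) / al) ^+ size s * expR (a * \sum_(i <- s) X i w))%R.
  rewrite (eq_big_seq (fun i => (al - a) / al * expR (a * X i w))%R); last first.
    by move=> i /sD[_ ->].
  elim: (s) => [|i s' IH]; first by rewrite !big_nil /= mulr0 expR0 mulr1.
  by rewrite !big_cons IH /= mulrDr expRD exprS; ring.
move=> f mf f0; rewrite QE// -ge0_integralZl//.
- apply: eq_integral => w _; rewrite -EFinM prodE; congr EFin.
  have AB : ((al / (al - a)) ^+ size s * ((al - a) / al) ^+ size s = 1)%R.
    by rewrite -exprMn -invf_div mulVf ?expr1n// gt_eqF// divr_gt0.
  by rewrite [in RHS]mulrCA [in RHS](mulrA (_ ^+ _)%R) AB mul1r mulrC.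
- apply/measurable_EFinP; apply: measurable_funM => //.
  under eq_fun do rewrite prodE.
  by apply: measurable_funM; first exact: measurable_cst.
- move=> w _; rewrite lee_fin prodE mulr_ge0// mulr_ge0 ?expR_ge0// exprn_ge0//.
  by rewrite divr_ge0// ltW.
- by rewrite lee_fin exprn_ge0// divr_ge0// ltW.
Qed.

Lemma independent_exponentials_laplace P (K : choiceType) (D : set K) (r : K -> R)
    (X : K -> T -> R) (s : seq K) (a al : R) :
  independent_exponentials P D r X -> uniq s -> (0 < al)%R -> (a < al)%R ->
  (forall i, i \in s -> D i /\ r i = al) ->
  \int[P]_w (expR (a * \sum_(i <- s) X i w))%:E =
  ((al / (al - a)) ^+ size s)%:E.
Proof.
move=> HX us al0 aal sD.
have [Q [_ QE]] := tilt_sum HX us al0 aal sD.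
have := QE (cst 1%R) (measurable_cst _) (fun=> ler01).
have -> : \int[Q]_w (cst 1%R w)%:E = 1.
  rewrite -[LHS]/(\int[Q]_w cst 1%:E w) integral_cst// mul1e.
  exact: probability_setT.
rewrite mule1 => <-.
by apply: eq_integral => w _; rewrite /= mulr1.
Qed.

Lemma big_iota (n : nat) (F : nat -> R) :
  (\sum_(i <- iota 0 n) F i = \sum_(i < n) F i)%R.
Proof. by rewrite -(big_mkord xpredT F) /index_iota subn0. Qed.

Lemma chernoff P (Y : T -> R) (M x : R) : measurable_fun setT Y ->
  \int[P]_w (expR (Y w))%:E <= M%:E ->
  P [set w | x <= Y w]%R <= (M * expR (- x))%:E.
Proof.
move=> mY YM.
have mE : measurable [set w | x <= Y w]%R.
  rewrite (_ : [set w | _] = Y @^-1` `[x, +oo[).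
    by rewrite -[_ @^-1` _]setTI; exact: mY.
  by apply/seteqP; split => w /=; rewrite in_itv/= andbT.
have : (expR x)%:E * P [set w | x <= Y w]%R <= M%:E.
  apply: le_trans YM; rewrite -integral_cst//.
  rewrite integral_mkcond; apply: ge0_le_integral => //.
  - by move=> w _; apply: erestrict_ge0 => ? _; rewrite lee_fin expR_ge0.
  - by apply/(measurable_restrictT _ _).1 => //; exact: measurable_cst.
  - apply/measurable_EFinP; exact: (measurableT_comp (@measurable_expR R)).
  - move=> w _; rewrite patchE; case: ifPn => [|_]; last by rewrite lee_fin expR_ge0.
    by rewrite inE /= => xY; rewrite lee_fin ler_expR.
have PE : P [set w | x <= Y w]%R \is a fin_num by rewrite fin_num_measure.
rewrite -(fineK PE) -EFinM !lee_fin => H.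
by rewrite expRN ler_pdivlMr ?expR_gt0// mulrC.
Qed.

(* Tilting the weights of the vertical axis to rate [1 - al] makes the process
   stationary; the increments along the upper side of the rectangle are then
   i.i.d. exponential variables. *)
Lemma passage_mgf P (al be : R) W m n : (0 < al < 1)%R -> (0 < be < 1)%R ->
  independent_exponentials P (rect m n) (boundary_rate al be) W ->
  \int[P]_w (expR ((al + be - 1) * passage W m n w))%:E =
  ((be / (1 - al)) ^+ n * (al / (1 - be)) ^+ m)%:E.
Proof.
move=> /andP[al0 al1] /andP[be0 be1] HW; have [mW W0 _ _] := HW.
pose s := [seq (0%N, j.+1) | j <- iota 0 n].
have us : uniq s by rewrite map_inj_uniq ?iota_uniq// => i j [].
have sW w : (\sum_(x <- s) W x w = passage W 0 n w)%R.
  rewrite big_map big_iota.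
  by rewrite /passage -lpp_transpose lpp_axis.
have [||Q [HQ QE]] := @tilt_sum P _ _ _ _ s (al + be - 1) be HW us be0.
- by lra.
- move=> x /mapP[j]; rewrite mem_iota add0n /= => jn ->.
  by split; [rewrite /rect /=; lia|].
pose f w := expR ((al + be - 1) * (passage W m n w - passage W 0 n w)).
have mf : measurable_fun setT f.
  by apply: measurable_expRM; apply: measurable_funB; exact: measurable_passage.
have f0 w : (0 <= f w)%R by rewrite expR_ge0.
transitivity (\int[P]_w (expR ((al + be - 1) * \sum_(x <- s) W x w) * f w)%:E).
  apply: eq_integral => w _; congr EFin; rewrite /f -expRD sW; congr expR; ring.
rewrite QE// size_map size_iota EFinM.
congr (_ * _); first by congr ((_ / _) ^+ _)%:E; ring.
have alal : (al + (1 - al) = 1)%R by rewrite addrC subrK.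
have HQ' : independent_exponentials Q (rect (0 + m) (n + 0)) (boundary_rate al (1 - al)) W.
  rewrite add0n addn0; apply: independent_exponentials_rate HQ.
  move=> [[|i] [|j]]; rewrite /rect /boundary_rate/= ?andbT => jn.
  - by [].
  - rewrite ifT; first by ring.
    by apply/mapP; exists j => //; rewrite mem_iota.
  - by rewrite ifF//; apply/negP => /mapP[].
  - by rewrite ifF//; apply/negP => /mapP[].
have HB := rebased_stationary alal HQ'.
pose s' := [seq (i.+1, 0%N) | i <- iota 0 m].
have us' : uniq s' by rewrite map_inj_uniq ?iota_uniq// => i j [].
have s'_rect x : x \in s' -> rect m 0 x /\ boundary_rate al (1 - al) x = al.
  move=> /mapP[i]; rewrite mem_iota add0n /= => im ->.
  by split; [rewrite /rect /=; lia|].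
have aal : (al + be - 1 < al)%R by lra.
have := independent_exponentials_laplace HB us' al0 aal.
rewrite size_map size_iota => /(_ s'_rect) H.
transitivity (\int[Q]_w (expR ((al + be - 1) *
    (\sum_(i <- s') rebased W 0 n i w)))%:E).
  apply: eq_integral => w _; rewrite /f; congr (expR (_ * _))%:E.
  by rewrite big_map big_iota -lpp_axis lpp_rebase add0n addn0.
by rewrite H; congr ((_ / _) ^+ _)%:E; ring.
Qed.

Lemma passage_chernoff P (al be x : R) W m n : (0 < al < 1)%R -> (0 < be < 1)%R ->
  independent_exponentials P (rect m n) (boundary_rate al be) W ->
  P [set w | (al + be - 1) * x <= (al + be - 1) * passage W m n w]%R <=
  ((be / (1 - al)) ^+ n * (al / (1 - be)) ^+ m *
   expR (- ((al + be - 1) * x)))%:E.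
Proof.
move=> al01 be01 HW; have [mW _ _ _] := HW.
apply: chernoff; last by rewrite (passage_mgf al01 be01 HW).
by apply: measurable_funM; [exact: measurable_cst|exact: measurable_passage].
Qed.

Definition shifted (x : nat * nat) W (y : nat * nat) : T -> R :=
  W ((x.1 + y.1)%N, (x.2 + y.2)%N).

(** The first [k] axis weights contribute their Laplace transform. The process seen from [(k, 0)] is
    dominated by one with boundary rates [al'] and [be'], obtained by scaling weights up, and its
    moment at the exponent [al' + be' - 1] is explicit. *)
Lemma exit_chernoff P (al al' be' x : R) (r : nat * nat -> R) W k m n :
  (0 < al)%R -> (al' <= al)%R -> (0 < al' < 1)%R -> (0 < be' < 1)%R ->
  (0 < al' + be' - 1)%R -> (0 < k <= m)%N ->
  (forall i, (0 < i <= m)%N -> r (i, 0)%N = al) ->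
  (forall i j, (0 < i <= m)%N -> (0 < j <= n)%N -> r (i, j) = 1%R) ->
  independent_exponentials P (rect m n) r W ->
  P [set w | x <= passage W k 0 w + passage (shifted (k, 0)%N W) (m - k) n w]%R <=
  ((al / (al - (al' + be' - 1))) ^+ k *
   ((be' / (1 - al')) ^+ n * (al' / (1 - be')) ^+ (m - k)) *
   expR (- ((al' + be' - 1) * x)))%:E.
Proof.
move=> al0 al'al /andP[al'0 al'1] /andP[be'0 be'1] a0 /andP[k0 km] rh rb HW.
have [mW W0 _ _] := HW.
set a := (al' + be' - 1)%R.
pose s := [seq (i.+1, 0%N) | i <- iota 0 k].
have us : uniq s by rewrite map_inj_uniq ?iota_uniq// => i j [].
have sW w : (\sum_(x <- s) W x w = passage W k 0 w)%R.
  by rewrite big_map big_iota /passage lpp_axis.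
have aal : (a < al)%R by rewrite /a; lra.
have [|Q [HQ QE]] := @tilt_sum P _ _ _ _ s a al HW us al0 aal.
  move=> y /mapP[i]; rewrite mem_iota add0n /= => ik ->.
  have ikm : (i.+1 <= m)%N by exact: leq_trans km.
  by split; [rewrite /rect /= ikm|rewrite rh].
set V := shifted (k, 0)%N W.
have mV y : measurable_fun setT (V y) by exact: mW.
have := @chernoff P (fun w => a * (passage W k 0 w + passage V (m - k) n w))%R
  ((al / (al - a)) ^+ k *
   ((be' / (1 - al')) ^+ n * (al' / (1 - be')) ^+ (m - k)))%R (a * x)%R.
rewrite (_ : [set w | _] = [set w | (x <= passage W k 0 w + passage V (m - k) n w)%R]).
  apply.
  - apply: measurable_funM; first exact: measurable_cst.
    by apply: measurable_funD; exact: measurable_passage.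
  pose f w := expR (a * passage V (m - k) n w).
  have mf : measurable_fun setT f.
    by apply: measurable_expRM; exact: measurable_passage.
  have f0 w : (0 <= f w)%R by rewrite expR_ge0.
  rewrite (_ : \int[P]_w _ = \int[P]_w (expR (a * \sum_(x <- s) W x w) * f w)%:E);
    last by apply: eq_integral => w _; rewrite mulrDr expRD sW.
  rewrite QE// size_map size_iota EFinM lee_pmul2l//; last first.
    by rewrite lte_fin exprn_gt0// divr_gt0// subr_gt0.
  pose phi (y : nat * nat) := ((k + y.1)%N, y.2).
  have D1 y : rect (m - k) n y -> rect m n (phi y).
    clear -k0 km; case: y => i j; rewrite /rect/= => /and3P[_ im jn].
    by rewrite xpair_eqE; lia.
  have D2 : {in rect (m - k) n &, injective phi}.
    by move=> [i j] [i' j'] _ _ [/addnI -> ->].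
  have HV := independent_exponentials_reindex D1 D2 HQ.
  (* The column above [(k, 0)] carries bulk weights of rate 1. Enlarged to rate [be'], they form the
     vertical axis of the dominating process. *)
  pose c (y : nat * nat) : R :=
    if y.2 == 0%N then (al / al')%R else if y.1 == 0%N then be'^-1%R else 1%R.
  have c1 y : (1 <= c y)%R.
    rewrite /c; case: ifP => _; first by rewrite ler_pdivlMr// mul1r.
    by case: ifP => // _; rewrite invf_ge1// ltW.
  have c0 y : (0 < c y)%R by exact: lt_le_trans (c1 y).
  have HcV := independent_exponentials_scale c0 HV.
  have {}HcV : independent_exponentials Q (rect (m - k) n)
      (boundary_rate al' be') (fun y w => c y * V y w)%R.
    rewrite (_ : (fun y w => c y * V y w)%R = (fun y w => c y * (W \o phi) y w)%R).
      apply: independent_exponentials_rate HcV => -[i j].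
      rewrite /rect /phi /boundary_rate /c/= => /and3P[ij0 im jn].
      have kim : (0 < k + i <= m)%N by clear -k0 km im; lia.
      rewrite ifF; last first.
        apply/negP => /mapP[l]; rewrite mem_iota add0n /= => lk [kil j0].
        by move: ij0; rewrite j0 xpair_eqE eqxx andbT; clear -kil lk; lia.
      case: eqP => [j0|j0].
        by rewrite j0 rh// invf_div mulrCA divff ?mulr1// gt_eqF.
      rewrite rb//; last by rewrite lt0n jn andbT; apply/eqP.
      by case: eqP => _; rewrite ?invrK ?invr1 ?mul1r ?mulr1.
    by apply/funext => y; apply/funext => w; rewrite /V /shifted /phi add0n.
  have al'01 : (0 < al' < 1)%R by rewrite al'0.
  have be'01 : (0 < be' < 1)%R by rewrite be'0.
  rewrite -(passage_mgf al'01 be'01 HcV); apply: ge0_le_integral => //.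
  - by move=> w _; rewrite lee_fin.
  - exact/measurable_EFinP.
  - apply/measurable_EFinP; apply: measurable_expRM.
    by have [mcV _ _ _] := HcV; exact: measurable_passage.
  - move=> w _; rewrite lee_fin ler_expR ler_pM2l//; apply: le_lpp => y _ _ _.
    by rewrite ler_peMl// W0.
by apply/seteqP; split => w /=; rewrite ler_pM2l.
Qed.

End moment_generating_function.

(** * The cumulant near the characteristic parameter *)

Section cumulant.
Context (R : realType).
Implicit Types (x y c rho N : R) (m n : nat).

(* [cumulant n m] generates the exponential moments of the passage times; at the
   characteristic direction its second derivative vanishes at [rho]. *)
Definition cumulant n m x : R := n%:R * ln x - m%:R * ln (1 - x).

Lemma expR_cumulant n m x y : 0 < x < 1 -> 0 < y < 1 ->
  (y / x) ^+ n * ((1 - x) / (1 - y)) ^+ m = expR (cumulant n m y - cumulant n m x).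
Proof.
move=> /andP[x0 x1] /andP[y0 y1].
rewrite (_ : cumulant n m y - cumulant n m x =
  n%:R * (ln y - ln x) + m%:R * (ln (1 - x) - ln (1 - y))); last first.
  by rewrite /cumulant; ring.
by rewrite expRD !expRM_natl !expRB !lnK ?posrE// subr_gt0.
Qed.

Lemma is_derive_cumulant n m c : 0 < c < 1 ->
  is_derive c 1 (cumulant n m) (n%:R / c + m%:R / (1 - c)).
Proof.
move=> /andP[c0 c1].
have h1 : is_derive c 1 (@ln R) c^-1 by exact: is_derive1_ln.
have h2 : is_derive (1 - c) 1 (@ln R) (1 - c)^-1.
  by apply: is_derive1_ln; rewrite subr_gt0.
have h3 : is_derive c 1 (fun x : R => 1 - x) (-1).
  have := is_deriveB (is_derive_cst (1 : R) c 1) (is_derive_id c (1 : R)).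
  by rewrite sub0r.
have h4 : is_derive c 1 (fun x : R => ln (1 - x)) ((1 - c)^-1 * -1).
  exact: (@is_derive1_comp _ (@ln R) (fun x : R => 1 - x)).
have := is_deriveB (is_deriveZ n%:R h1) (is_deriveZ m%:R h4).
rewrite /GRing.scale /= mulrN1 mulrN opprK; exact.
Qed.

Lemma cumulant_MVT n m x y : 0 < x -> x < y -> y < 1 ->
  exists2 c, x < c < y &
  cumulant n m y - cumulant n m x = (n%:R / c + m%:R / (1 - c)) * (y - x).
Proof.
move=> x0 xy y1.
have d c : x <= c <= y -> is_derive c 1 (cumulant n m) (n%:R / c + m%:R / (1 - c)).
  by move=> /andP[xc cy]; apply: is_derive_cumulant; lra.
have [||c cxy ->] := @MVT R (cumulant n m) (fun c => n%:R / c + m%:R / (1 - c)) x y xy.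
- by move=> c; rewrite in_itv/= => /andP[? ?]; apply: d; lra.
- apply: continuous_in_subspaceT => c; rewrite inE /= in_itv/= => cxy.
  have [dc _] := d c cxy.
  by apply: differentiable_continuous; exact/derivable1_diffP.
- by exists c => //; move: cxy; rewrite in_itv.
Qed.

(** The slack 2 pays for two roundings: the integer parts in the side lengths and the integer corner
    close to [(t m, t n)]. *)
Definition characteristic rho N m n :=
  `|m%:R - N * (1 - rho) ^+ 2| <= 2 /\ `|n%:R - N * rho ^+ 2| <= 2.

(** The identity [rho^2 / c + (1 - rho)^2 / (1 - c) = 1 + (c - rho)^2 / (c (1 - c))] has no linear
    term at [rho]. For [c] in [[ka, 1 - ka]] the factor [1 / (c (1 - c))] lies between 4 and [B],
    and [2 * B] absorbs the rounding of [m] and [n]. *)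
Lemma cumulant_slope rho N m n (ka B c : R) : characteristic rho N m n ->
  0 <= N -> 0 < ka -> 2 * ka <= rho -> 2 * ka <= 1 - rho -> ka * B = 2 ->
  ka <= c -> ka <= 1 - c ->
  N * (1 + 4 * (c - rho) ^+ 2) - 2 * B <= n%:R / c + m%:R / (1 - c) <=
  N * (1 + B * (c - rho) ^+ 2) + 2 * B.
Proof.
move=> [mE nE] N0 ka0 kr kr' kaB kc kc'.
have c0 : 0 < c by exact: lt_le_trans kc.
have c0' : 0 < 1 - c by exact: lt_le_trans kc'.
have cc0 : 0 < c * (1 - c) by exact: mulr_gt0.
pose D := (c * (1 - c))^-1.
have DE : c^-1 + (1 - c)^-1 = D.
  by rewrite /D; field; rewrite !gt_eqF.
have D4 : 4 <= D.
  rewrite /D -[4]invrK lef_pV2 ?posrE// ?invr_gt0//.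
  have : 0 <= (c - 2^-1) ^+ 2 by exact: sqr_ge0.
  by rewrite expr2; lra.
have ka2 : ka <= 2^-1 by lra.
have DB : D <= B.
  rewrite /D -(ler_pM2l cc0) divff ?gt_eqF//.
  have B0 : 0 < B by rewrite -(pmulr_rgt0 _ ka0) kaB.
  suff : ka * 2^-1 <= c * (1 - c) by move=> /(ler_wpM2r (ltW B0)); lra.
  have [h|h] := leP c 2^-1.
    apply: ler_pM; lra.
  by rewrite mulrC (mulrC c); rewrite mulrC; nra.
have key : rho ^+ 2 / c + (1 - rho) ^+ 2 / (1 - c) = 1 + D * (c - rho) ^+ 2.
  by rewrite /D; field; rewrite !gt_eqF.
move: mE nE; rewrite !ler_norml => /andP[m1 m2] /andP[n1 n2].
have ci : 0 < c^-1 by rewrite invr_gt0.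
have ci' : 0 < (1 - c)^-1 by rewrite invr_gt0.
have nlo : (N * rho ^+ 2 - 2) / c <= n%:R / c by rewrite ler_pM2r//; lra.
have nup : n%:R / c <= (N * rho ^+ 2 + 2) / c by rewrite ler_pM2r//; lra.
have mlo : (N * (1 - rho) ^+ 2 - 2) / (1 - c) <= m%:R / (1 - c) by rewrite ler_pM2r//; lra.
have mup : m%:R / (1 - c) <= (N * (1 - rho) ^+ 2 + 2) / (1 - c) by rewrite ler_pM2r//; lra.
have sq0 : 0 <= (c - rho) ^+ 2 by exact: sqr_ge0.
have lo : (N * rho ^+ 2 - 2) / c + (N * (1 - rho) ^+ 2 - 2) / (1 - c) =
          N * (1 + D * (c - rho) ^+ 2) - 2 * D.
  by rewrite -key -DE; ring.
have up : (N * rho ^+ 2 + 2) / c + (N * (1 - rho) ^+ 2 + 2) / (1 - c) =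
          N * (1 + D * (c - rho) ^+ 2) + 2 * D.
  by rewrite -key -DE; ring.
have h1 : N * (1 + 4 * (c - rho) ^+ 2) <= N * (1 + D * (c - rho) ^+ 2).
  by rewrite ler_wpM2l// lerD2l ler_wpM2r.
have h2 : N * (1 + D * (c - rho) ^+ 2) <= N * (1 + B * (c - rho) ^+ 2).
  by rewrite ler_wpM2l// lerD2l ler_wpM2r.
apply/andP; split; lra.
Qed.

End cumulant.

(** * Tail bounds *)

Section tails.
Context d (T : measurableType d) (R : realType) (P : probability T R).
Implicit Types (W : nat * nat -> T -> R) (s u a x : R).
Variables (rho N ka B : R) (m n : nat).
Hypotheses (mn : characteristic rho N m n) (N_ge0 : 0 <= N).
Hypothesis win : [/\ 0 < ka, 2 * ka <= rho, 2 * ka <= 1 - rho & ka * B = 2].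

Lemma cumulant_diff_le (v v' e : R) : - ka <= v -> v < v' -> v' <= ka ->
  (forall c : R, rho + v < c < rho + v' -> (c - rho) ^+ 2 <= e) ->
  cumulant n m (rho + v') - cumulant n m (rho + v) <=
  (N * (1 + B * e) + 2 * B) * (v' - v).
Proof.
have [ka0 kr kr' kaB] := win; have N0 := N_ge0.
have B0 : 0 < B by rewrite -(pmulr_rgt0 _ ka0) kaB.
move=> v0 vv v1 ve.
have [|||c cI ->] := @cumulant_MVT R n m (rho + v) (rho + v'); try lra.
rewrite (_ : rho + v' - (rho + v) = v' - v); last by ring.
apply: ler_wpM2r; first lra.
have kc : ka <= c by lra.
have kc' : ka <= 1 - c by lra.
have /andP[_ h] := cumulant_slope mn N0 ka0 kr kr' kaB kc kc'.
apply: le_trans h _; rewrite lerD2r ler_wpM2l// lerD2l.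
by apply: ler_wpM2l; [exact: ltW|exact: ve].
Qed.

Lemma cumulant_diff_ge (v v' e : R) : - ka <= v -> v < v' -> v' <= ka ->
  (forall c : R, rho + v < c < rho + v' -> e <= (c - rho) ^+ 2) ->
  (N * (1 + 4 * e) - 2 * B) * (v' - v) <=
  cumulant n m (rho + v') - cumulant n m (rho + v).
Proof.
have [ka0 kr kr' kaB] := win; have N0 := N_ge0.
have B0 : 0 < B by rewrite -(pmulr_rgt0 _ ka0) kaB.
move=> v0 vv v1 ve.
have [|||c cI ->] := @cumulant_MVT R n m (rho + v) (rho + v'); try lra.
rewrite (_ : rho + v' - (rho + v) = v' - v); last by ring.
apply: ler_wpM2r; first lra.
have kc : ka <= c by lra.
have kc' : ka <= 1 - c by lra.
have /andP[h _] := cumulant_slope mn N0 ka0 kr kr' kaB kc kc'.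
apply: le_trans h; rewrite lerD2r ler_wpM2l// lerD2l ler_wpM2l//.
exact: ve.
Qed.

(** At these rates the exponent [al + be - 1] is [- s], and the log moment is minus the increment of
    [cumulant] from [rho] to [rho + s]. *)
Lemma passage_lower_tail W s x : 0 < s -> s <= ka ->
  independent_exponentials P (rect m n) (boundary_rate (1 - rho - s) rho) W ->
  (P [set w | (passage W m n w <= x)%R] <=
   (expR (s * (x - N) - N * s ^+ 3 / 2 + 2 * B * s))%:E)%E.
Proof.
have [ka0 kr kr' kaB] := win; have N0 := N_ge0.
move=> s0 ska HW.
have al01 : 0 < 1 - rho - s < 1 by lra.
have be01 : 0 < rho < 1 by lra.
have := passage_chernoff x al01 be01 HW.
rewrite (_ : 1 - rho - s + rho - 1 = - s); last by ring.
rewrite (_ : [set w | _] = [set w | passage W m n w <= x]); last first.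
  by apply/seteqP; split => w /=; rewrite !mulNr lerN2 ler_pM2l.
move=> /le_trans; apply; rewrite lee_fin.
rewrite (_ : 1 - (1 - rho - s) = rho + s); last by ring.
rewrite (_ : 1 - rho - s = 1 - (rho + s)); last by ring.
rewrite expR_cumulant; try lra.
rewrite -expRD ler_expR.
(* The interval is halved: the lower half has slope at least [N] up to rounding, and on the upper
   half [(c - rho)^2 >= s^2 / 4] yields the extra [N s^3 / 2]. *)
have h1 := @cumulant_diff_ge 0 (s / 2) 0; have h2 := @cumulant_diff_ge (s / 2) s (s ^+ 2 / 4).
move: h1; rewrite addr0 subr0 mulr0 addr0 mulr1 => h1.
have {}h1 : (N - 2 * B) * (s / 2) <= cumulant n m (rho + s / 2) - cumulant n m rho.
  by apply: h1; try lra; move=> c _; exact: sqr_ge0.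
have {}h2 : (N * (1 + 4 * (s ^+ 2 / 4)) - 2 * B) * (s - s / 2) <=
    cumulant n m (rho + s) - cumulant n m (rho + s / 2).
  apply: h2; try lra; move=> c cI.
  rewrite (_ : s ^+ 2 / 4 = (s / 2) ^+ 2); last by rewrite expr_div_n; congr (_ / _); ring.
  by rewrite ler_sqr ?nnegrE; lra.
have e1 : (N * (1 + 4 * (s ^+ 2 / 4)) - 2 * B) * (s - s / 2) =
   (N - 2 * B) * (s / 2) + N * s ^+ 3 / 2 by field.
rewrite e1 in h2; lra.
Qed.

(** The actual axis has rate [1 - rho - s], while the comparison process has rates [1 - rho - u] and
    [rho + u + a], so that the exponent is [a]. Each of the [k] axis sites falls short of the
    comparison rate and saves a factor [exp (- a (u - s))]. The parameters [u] and [a] stay free for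
    a later choice. *)
Lemma exit_tail W (r : nat * nat -> R) k s u a x : (0 < k <= m)%N ->
  s <= u -> - ka <= s -> 0 < a -> - ka <= u -> u + a <= ka ->
  (forall i, (0 < i <= m)%N -> r (i, 0)%N = 1 - rho - s) ->
  (forall i j, (0 < i <= m)%N -> (0 < j <= n)%N -> r (i, j) = 1) ->
  independent_exponentials P (rect m n) r W ->
  (P [set w | (x <= passage W k 0 w +
                   passage (shifted (k, 0)%N W) (m - k) n w)%R] <=
   (expR (- a * (x - N) + a * N * B * (`|u| + a) ^+ 2 + 2 * B * a -
          k%:R * (a * (u - s))))%:E)%E.
Proof.
have [ka0 kr kr' kaB] := win; have N0 := N_ge0.
move=> km su s0 a0 u0 uka rh rb HW.
have [k0 km'] := andP km.
have al0 : 0 < 1 - rho - s by lra.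
have al'al : 1 - rho - u <= 1 - rho - s by lra.
have al'01 : 0 < 1 - rho - u < 1 by lra.
have be'01 : 0 < rho + u + a < 1 by lra.
have aE : 1 - rho - u + (rho + u + a) - 1 = a by ring.
have a0' : 0 < 1 - rho - u + (rho + u + a) - 1 by rewrite aE.
have := exit_chernoff x al0 al'al al'01 be'01 a0' km rh rb HW.
rewrite aE => /le_trans; apply; rewrite lee_fin.
set t := (1 - rho - u) / (1 - (rho + u + a)).
have t0 : 0 < t by apply: divr_gt0; lra.
set q := (1 - rho - s) / (1 - rho - s - a).
have q0 : 0 <= q by apply: divr_ge0; lra.
(* Borrowing [k] factors [t] completes the power to [t ^+ m], as the cumulant requires, and leaves
   [q / t] per axis site. *)
have -> : q ^+ k * (((rho + u + a) / (1 - (1 - rho - u))) ^+ n * t ^+ (m - k)) =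
    (q / t) ^+ k * (((rho + u + a) / (rho + u)) ^+ n * t ^+ m).
  rewrite (_ : 1 - (1 - rho - u) = rho + u); last by ring.
  rewrite -[in RHS](subnKC km') exprD (expr_div_n q).
  have tk : t ^+ k != 0 by rewrite expf_neq0// gt_eqF.
  have canc (a1 a2 a3 e : R) : e != 0 -> a1 * (a2 * a3) = a1 / e * (a2 * (e * a3)).
    by move=> e0; field.
  exact: canc.
have -> : ((rho + u + a) / (rho + u)) ^+ n * t ^+ m =
    expR (cumulant n m (rho + u + a) - cumulant n m (rho + u)).
  by rewrite /t (_ : 1 - rho - u = 1 - (rho + u));
    [rewrite expR_cumulant//; lra|ring].
(* [q / t] has the form [1 - w / X] with [w = a (u - s) >= 0] and [0 < X <= 1], hence is at most
   [1 - w]. *)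
have qt : (q / t) ^+ k <= expR (- (k%:R * (a * (u - s)))).
  rewrite -mulrN expRM_natl lerXn2r ?nnegrE ?expR_ge0//.
    by rewrite divr_ge0// ltW.
  apply: le_trans (expR_ge1Dx _).
  have X0 : 0 < (1 - rho - s - a) * (1 - rho - u) by apply: mulr_gt0; lra.
  have -> : q / t = ((1 - rho - s) * (1 - rho - u - a)) /
                    ((1 - rho - s - a) * (1 - rho - u)).
    rewrite /q /t (_ : 1 - (rho + u + a) = 1 - rho - u - a); last by ring.
    by field; repeat (apply/andP; split); rewrite gt_eqF//; lra.
  rewrite ler_pdivrMr//.
  have X1 : (1 - rho - s - a) * (1 - rho - u) <= 1 by rewrite mulr_ile1//; lra.
  have w0 : 0 <= a * (u - s) by rewrite mulr_ge0//; lra.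
  have e1 : (1 - rho - s) * (1 - rho - u - a) =
            (1 - rho - s - a) * (1 - rho - u) - a * (u - s) by ring.
  have gen (X w : R) : 0 <= w -> X <= 1 -> X - w <= (1 + - w) * X.
    by move=> w1 X2; rewrite mulrDl mul1r lerD2l mulNr lerN2 -[leRHS]mulr1 ler_wpM2l.
  by rewrite e1; exact: gen.
have h := @cumulant_diff_le u (u + a) ((`|u| + a) ^+ 2).
have {}h : cumulant n m (rho + u + a) - cumulant n m (rho + u) <=
    (N * (1 + B * (`|u| + a) ^+ 2) + 2 * B) * a.
  rewrite -(addrA rho); apply: (le_trans (h _ _ _ _)); try lra.
  move=> c cI; rewrite -real_normK ?num_real// ler_sqr ?nnegrE ?addr_ge0//; last lra.
  by rewrite ler_norml; have := ler_norm u; have := ler_norm (- u); rewrite normrN; lra.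
rewrite -[leLHS]mulrA -expRD.
apply: (le_trans (ler_wpM2r (expR_ge0 _) qt)).
rewrite -expRD ler_expR; lra.
Qed.

End tails.

(** * Monotone coupling in the axis weights *)

Section coupling.
Context (R : realType).
Implicit Types (W V : nat * nat -> R) (m n k : nat).

Lemma lpp_perturb_axis W V (e : nat -> R) m n : (forall i, 0 <= e i) ->
  (forall i j, V (i, j.+1) <= W (i, j.+1)) ->
  (forall i, V (i.+1, 0)%N <= W (i.+1, 0)%N + e i) ->
  lpp V m n <= lpp W m n + \sum_(i < m) e i.
Proof.
move=> e0 VW VWe; move: m n; apply: lpp_ind2 => [|n IH|m IH|m n IH1 IH2].
- by rewrite big_ord0 addr0.
- by move: IH; rewrite !lpp0S big_ord0 !addr0 => IH; rewrite lerD.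
- by rewrite !lppS0 big_ord_recr /= addrACA lerD.
- rewrite !lppSS addrAC lerD// ge_max; apply/andP; split.
    apply: le_trans IH1 _; rewrite big_ord_recr /= addrA ler_wpDr// lerD2r.
    by rewrite le_max lexx.
  by apply: le_trans IH2 _; rewrite lerD2r le_max lexx orbT.
Qed.

Definition scale_axis (c : R) W (x : nat * nat) : R :=
  if x.2 == 0%N then c * W x else W x.

Lemma lpp_scale_axis c W k : lpp (scale_axis c W) k 0 = c * lpp W k 0.
Proof. by rewrite !lpp_axis mulr_sumr. Qed.

(* The inequality says that the geodesic leaves the axis after [k - 1] sites or
   later; larger weights on the axis cannot make it leave earlier. *)
Lemma exit_scale_axis c W k m n : 1 <= c -> (forall x, 0 <= W x) ->
  (0 < k <= m)%N ->
  lpp W m n <= lpp W k 0 + lpp (shift (k, 0)%N W) (m - k) n ->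
  lpp (scale_axis c W) m n <= lpp (scale_axis c W) k 0 +
    lpp (shift (k, 0)%N (scale_axis c W)) (m - k) n.
Proof.
move=> c1 W0 /andP[k0 km] exitW.
have c0 : 0 <= c - 1 by rewrite subr_ge0.
(* [V] enlarges the axis only before [(k, 0)], which is all that an early exit can see. The gain
   there is at most [(c - 1) * lpp W k 0], and a path through [(k, 0)] collects this amount in
   full. *)
pose V x := if (x.1 < k)%N then scale_axis c W x else W x.
have shiftle : lpp (shift (k, 0)%N W) (m - k) n <=
               lpp (shift (k, 0)%N (scale_axis c W)) (m - k) n.
  apply: le_lpp => x _ _ _; rewrite !shiftE /scale_axis; case: ifP => // _.
  by rewrite ler_peMl.
apply: le_trans (lpp_exit _ k0 km (_ : forall x, _ -> _ = V x)) _.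
  move=> [i j] /=; rewrite /V /=; case: ifP => //= _ j0.
  by rewrite /scale_axis /= gtn_eqF.
rewrite ge_max lexx andbT.
apply: le_trans (_ : lpp W m n + (c - 1) * lpp W k 0 <= _); last first.
  apply: le_trans (_ : lpp W k 0 + lpp (shift (k, 0)%N W) (m - k) n +
    (c - 1) * lpp W k 0 <= _); first by rewrite lerD2r.
  rewrite lpp_scale_axis; lra.
pose e i := if (i < k)%N then (c - 1) * W (i.+1, 0)%N else 0.
have e0 i : 0 <= e i by rewrite /e; case: ifP => // _; rewrite mulr_ge0.
have -> : (c - 1) * lpp W k 0 = \sum_(i < m) e i.
  rewrite lpp_axis mulr_sumr (big_ord_widen _ (fun i => (c - 1) * W (i.+1, 0)%N) km).
  by rewrite big_mkcond.
apply: lpp_perturb_axis => //.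
- by move=> i j; rewrite /V /scale_axis /=; case: ifP.
- move=> i; rewrite /V /scale_axis /e /=.
  case: (ltnP i.+1 k) => [ik|ik]; last by rewrite lerDl e0.
  by rewrite (ltnW ik) mulrBl mul1r addrC subrK.
Qed.

End coupling.

(** * Late exits from the axis of the stationary process *)

Section exit_bound.
Context d (T : measurableType d) (R : realType) (P : probability T R).
Implicit Types (W : nat * nat -> T -> R).

Lemma measurable_le_set (f g : T -> R) :
  measurable_fun setT f -> measurable_fun setT g ->
  measurable [set w | f w <= g w].
Proof.
move=> mf mg; rewrite (_ : [set w | _] = (fun w => g w - f w) @^-1` `[0, +oo[).
  by rewrite -[_ @^-1` _]setTI; exact: measurable_funB.
by apply/seteqP; split => w /=; rewrite in_itv/= andbT subr_ge0.
Qed.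

Lemma independent_exponentials_scale_axis (al al' : R) (r : nat * nat -> R) m n W :
  0 < al -> 0 < al' -> (forall i, r (i.+1, 0)%N = al) ->
  independent_exponentials P (rect m n) r W ->
  independent_exponentials P (rect m n) (fun x => if x.2 == 0%N then al' else r x)
    (fun x w => scale_axis (al / al') (W^~ w) x).
Proof.
move=> al0 al'0 rh HW.
pose c (x : nat * nat) : R := if x.2 == 0%N then al / al' else 1.
have c0 x : 0 < c x by rewrite /c; case: ifP => // _; exact: divr_gt0.
have := independent_exponentials_scale c0 HW.
rewrite (_ : (fun x w => c x * W x w) = (fun x w => scale_axis (al / al') (W^~ w) x)).
  apply: independent_exponentials_rate => -[[|i] [|j]]; rewrite /rect /c//=.
  - by rewrite divr1.
  - by rewrite rh invf_div mulrCA divff ?mulr1// gt_eqF.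
  - by rewrite divr1.
apply/funext => x; apply/funext => w; rewrite /c /scale_axis.
by case: ifP => _; rewrite ?mul1r.
Qed.

(** This is [exit_tail] with [a = u = be k / N] and [s = u / 2]. The axis sites save [k u^2 / 2]; by
    [32 * be <= ka] the error [4 B N u^3] is at most half of that, and [k u^2 >= N u^3] because
    [be <= 1]. The factor 16 makes the exponent equal to the [N s^3 / 2] of the lower tail. *)
Lemma exit_tail_parabolic (rho N ka B be X : R) m n k (r : nat * nat -> R) W :
  characteristic rho N m n -> 1 <= N -> N <= X ->
  [/\ 0 < ka, 2 * ka <= rho, 2 * ka <= 1 - rho & ka * B = 2] ->
  0 < be -> 32 * be <= ka -> (0 < k <= m)%N ->
  (forall i, (0 < i <= m)%N -> r (i, 0)%N = 1 - rho - be * k%:R / N / 2) ->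
  (forall i j, (0 < i <= m)%N -> (0 < j <= n)%N -> r (i, j) = 1) ->
  independent_exponentials P (rect m n) r W ->
  [/\ 0 < be * k%:R / N / 2, be * k%:R / N <= ka / 2 &
  (P [set w | (X <= passage W k 0 w +
                passage (shifted (k, 0)%N W) (m - k) n w)%R] <=
   (expR (2 - be ^+ 3 / 16 * (k%:R ^+ 3 / N ^+ 2)))%:E)%E].
Proof.
move=> mn N1 NX win be0 beka km rh rb HW; have [ka0 kr kr' kaB] := win.
have B0 : 0 < B by rewrite -(pmulr_rgt0 _ ka0) kaB.
have N0 : 0 < N by lra.
have [k0 km'] := andP km.
have k0' : 0 < k%:R :> R by rewrite ltr0n.
(* [k <= m <= N + 2 <= 3 N], so [u <= 3 * be] stays inside the window of width [ka]. *)
have k3N : k%:R <= 3 * N.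
  have : k%:R <= m%:R :> R by rewrite ler_nat.
  have [/ler_normlP[_ mle] _] := mn.
  have : N * (1 - rho) ^+ 2 <= N * 1.
    by rewrite ler_pM2l// expr_le1//; lra.
  lra.
set u := be * k%:R / N in rh *; set s := u / 2 in rh *.
have uN : u * N = be * k%:R by rewrite /u divfK// gt_eqF.
have u0 : 0 < u by rewrite /u divr_gt0// mulr_gt0.
have u3 : u <= 3 * be.
  rewrite -(ler_pM2r N0) uN; have := ler_wpM2l (ltW be0) k3N; lra.
have s0 : 0 < s by rewrite /s; lra.
split; [by []|by lra|].
have Bu : 2 * B * u <= 2.
  have : B * u <= B * (ka / 2) by rewrite ler_pM2l//; lra.
  lra.
have su : s <= u by rewrite /s; lra.
have kas : - ka <= s by rewrite /s; lra.
have kau : - ka <= u by lra.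
have uka : u + u <= ka by lra.
have P2 := @exit_tail _ _ _ P rho N ka B m n mn (ltW N0) win W
  r k s u u X km su kas u0 kau uka rh rb HW.
have key : be ^+ 3 / 16 * (k%:R ^+ 3 / N ^+ 2) = N * u ^+ 3 / 16.
  by rewrite /u; field; rewrite gt_eqF.
have key2 : k%:R * u ^+ 2 * be = N * u ^+ 3.
  by rewrite /u; field; rewrite gt_eqF.
have be1 : be <= 1 by lra.
have ku0 : 0 <= k%:R * u ^+ 2 by rewrite mulr_ge0// sqr_ge0.
apply: le_trans P2 _; rewrite lee_fin ler_expR key gtr0_norm//.
have e1 : u * N * B * (u + u) ^+ 2 = 4 * B * be * (k%:R * u ^+ 2).
  by rewrite uN; ring.
have Bbe : 16 * B * be <= 1.
  have : B * (32 * be) <= B * ka by rewrite ler_pM2l.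
  lra.
have e2 : 4 * (4 * B * be * (k%:R * u ^+ 2)) <= k%:R * u ^+ 2.
  have := ler_wpM2r ku0 Bbe; lra.
have e3 : k%:R * (u * (u - s)) = k%:R * u ^+ 2 / 2 by rewrite /s; field.
have e4 : N * u ^+ 3 <= k%:R * u ^+ 2.
  by rewrite -key2 -[leRHS]mulr1 ler_wpM2l.
have e5 : 0 <= u * (X - N) by rewrite mulr_ge0//; lra.
rewrite e1 e3 mulNr; lra.
Qed.

(** Enlarging the axis weights to rate [1 - rho - s] preserves a late exit. In the enlarged process
    the level [N] separates: a passage time below [N] and a late-exit value above [N] are both
    unlikely, with the same exponent for [s = be k / (2 N)]. *)
Lemma exit_bound (rho N ka B be : R) m n k W :
  characteristic rho N m n -> 1 <= N ->
  [/\ 0 < ka, 2 * ka <= rho, 2 * ka <= 1 - rho & ka * B = 2] ->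
  0 < be -> 32 * be <= ka -> (0 < k <= m)%N ->
  independent_exponentials P (rect m n) (boundary_rate (1 - rho) rho) W ->
  (P [set w | (passage W m n w <= passage W k 0 w +
                passage (shifted (k, 0)%N W) (m - k) n w)%R] <=
   (2 * expR (2 - be ^+ 3 / 16 * (k%:R ^+ 3 / N ^+ 2)))%:E)%E.
Proof.
move=> mn N1 win be0 beka km HW; have [ka0 kr kr' kaB] := win.
have [mW W0 _ _] := HW.
have N0 : 0 < N by lra.
pose u := be * k%:R / N; pose s := u / 2.
have k0' : 0 < k%:R :> R by rewrite ltr0n; have [] := andP km.
have u0 : 0 < u by rewrite /u divr_gt0// mulr_gt0.
have k3N : k%:R <= 3 * N.
  have : k%:R <= m%:R :> R by rewrite ler_nat; have [] := andP km.
  have [/ler_normlP[_ mle] _] := mn.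
  have : N * (1 - rho) ^+ 2 <= N * 1.
    by rewrite ler_pM2l// expr_le1//; lra.
  lra.
have uN : u * N = be * k%:R by rewrite /u divfK// gt_eqF.
have u3 : u <= 3 * be.
  rewrite -(ler_pM2r N0) uN; have := ler_wpM2l (ltW be0) k3N; lra.
have s0 : 0 < s by rewrite /s; lra.
have ska : s <= ka by rewrite /s; lra.
have arho : 0 < 1 - rho by lra.
have arhos : 0 < 1 - rho - s by lra.
have rh i : boundary_rate (1 - rho) rho (i.+1, 0)%N = 1 - rho by [].
have := independent_exponentials_scale_axis arho arhos rh HW.
set c := (1 - rho) / (1 - rho - s).
set V := fun x w => scale_axis c (W^~ w) x.
have c1 : 1 <= c by rewrite /c ler_pdivlMr// mul1r; lra.
move=> HV.
have {}HV : independent_exponentials P (rect m n) (boundary_rate (1 - rho - s) rho) V.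
  apply: independent_exponentials_rate HV => -[i j] _; rewrite /boundary_rate /=.
  by case: (j == 0%N).
have [mV _ _ _] := HV.
set E := [set w | _].
pose E1 := [set w | passage V m n w <= N].
pose E2 := [set w | N <= passage V k 0 w + passage (shifted (k, 0)%N V) (m - k) n w].
have mpV a b : measurable_fun setT (passage V a b) by exact: measurable_passage.
have msV a b : measurable_fun setT (passage (shifted (k, 0)%N V) a b).
  by apply: measurable_passage => x; exact: mV.
have msW a b : measurable_fun setT (passage (shifted (k, 0)%N W) a b).
  by apply: measurable_passage => x; exact: mW.
have mpW a b : measurable_fun setT (passage W a b) by exact: measurable_passage.
have mE : measurable E.
  by apply: measurable_le_set => //; exact: measurable_funD.
have mE1 : measurable E1.
  by apply: measurable_le_set => //; exact: measurable_cst.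
have mE2 : measurable E2.
  by apply: measurable_le_set; [exact: measurable_cst|exact: measurable_funD].
have EE : E `<=` E1 `|` E2.
  move=> w Ew; have [h|h] := leP (passage V m n w) N; first by left.
  right; rewrite /E2 /=; apply: (le_trans (ltW h)).
  exact: (@exit_scale_axis _ c (W^~ w)).
have P1 := @passage_lower_tail _ _ _ P rho N ka B m n mn (ltW N0) win V s N s0 ska HV.
have rhV i : (0 < i <= m)%N ->
    boundary_rate (1 - rho - s) rho (i, 0)%N = 1 - rho - be * k%:R / N / 2 by [].
have rbV i j : (0 < i <= m)%N -> (0 < j <= n)%N ->
    boundary_rate (1 - rho - s) rho (i, j) = 1.
  by case: i j => [|i] [|j].
have [_ _ P2] := exit_tail_parabolic mn N1 (lexx N) win be0 beka km rhV rbV HV.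
have key : be ^+ 3 / 16 * (k%:R ^+ 3 / N ^+ 2) = N * s ^+ 3 / 2.
  by rewrite /s /u; field; rewrite gt_eqF.
have B0 : 0 < B by rewrite -(pmulr_rgt0 _ ka0) kaB.
have Bs : B * s <= B * ka by rewrite ler_pM2l.
have Bs' : 2 * B * s <= 2.
  have : B * s <= B * (ka / 2) by rewrite ler_pM2l// /s; lra.
  lra.
apply: (@le_trans _ _ (P E1 + P E2)%E).
  apply: (@le_trans _ _ (P (E1 `|` E2))).
    by apply: le_measure; rewrite ?inE//; exact: measurableU.
  exact: measureU2.
rewrite mulrDl mul1r EFinD; apply: leeD; last exact: P2.
by apply: (le_trans P1); rewrite lee_fin ler_expR key subrr mulr0; lra.
Qed.

End exit_bound.

(** * The geodesic and the square *)

Section geodesics.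
Context (R : realType).
Implicit Types (W : nat * nat -> R) (m n a b k : nat).

Lemma eq_geodesic W W' m n :
  (forall x, (x.1 <= m)%N -> (x.2 <= n)%N -> W x = W' x) ->
  geodesic W m n = geodesic W' m n.
Proof.
move=> WW'; rewrite /geodesic; congr (Order.arg_max _ _ _).
apply/funext => p; apply: eq_bigr => k _.
by apply: WW' => /=; rewrite -ltnS.
Qed.

Lemma lpp_axis_split W k j :
  lpp W (k + j) 0 = lpp W k 0 + lpp (shift (k, 0)%N W) j 0.
Proof.
elim: j => [|j IH]; first by rewrite addn0 lpp00 addr0.
by rewrite addnS !lppS0 IH shiftE /= addnS addrA.
Qed.

Lemma lpp_axis_split2 W k j :
  lpp W 0 (k + j) = lpp W 0 k + lpp (shift (0, k)%N W) 0 j.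
Proof.
elim: j => [|j IH]; first by rewrite addn0 lpp00 addr0.
by rewrite addnS !lpp0S IH shiftE /= addnS addrA.
Qed.

(** The geodesic enters the quadrant through an axis site beyond the box. Read in the rebased
    process, this site is reached along the axis through its site number [k + 1], so one late-exit
    event per axis covers every possible entry. *)
Lemma geodesic_misses_box W m n a b k : W (0, 0)%N = 0 ->
  (a <= m)%N -> (b <= n)%N ->
  (forall l x, site (geodesic W m n) l = x ->
     ~ [&& (a <= x.1)%N, (x.1 <= a + k)%N, (b <= x.2)%N & (x.2 <= b + k)%N]) ->
  let V := rebase W a b in
  ((k < m - a)%N /\ lpp V (m - a) (n - b) <=
     lpp V k.+1 0 + lpp (shift (k.+1, 0)%N V) (m - a - k.+1) (n - b)) \/
  ((k < n - b)%N /\ lpp V (m - a) (n - b) <=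
     lpp V 0 k.+1 + lpp (shift (0, k.+1)%N V) (m - a) (n - b - k.+1)).
Proof.
move=> W0 am bn miss V.
have [l [[c kc pl]|[c kc pl]]] :=
    up_right_enters (up_right_geodesic W m n) am bn miss.
- left; have [cm _ gc] := geodesic_through W0 pl.
  have [i ci] : exists i, c = (a + i)%N by exists (c - a)%N; lia.
  subst c; have ki : (k < i)%N by lia.
  have im : (i <= m - a)%N by lia.
  split; first exact: leq_trans im.
  have h1 : lpp V (m - a) (n - b) <= lpp V i 0 + lpp (shift (i, 0)%N V) (m - a - i) (n - b).
    rewrite !lpp_rebase !subnKC// addn0.
    have := shift_le_rebase W a b i 0 (m - a - i) (n - b).
    by rewrite addn0 -subnDA -/V; move: gc; rewrite subnDA; lra.
  apply: (le_trans h1).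
  have h2 := lpp_superadd (shift (k.+1, 0)%N V) (i - k.+1) 0 (m - a - i) (n - b).
  have e1 : (i - k.+1 + (m - a - i) = m - a - k.+1)%N by clear -ki im; lia.
  rewrite e1 add0n in h2.
  have e2 : lpp V i 0 = lpp V k.+1 0 + lpp (shift (k.+1, 0)%N V) (i - k.+1) 0.
    by rewrite -{1}(subnKC ki) lpp_axis_split.
  have e3 : lpp (shift ((i - k.+1)%N, 0%N) (shift (k.+1, 0)%N V)) (m - a - i) (n - b) =
            lpp (shift (i, 0)%N V) (m - a - i) (n - b).
    by apply: eq_lpp => x _ _ _; rewrite !shiftE !addnA subnKC.
  by rewrite e2 -addrA lerD2l -e3.
- right; have [_ cn gc] := geodesic_through W0 pl.
  have [i ci] : exists i, c = (b + i)%N by exists (c - b)%N; lia.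
  subst c; have ki : (k < i)%N by lia.
  have im : (i <= n - b)%N by lia.
  split; first exact: leq_trans im.
  have h1 : lpp V (m - a) (n - b) <= lpp V 0 i + lpp (shift (0, i)%N V) (m - a) (n - b - i).
    rewrite !lpp_rebase !subnKC// addn0.
    have := shift_le_rebase W a b 0 i (m - a) (n - b - i).
    by rewrite addn0 -subnDA -/V; move: gc; rewrite subnDA; lra.
  apply: (le_trans h1).
  have h2 := lpp_superadd (shift (0, k.+1)%N V) 0 (i - k.+1) (m - a) (n - b - i).
  have e1 : (i - k.+1 + (n - b - i) = n - b - k.+1)%N by clear -ki im; lia.
  rewrite e1 add0n in h2.
  have e2 : lpp V 0 i = lpp V 0 k.+1 + lpp (shift (0, k.+1)%N V) 0 (i - k.+1).
    by rewrite -{1}(subnKC ki) lpp_axis_split2.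
  have e3 : lpp (shift (0%N, (i - k.+1)%N) (shift (0, k.+1)%N V)) (m - a) (n - b - i) =
            lpp (shift (0, i)%N V) (m - a) (n - b - i).
    by apply: eq_lpp => x _ _ _; rewrite !shiftE !addnA subnKC.
  by rewrite e2 -addrA lerD2l -e3.
Qed.

End geodesics.

(** * Measurability of events of the geodesic *)

Section measurable_geodesic.
Context d (T : measurableType d) (R : realType).

Lemma measurable_finfun (F : finType) (h : T -> {ffun F -> bool})
    (Q : {ffun F -> bool} -> Prop) :
  (forall i, measurable [set w | h w i]) -> measurable [set w | Q (h w)].
Proof.
move=> mh.
rewrite (_ : [set w | _] = \bigcup_(tau in Q) \bigcap_(i in setT)
    [set w | h w i = tau i]); last first.
  apply/seteqP; split => w /=; first by move=> Qw; exists (h w).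
  by move=> [tau Qtau hw]; rewrite (_ : h w = tau)//; apply/ffunP => i; exact: hw.
apply: fin_bigcup_measurable => [|tau _]; first exact: finite_finset.
apply: fin_bigcap_measurable => [|i _]; first exact: finite_finset.
case: (tau i); first exact: mh.
rewrite (_ : [set w | _] = ~` [set w | h w i]); first exact: measurableC.
by apply/seteqP; split => w /=; [move=> ->|move/negP/negbTE].
Qed.

(** The weights enter the choice of the geodesic only through finitely many comparisons [h] between
    path weights, and [sel] recovers the chosen path from them. Any property of the path is
    therefore measurable. *)
Lemma measurable_geodesic (W : nat * nat -> T -> R) m n (Q : lattice_path m n -> Prop) :
  (forall x, measurable_fun setT (W x)) ->
  measurable [set w | Q (geodesic (W^~ w) m n)].
Proof.
move=> mW.
pose h w : {ffun lattice_path m n * lattice_path m n -> bool} :=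
  [ffun pq => path_weight (W^~ w) pq.2 <= path_weight (W^~ w) pq.1].
pose sel (tau : {ffun lattice_path m n * lattice_path m n -> bool}) :=
  odflt (right_then_up m n)
    [pick p | up_right p && [forall q, up_right q ==> tau (p, q)]].
have geoE w : geodesic (W^~ w) m n = sel (h w).
  rewrite /geodesic /Order.arg_max /extremum /sel; congr odflt.
  by apply: eq_pick => p /=; congr (_ && _); apply: eq_forallb => q; rewrite ffunE.
rewrite (_ : [set w | _] = [set w | (Q \o sel) (h w)]); last first.
  by apply/seteqP; split => w /=; rewrite geoE.
apply: measurable_finfun => -[p q].
rewrite (_ : [set w | _] =
    [set w | path_weight (W^~ w) q <= path_weight (W^~ w) p]); last first.
  by apply/seteqP; split => w /=; rewrite ffunE.
by apply: measurable_le_set; apply: measurable_sum.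
Qed.

End measurable_geodesic.

(** * The model with surely nonnegative weights *)

Section model.
Context d (T : measurableType d) (R : realType) (P : probability T R).
Variables (rho : R) (omega : nat * nat -> {RV P >-> R}) (I J : nat -> {RV P >-> R}).
Hypothesis HW : increment_stationary rho omega I J.
Hypothesis rho01 : 0 < rho < 1.

(** Exponential variables are nonnegative only almost surely, while the coupling arguments use
    nonnegativity at every sample point. On a finite rectangle the truncation changes the weights
    only on a null event. *)
Definition positive_weight (x : nat * nat) (w : T) : R :=
  Num.max (weight omega I J x w) 0.

Lemma measurable_weight x : measurable_fun setT (weight omega I J x).
Proof.
by case: x => [[|i] [|j]] /=; [exact: measurable_cst|exact: measurable_funP..].
Qed.

Lemma weight_law m n x : rect m n x -> 0 < boundary_rate (1 - rho) rho x /\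
  forall B, measurable B ->
    P (weight omega I J x @^-1` B) = exponential_prob (boundary_rate (1 - rho) rho x) B.
Proof.
have [_ oE IE JE] := HW; have [rho0 rho1] := andP rho01.
case: x => [[|i] [|j]] // _; rewrite /boundary_rate /=; split => //.
- exact: JE.
- by rewrite subr_gt0.
- exact: IE.
- exact: oE.
Qed.

Lemma weight_independent m n :
  mutually_independent P (rect m n) (weight omega I J).
Proof.
have [iW _ _ _] := HW; move=> s B us sD mB; apply: iW => // x /sD.
by rewrite /rect /= => /and3P[].
Qed.

Lemma positive_weight_independent m n :
  independent_exponentials P (rect m n) (boundary_rate (1 - rho) rho) positive_weight.
Proof.
apply: independent_exponentials_pos.
- exact: measurable_weight.
- exact: weight_independent.
- by move=> x; exact: weight_law.
Qed.

Lemma weight_nonneg_as m n : exists2 O : set T, measurable O /\ P O = 1%E &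
  forall w, O w -> forall x, (x.1 <= m)%N -> (x.2 <= n)%N ->
    weight omega I J x w = positive_weight x w.
Proof.
pose s := [seq x <- [seq (i, j) | i <- iota 0 m.+1, j <- iota 0 n.+1] | x != (0, 0)%N].
have us : uniq s.
  rewrite filter_uniq// allpairs_uniq ?iota_uniq//.
  by move=> [? ?] [? ?] _ _.
have sE x : x \in s -> rect m n x.
  rewrite mem_filter => /andP[x0 /allpairsP[[i j] []]].
  rewrite !mem_iota !add0n !ltnS /= => im jn xE.
  by rewrite /rect /= x0 xE /= im jn.
pose O := \bigcap_(x in [set` s]) weight omega I J x @^-1` `[0, +oo[.
have mO : measurable O.
  apply: fin_bigcap_measurable => // x _; rewrite -[_ @^-1` _]setTI.
  exact: measurable_weight.
exists O.
  split => //; have iW := @weight_independent m n.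
  rewrite /O (iW s (fun=> `[0, +oo[%classic) us sE)//.
  rewrite big_seq big1// => x xs; have [r0 ->//] := weight_law (sE _ xs).
  have [Q QE] := exists_exponential r0.
  rewrite -QE// -setCitvl probability_setC// QE// exponential_prob_lt0 sube0//.
move=> w Ow [i j] im jn; rewrite /positive_weight.
have [->|ij] := eqVneq (i, j) (0, 0)%N; first by rewrite /= maxxx.
have ijs : (i, j) \in s.
  rewrite mem_filter ij; apply/allpairsP; exists (i, j).
  by rewrite !mem_iota !add0n !ltnS; split.
by have := Ow _ ijs; rewrite /= in_itv/= andbT => h; apply/esym/max_idPl.
Qed.

End model.

Lemma le_probability_as d (T : measurableType d) (R : realType) (P : probability T R)
    (O A B : set T) : measurable O -> P O = 1%E -> measurable A -> measurable B ->
  A `&` O `<=` B -> (P A <= P B)%E.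
Proof.
move=> mO PO mA mB AOB.
apply: (@le_trans _ _ (P (B `|` ~` O))).
  apply: le_measure; rewrite ?inE//.
    by apply: measurableU => //; exact: measurableC.
  by move=> w Aw; have [Ow|Ow] := pselect (O w); [left; apply: AOB|right].
apply: (@le_trans _ _ (P B + P (~` O))%E).
  by apply: measureU2 => //; exact: measurableC.
by rewrite probability_setC// PO subee// adde0.
Qed.

(** * The upper bound for missing the square *)

Section upper_bound.
Context d (T : measurableType d) (R : realType) (P : probability T R).

(** Transposition exchanges the axes, hence [rho] with [1 - rho]; the conditions on [ka] are
    symmetric under this exchange. *)
Lemma exit_bound_vertical (rho N ka B be : R) m n k (W : nat * nat -> T -> R) :
  characteristic rho N m n -> 1 <= N ->
  [/\ 0 < ka, 2 * ka <= rho, 2 * ka <= 1 - rho & ka * B = 2] ->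
  0 < be -> 32 * be <= ka -> (0 < k <= n)%N ->
  independent_exponentials P (rect m n) (boundary_rate (1 - rho) rho) W ->
  (P [set w | (passage W m n w <= passage W 0 k w +
                passage (shifted (0, k)%N W) m (n - k) w)%R] <=
   (2 * expR (2 - be ^+ 3 / 16 * (k%:R ^+ 3 / N ^+ 2)))%:E)%E.
Proof.
move=> [mE nE] N1 [ka0 kr kr' kaB] be0 beka kn HW.
have rhoK : 1 - (1 - rho) = rho by ring.
have HWt := independent_exponentials_transposed HW.
rewrite -[X in boundary_rate X]rhoK in HWt.
have ch : characteristic (1 - rho) N n m by split; rewrite ?rhoK.
have := exit_bound ch N1 (And4 ka0 kr' _ kaB) be0 beka kn HWt.
rewrite rhoK => /(_ kr); apply: le_trans.
rewrite (_ : [set w | _] = [set w | passage (transposed W) n m w <=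
   passage (transposed W) k 0 w +
   passage (shifted (k, 0)%N (transposed W)) (n - k) m w])//.
apply/seteqP; split => w /=; rewrite !passage_transposed;
by rewrite -(passage_transposed (shifted (0, k)%N W)).
Qed.

Lemma ceil_nat (x : R) : 0 <= x -> exists a : nat, x <= a%:R < x + 1.
Proof.
move=> x0; have /andP[h1 h2] := truncn_itv x0.
have [e|ne] := eqVneq x (Num.truncn x)%:R.
  by exists (Num.truncn x); rewrite -e; lra.
exists (Num.truncn x).+1; rewrite -natr1 in h2 *.
have : (Num.truncn x)%:R < x by rewrite lt_neqAle eq_sym ne.
by move=> ?; apply/andP; split; lra.
Qed.

(** Here [x] is a real side length, [q] its integer part and [c] a rounding of [t q]. The remaining
    rectangle then has the characteristic shape of scale [(1 - t) N]. *)
Lemma remaining_distance (t x : R) (q c : nat) : 0 <= t <= 1 -> (c <= q)%N ->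
  q%:R <= x < q.+1%:R -> `|c%:R - t * q%:R| <= 1 ->
  `|(q - c)%:R - (1 - t) * x| <= 2.
Proof.
move=> /andP[t0 t1] cq; rewrite -natr1 natrB// => /andP[q1 q2] /ler_normlP[c1 c2].
have t1' : 0 <= 1 - t by lra.
have h1 : (1 - t) * q%:R <= (1 - t) * x by rewrite ler_wpM2l.
have h2 : (1 - t) * x <= (1 - t) * (q%:R + 1) by rewrite ler_wpM2l// ltW.
rewrite ler_norml; apply/andP; split; lra.
Qed.

Lemma powR23_cube (N : R) : 0 <= N -> (N `^ (2 / 3)) ^+ 3 = N ^+ 2.
Proof.
move=> N0; rewrite -powR_mulrn ?powR_ge0// -powRrM.
by rewrite (_ : 2 / 3 * 3%:R = 2%:R :> R) ?powR_mulrn//; field.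
Qed.

(** The rectangle beyond the corner has scale [(1 - t) N], which [delta^-1 <= N] keeps at least 1.
    The two axes contribute a factor 2 each to the constant 4. *)
Lemma geodesic_misses_upper (rho ka B be delta t r N : R)
    (omega : nat * nat -> {RV P >-> R}) (I J : nat -> {RV P >-> R}) :
  increment_stationary rho omega I J -> 0 < rho < 1 ->
  [/\ 0 < ka, 2 * ka <= rho, 2 * ka <= 1 - rho & ka * B = 2] ->
  0 < be -> 32 * be <= ka -> 0 < delta < 1 -> 1 <= r -> delta^-1 <= N ->
  0 <= t <= 1 - delta ->
  (P (geodesic_misses omega I J rho N t (r * N `^ (2 / 3))) <=
   (4 * expR (2 - be ^+ 3 / 16 * (r ^+ 3 / 8)))%:E)%E.
Proof.
move=> HW rho01 win be0 beka /andP[de0 de1] r1 deN /andP[t0 t1].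
have [rho0 rho1] := andP rho01.
have N1 : 1 <= N by apply: le_trans deN; rewrite invf_ge1// ltW.
have N0 : 0 < N by lra.
have N'1 : 1 <= (1 - t) * N.
  have h1 : 1 <= delta * N by rewrite mulrC -ler_pdivrMr// mul1r.
  apply: (le_trans h1); rewrite ler_pM2r//; lra.
have N'N : (1 - t) * N <= N by rewrite ler_piMl//; lra.
set l := r * N `^ (2 / 3).
have l1 : 1 <= l.
  have N23 : 1 <= N `^ (2 / 3).
    have : N `^ 0 <= N `^ (2 / 3) by apply: ler_powR => //; lra.
    by rewrite powRr0.
  by rewrite -[1]mulr1 /l ler_pM.
set m := Num.truncn (N * (1 - rho) ^+ 2).
set n := Num.truncn (N * rho ^+ 2).
have m_itv : m%:R <= N * (1 - rho) ^+ 2 < m.+1%:R.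
  by apply: truncn_itv; rewrite mulr_ge0 ?sqr_ge0// ltW.
have n_itv : n%:R <= N * rho ^+ 2 < n.+1%:R.
  by apply: truncn_itv; rewrite mulr_ge0 ?sqr_ge0// ltW.
have [|a a_itv] := @ceil_nat (t * m%:R); first by rewrite mulr_ge0.
have [|b b_itv] := @ceil_nat (t * n%:R); first by rewrite mulr_ge0.
have tle (q : nat) : t * q%:R <= q%:R by rewrite ler_piMl//; lra.
have am : (a <= m)%N.
  by rewrite -ltnS -(ltr_nat R) -natr1; have := tle m; lra.
have bn : (b <= n)%N.
  by rewrite -ltnS -(ltr_nat R) -natr1; have := tle n; lra.
have t01 : 0 <= t <= 1 by lra.
have ch : characteristic rho ((1 - t) * N) (m - a) (n - b).
  by split; rewrite -mulrA; apply: remaining_distance => //; rewrite ler_norml; lra.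
(* The corner is rounded up by less than one unit, so the box has side [k], one less than the
   integer part of [l]: it then still lies in the real square, and a geodesic that misses the square
   misses the box. *)
have [k kE] : exists k, Num.truncn l = k.+1.
  have : (0 < Num.truncn l)%N by rewrite truncn_gt0.
  by case: (Num.truncn l) => // k _; exists k.
have /andP[kl lk] : k.+1%:R <= l < k.+2%:R by rewrite -kE truncn_itv//; lra.
pose W := positive_weight omega I J.
have HP : independent_exponentials P (rect (a + (m - a)) (b + (n - b)))
    (boundary_rate (1 - rho) rho) W by exact: positive_weight_independent.
have rr1 : 1 - rho + rho = 1 by ring.
have HV := rebased_stationary rr1 HP.
set V := rebased W a b in HV; have [mV _ _ _] := HV.
have mW x : measurable_fun setT (W x).
  by have [+ _ _ _] := HP; exact.
pose Eh := [set w | passage V (m - a) (n - b) w <= passage V k.+1 0 w +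
                passage (shifted (k.+1, 0)%N V) (m - a - k.+1) (n - b) w].
pose Ev := [set w | passage V (m - a) (n - b) w <= passage V 0 k.+1 w +
                passage (shifted (0, k.+1)%N V) (m - a) (n - b - k.+1) w].
have mEh : measurable Eh.
  apply: measurable_le_set; first exact: measurable_passage.
  apply: measurable_funD; first exact: measurable_passage.
  by apply: measurable_passage => x; exact: mV.
have mEv : measurable Ev.
  apply: measurable_le_set; first exact: measurable_passage.
  apply: measurable_funD; first exact: measurable_passage.
  by apply: measurable_passage => x; exact: mV.
pose Fh := if (k < m - a)%N then Eh else set0.
pose Fv := if (k < n - b)%N then Ev else set0.
have mFh : measurable Fh by rewrite /Fh; case: ifP.
have mFv : measurable Fv by rewrite /Fv; case: ifP.
have := weight_nonneg_as HW rho01 m n.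
move=> [Om [mO PO] OW].
set A := geodesic_misses _ _ _ _ _ _ _.
have mA : measurable A.
  exact: (@measurable_geodesic _ T R (weight omega I J) m n (fun p =>
    @path_sites R m n p `&` closed_square l (t * m%:R, t * n%:R) = set0)
    (measurable_weight omega I J)).
have AF : A `&` Om `<=` Fh `|` Fv.
  move=> w [Aw Ow].
  have W00 : W (0, 0)%N w = 0 by rewrite /W /positive_weight /= maxxx.
  have geoE : geodesic (fun x => weight omega I J x w) m n = geodesic (W^~ w) m n.
    by apply: eq_geodesic => x xm xn; exact: OW.
  have miss : forall (q : 'I_(m + n).+1) x, site (geodesic (W^~ w) m n) q = x ->
     ~ [&& (a <= x.1)%N, (x.1 <= a + k)%N, (b <= x.2)%N & (x.2 <= b + k)%N].
    move=> q [x y] xE /and4P[/= ax xa yb0 yb].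
    move: Aw; rewrite /A /geodesic_misses /= -/m -/n geoE => /eqP.
    apply/negP/set0P; exists (x%:R, y%:R); split.
      by exists q => //; rewrite xE.
    move: ax xa yb0 yb; rewrite -!(ler_nat R) !natrD => ax xa yb1 yb2.
    rewrite -natr1 in kl.
    clear -P ax xa yb1 yb2 a_itv b_itv kl.
    by split => /=; apply/andP; split; lra.
  have [[km h]|[kn h]] := geodesic_misses_box W00 am bn miss.
    by left; rewrite /Fh km.
  by right; rewrite /Fv kn.
have expo : expR (2 - be ^+ 3 / 16 * (k.+1%:R ^+ 3 / ((1 - t) * N) ^+ 2)) <=
            expR (2 - be ^+ 3 / 16 * (r ^+ 3 / 8)).
  rewrite ler_expR lerD2l lerN2 ler_pM2l; last by rewrite divr_gt0// exprn_gt0.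
  (* Taking the integer part costs at most a factor 2, the origin of the 8 in the exponent. *)
  have l2 : l / 2 <= k.+1%:R.
    clear -P lk.
    have : 0 <= k%:R :> R by [].
    by have := @natr1 R k; have := @natr1 R k.+1; lra.
  have h1 : (l / 2) ^+ 3 <= k.+1%:R ^+ 3 by rewrite lerXn2r ?nnegrE//; lra.
  have h2 : (l / 2) ^+ 3 = r ^+ 3 / 8 * N ^+ 2.
    by rewrite expr_div_n {1}/l exprMn powR23_cube ?ltW//; field.
  have h3 : ((1 - t) * N) ^+ 2 <= N ^+ 2.
    by clear -P N'1 N'N N1; rewrite lerXn2r ?nnegrE//; lra.
  rewrite ler_pdivlMr ?exprn_gt0//; last lra.
  apply: le_trans h1; rewrite h2 ler_wpM2l// divr_ge0// exprn_ge0//; lra.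
have bh : (P Fh <= (2 * expR (2 - be ^+ 3 / 16 * (r ^+ 3 / 8)))%:E)%E.
  rewrite /Fh; case: ifP => km; last by rewrite measure0 lee_fin mulr_ge0 ?expR_ge0.
  have hb := @exit_bound _ _ _ P rho ((1 - t) * N) ka B be (m - a) (n - b) k.+1 V
    ch N'1 win be0 beka km HV.
  apply: (le_trans hb).
  by rewrite lee_fin ler_pM2l.
have bv : (P Fv <= (2 * expR (2 - be ^+ 3 / 16 * (r ^+ 3 / 8)))%:E)%E.
  rewrite /Fv; case: ifP => kn; last by rewrite measure0 lee_fin mulr_ge0 ?expR_ge0.
  have hb := @exit_bound_vertical rho ((1 - t) * N) ka B be (m - a) (n - b) k.+1 V
    ch N'1 win be0 beka kn HV.
  apply: (le_trans hb).
  by rewrite lee_fin ler_pM2l.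
have mFU : measurable (Fh `|` Fv) by exact: measurableU.
apply: (le_trans (le_probability_as mO PO mA mFU AF)).
apply: (@le_trans _ _ (P Fh + P Fv)%E); first exact: measureU2.
apply: (le_trans (leeD bh bv)).
by rewrite -EFinD lee_fin; lra.
Qed.

Lemma expRN_le (y : R) : 0 < y -> expR (- y) <= y^-1.
Proof.
move=> y0; rewrite expRN lef_pV2 ?posrE ?expR_gt0//.
by have := expR_ge1Dx y; lra.
Qed.

End upper_bound.

(** * Lower bound *)

Section change_of_measure.
Context d (T : measurableType d) (R : realType).
Implicit Types (P : probability T R).

(* With f = dQ/dP, f <= M + f^2/M gives Q F <= M P F + E[f^2]/M. *)
Lemma tilt_comparison P (K : choiceType) (D : set K) (r : K -> R)
    (X : K -> T -> R) (s : seq K) (a al : R) :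
  independent_exponentials P D r X -> uniq s -> 0 < a -> 2 * a < al ->
  (forall i, i \in s -> D i /\ r i = al) ->
  exists Q : probability T R,
    independent_exponentials Q D (fun l => if l \in s then al - a else r l) X /\
    forall (F : set T) (M : R), measurable F -> 0 < M ->
      (Q F <= M%:E * P F +
        ((((al - a) ^+ 2 / (al * (al - 2 * a))) ^+ size s) / M)%:E)%E.
Proof.
move=> HX us a0 aal sD; have [mX X0 _ _] := HX.
have al0 : 0 < al by lra.
have aal' : a < al by lra.
have [Q [HQ QE]] := tilt_sum HX us al0 aal' sD.
exists Q; split => // F M mF M0.
set S := fun w => \sum_(i <- s) X i w.
have mS : measurable_fun setT S by exact: measurable_sum_seq.
(* [q] normalizes the tilt, so the likelihood ratio is [expR (a * S w) / q] and the level [M] for it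
   appears as [q * M]. *)
set q := (al / (al - a)) ^+ size s.
have q0 : 0 < q by rewrite exprn_gt0// divr_gt0//; lra.
have mI : measurable_fun setT (\1_F : T -> R) by exact: measurable_indic.
have I0 w : 0 <= (\1_F w : R) by [].
have := QE _ mI I0; rewrite integral_indic// setIT -/q => QF.
have L2 := independent_exponentials_laplace HX us al0 aal sD.
have PF : P F \is a fin_num by rewrite fin_num_measure.
have QFfin : Q F \is a fin_num by rewrite fin_num_measure.
have mexp c : measurable_fun setT (fun w => (expR (c * S w))%:E).
  by apply/measurable_EFinP; exact: measurable_expRM.
have le1 : (\int[P]_w (expR (a * S w) * \1_F w)%:E <=
    (q * M)%:E * P F + ((q * M)^-1)%:E * \int[P]_w (expR (2 * a * S w))%:E)%E.
  have qM : 0 < q * M by exact: mulr_gt0.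
  pose f1 w := (q * M * \1_F w)%:E.
  pose f2 w := ((q * M)^-1 * expR (2 * a * S w))%:E.
  have mf1 : measurable_fun setT f1.
    by apply/measurable_EFinP; apply: measurable_funM; first exact: measurable_cst.
  have mf2 : measurable_fun setT f2.
    apply/measurable_EFinP; apply: measurable_funM; first exact: measurable_cst.
    exact: measurable_expRM.
  have f10 w : (0 <= f1 w)%E by rewrite lee_fin mulr_ge0// ltW.
  have f20 w : (0 <= f2 w)%E by rewrite lee_fin mulr_ge0 ?expR_ge0// invr_ge0 ltW.
  have <- : (\int[P]_w f1 w = (q * M)%:E * P F)%E.
    rewrite -[in RHS](setIT F) -integral_indic// -ge0_integralZl_EFin ?(ltW qM)//.
    exact/measurable_EFinP.
  have <- : (\int[P]_w f2 w =
      (q * M)^-1%:E * \int[P]_w (expR (2 * a * S w))%:E)%E.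
    by rewrite -ge0_integralZl_EFin ?invr_ge0 ?(ltW qM).
  rewrite -ge0_integralD//; apply: ge0_le_integral => //.
  - by apply/measurable_EFinP; apply: measurable_funM => //; exact: measurable_expRM.
  - exact: emeasurable_funD.
  move=> w _; rewrite /f1 /f2 -EFinD lee_fin.
  have -> : expR (2 * a * S w) = expR (a * S w) * expR (a * S w).
    by rewrite -expRD; congr expR; ring.
  set e := expR _; have e0 : 0 < e := expR_gt0 _.
  rewrite indicE; case: (w \in F) => /=; last first.
    by rewrite !mulr0 add0r mulr_ge0 ?invr_ge0 ?mulr_ge0 ?ltW.
  rewrite !mulr1 -(ler_pM2l qM) mulrDr mulVKf ?gt_eqF//.
  have : 0 <= (q * M - e) ^+ 2 + (q * M) ^+ 2 + e ^+ 2 by rewrite !addr_ge0 ?sqr_ge0.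
  have sq : (q * M - e) ^+ 2 = (q * M) ^+ 2 - 2 * (q * M * e) + e ^+ 2 by ring.
  rewrite sq -!expr2; lra.
have QF' : (q%:E * Q F = (q * fine (Q F))%:E)%E by rewrite EFinM fineK.
rewrite QF QF' L2 in le1.
move: le1; rewrite -(fineK PF) -(fineK QFfin) -!EFinM -!EFinD !lee_fin => le1.
rewrite -(ler_pM2l q0); apply: (le_trans le1); rewrite mulrDr; apply: lerD.
  by rewrite mulrA.
have pAC : (al / (al - a))^-1 * (al / (al - 2 * a)) =
    al / (al - a) * ((al - a) ^+ 2 / (al * (al - 2 * a))).
  by field; repeat (apply/andP; split); rewrite gt_eqF//; lra.
rewrite invfM mulrAC mulrA ler_pM2r ?invr_gt0// /q -exprVn -!exprMn pAC.
exact: lexx.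
Qed.

End change_of_measure.

(** * Tail bounds for partially tilted axes *)

Section lower_bound_ingredients.
Context d (T : measurableType d) (R : realType) (P : probability T R).
Implicit Types (W V : nat * nat -> T -> R) (m n k K : nat).

(** A positive exponent requires [al + be > 1], that is, smaller axis weights than the stationary
    ones. By [lpp_exit] with [k = 1], a path either avoids the horizontal axis and does not see the
    change, or passes through [(1, 0)], where [exit_tail] with [s = u = 0] applies. Hence the factor
    2. *)
Lemma passage_upper_tail (rho N ka B a Y : R) m n W :
  characteristic rho N m n -> 0 <= N ->
  [/\ 0 < ka, 2 * ka <= rho, 2 * ka <= 1 - rho & ka * B = 2] ->
  0 < a -> a <= ka -> (0 < m)%N ->
  independent_exponentials P (rect m n) (boundary_rate (1 - rho) rho) W ->
  (P [set w | (Y <= passage W m n w)%R] <=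
   (2 * expR (- a * (Y - N) + N * B * a ^+ 3 + 2 * B * a))%:E)%E.
Proof.
move=> mn N0 win a0 aka m0 HW; have [ka0 kr kr' kaB] := win.
have [mW W0 _ _] := HW.
have al0 : 0 < 1 - rho by lra.
have al'0 : 0 < 1 - rho + a by lra.
have rh i : boundary_rate (1 - rho) rho (i.+1, 0)%N = 1 - rho by [].
have := independent_exponentials_scale_axis al0 al'0 rh HW.
set c := (1 - rho) / (1 - rho + a); set V := fun x w => scale_axis c (W^~ w) x.
move=> HV.
have {}HV : independent_exponentials P (rect m n) (boundary_rate (1 - rho + a) rho) V.
  apply: independent_exponentials_rate HV => -[i j] _; rewrite /boundary_rate /=.
  by case: (j == 0%N).
have [mV _ _ _] := HV.
pose E1 := [set w | Y <= passage V m n w].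
pose E2 := [set w | Y <= passage W 1 0 w + passage (shifted (1, 0)%N W) (m - 1) n w].
have mE1 : measurable E1.
  by apply: measurable_le_set; [exact: measurable_cst|exact: measurable_passage].
have mE2 : measurable E2.
  apply: measurable_le_set; first exact: measurable_cst.
  apply: measurable_funD; first exact: measurable_passage.
  by apply: measurable_passage => x; exact: mW.
have mE : measurable [set w | Y <= passage W m n w].
  by apply: measurable_le_set; [exact: measurable_cst|exact: measurable_passage].
have EE : [set w | Y <= passage W m n w] `<=` E1 `|` E2.
  move=> w /= Yw; rewrite /E1 /E2 /=.
  (* [lpp_exit] asks for agreement at the origin as well. [V] is scaled there, and restoring the
     value leaves the passage time unchanged. *)
  pose U x := if x == (0, 0)%N then W x w else V x w.
  have UV : lpp U m n = passage V m n w.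
    by apply: eq_lpp => x x0 _ _; rewrite /U (negbTE x0).
  have := lpp_exit (W := W^~ w) (W' := U) n (ltn0Sn 0) m0.
  rewrite UV => h; have {}h := le_trans Yw (h _).
  have : Y <= Num.max (passage V m n w)
     (passage W 1 0 w + passage (shifted (1, 0)%N W) (m - 1) n w).
    by apply: h => -[[|i] [|j]].
  by rewrite le_max => /orP[]; [left|right].
have al01 : 0 < 1 - rho + a < 1 by lra.
have be01 : 0 < rho < 1 by lra.
have P1 := passage_chernoff Y al01 be01 HV.
have aE : 1 - rho + a + rho - 1 = a by ring.
rewrite aE in P1.
have P1' : (P E1 <= (expR (- a * (Y - N) + N * B * a ^+ 3 + 2 * B * a))%:E)%E.
  rewrite (_ : E1 = [set w | a * Y <= a * passage V m n w]); last first.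
    by apply/seteqP; split => w /=; rewrite ler_pM2l.
  apply: (le_trans P1); rewrite lee_fin.
  rewrite (_ : 1 - (1 - rho + a) = rho - a); last by ring.
  rewrite (_ : 1 - rho + a = 1 - (rho - a)); last by ring.
  rewrite expR_cumulant; try lra.
  rewrite -expRD ler_expR.
  have := @cumulant_diff_le R rho N ka B m n mn N0 win (- a) 0 (a ^+ 2).
  rewrite addr0 => h; have {}h := h _ _ _ _.
  have {}h : cumulant n m rho - cumulant n m (rho - a) <=
      (N * (1 + B * a ^+ 2) + 2 * B) * (0 - - a).
    apply: h; try lra; move=> z zI.
    rewrite -[leLHS]sqrrN ler_sqr ?nnegrE; lra.
  lra.
have P2 : (P E2 <= (expR (- a * (Y - N) + N * B * a ^+ 3 + 2 * B * a))%:E)%E.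
  have km : (0 < 1 <= m)%N by [].
  have ka' : - ka <= 0 by lra.
  have oa : 0 + a <= ka by lra.
  have rb i j : (0 < i <= m)%N -> (0 < j <= n)%N -> boundary_rate (1 - rho) rho (i, j) = 1.
    by case: i j => [|i] [|j].
  have rh' i : (0 < i <= m)%N -> boundary_rate (1 - rho) rho (i, 0)%N = 1 - rho - 0.
    by rewrite subr0.
  have := @exit_tail _ _ _ P rho N ka B m n mn N0 win W
    (boundary_rate (1 - rho) rho) 1 0 0 a Y km (lexx 0) ka' a0 ka' oa rh' rb HW.
  move=> /le_trans; apply; rewrite lee_fin ler_expR normr0; lra.
apply: (@le_trans _ _ (P E1 + P E2)%E).
  apply: (@le_trans _ _ (P (E1 `|` E2))).
    by apply: le_measure; rewrite ?inE//; exact: measurableU.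
  exact: measureU2.
by rewrite mulrDl mul1r EFinD; apply: leeD.
Qed.

Lemma axis_tail (r : nat * nat -> R) (al ka z : R) m n k W : 0 < ka -> 2 * ka <= al ->
  (k <= m)%N -> (forall i, (0 < i <= k)%N -> r (i, 0)%N = al) ->
  independent_exponentials P (rect m n) r W ->
  (P [set w | (z <= passage W k 0 w)%R] <= (expR (k%:R - ka * z))%:E)%E.
Proof.
move=> ka0 kaal km rh HW; have [mW _ _ _] := HW.
pose s := [seq (i.+1, 0%N) | i <- iota 0 k].
have us : uniq s by rewrite map_inj_uniq ?iota_uniq// => i j [].
have sW w : \sum_(x <- s) W x w = passage W k 0 w.
  by rewrite big_map big_iota /passage lpp_axis.
have al0 : 0 < al by lra.
have kaal' : ka < al by lra.
have sD x : x \in s -> rect m n x /\ r x = al.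
  move=> /mapP[i]; rewrite mem_iota add0n /= => ik ->.
  by split; [rewrite /rect /= (leq_trans ik)|rewrite rh].
have := independent_exponentials_laplace HW us al0 kaal' sD.
rewrite size_map size_iota => H.
have mY : measurable_fun setT (fun w => ka * passage W k 0 w).
  by apply: measurable_funM; [exact: measurable_cst|exact: measurable_passage].
rewrite (_ : [set w | _] = [set w | ka * z <= ka * passage W k 0 w]); last first.
  by apply/seteqP; split => w /=; rewrite ler_pM2l.
have := @chernoff _ _ _ P _ (expR k%:R) (ka * z) mY.
rewrite -expRD; apply.
have -> : (\int[P]_w (expR (ka * passage W k 0 w))%:E =
           ((al / (al - ka)) ^+ k)%:E)%E.
  by rewrite -H; apply: eq_integral => w _; rewrite sW.
rewrite lee_fin -[k%:R]mulr1 expRM_natl; apply: lerXn2r; rewrite ?nnegrE ?expR_ge0//.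
  by rewrite divr_ge0; lra.
(* [2 * ka <= al] gives [al / (al - ka) <= 2], which is below [exp 1]. *)
apply: le_trans (expR_ge1Dx 1); rewrite ler_pdivrMr; lra.
Qed.

(** The strict inequality fits [lpp_exit] at [K]: this environment and the one with the whole axis
    tilted differ only at axis sites from [(K, 0)] on. *)
Definition mixed_rate (rho s : R) K (x : nat * nat) : R :=
  if (x.2 == 0%N) && (x.1 < K)%N then 1 - rho - s else boundary_rate (1 - rho) rho x.

(** [U] tilts the whole axis, where [passage_lower_tail] applies. Stopping the tilt at [K] can bring
    the passage time below [X] only if that of [U] is already low or if a path of [U] through
    [(K, 0)] reaches [X], a late exit. *)
Lemma mixed_lower_tail (rho N ka B be X : R) m n K V :
  characteristic rho N m n -> 1 <= N -> N <= X ->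
  [/\ 0 < ka, 2 * ka <= rho, 2 * ka <= 1 - rho & ka * B = 2] ->
  0 < be -> 32 * be <= ka -> (0 < K <= m)%N ->
  let s := be * K%:R / N / 2 in s <= ka ->
  independent_exponentials P (rect m n) (mixed_rate rho s K) V ->
  (P [set w | (passage V m n w <= X)%R] <=
   (expR (s * (X - N) - N * s ^+ 3 / 2 + 2 * B * s) +
    expR (2 - be ^+ 3 / 16 * (K%:R ^+ 3 / N ^+ 2)))%:E)%E.
Proof.
move=> mn N1 NX win be0 beka km s ska HV; have [ka0 kr kr' kaB] := win.
have [k0 km'] := andP km.
have [mV V0 _ _] := HV.
have K0 : 0 < K%:R :> R by rewrite ltr0n.
have s0 : 0 < s by rewrite !divr_gt0// ?mulr_gt0//; lra.
pose c (x : nat * nat) : R :=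
  if (x.2 == 0%N) && (K <= x.1)%N then (1 - rho) / (1 - rho - s) else 1.
have c0 x : 0 < c x by rewrite /c; case: ifP => // _; rewrite divr_gt0//; lra.
pose U x w := c x * V x w.
have HU : independent_exponentials P (rect m n) (boundary_rate (1 - rho - s) rho) U.
  apply: independent_exponentials_rate (independent_exponentials_scale c0 HV).
  move=> [i j] _; rewrite /mixed_rate /boundary_rate /c /=.
  case: (j == 0%N) => /=; last by rewrite divr1.
  case: ltnP => _; first by rewrite divr1.
  by rewrite invf_div mulrCA divff ?mulr1// gt_eqF//; lra.
have [mU _ _ _] := HU.
pose E1 := [set w | passage U m n w <= X].
pose E2 := [set w | X <= passage U K 0 w + passage (shifted (K, 0)%N U) (m - K) n w].
have mE1 : measurable E1.
  by apply: measurable_le_set; [exact: measurable_passage|exact: measurable_cst].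
have mE2 : measurable E2.
  apply: measurable_le_set; first exact: measurable_cst.
  apply: measurable_funD; first exact: measurable_passage.
  by apply: measurable_passage => x; exact: mU.
have mE : measurable [set w | passage V m n w <= X].
  by apply: measurable_le_set; [exact: measurable_passage|exact: measurable_cst].
have EE : [set w | passage V m n w <= X] `<=` E1 `|` E2.
  move=> w /= VX; rewrite /E1 /E2 /=.
  have [h|h] := leP (passage U m n w) X; [by left|right].
  have := lpp_exit (W := U^~ w) (W' := V^~ w) n k0 km'.
  move=> H; have {}H := H _.
  have : passage U m n w <= Num.max (passage V m n w)
     (passage U K 0 w + passage (shifted (K, 0)%N U) (m - K) n w).
    apply: H => -[i j] /= ij; rewrite /U /c /=.
    by case: ifP => [/andP[/eqP j0 Ki]|_]; [move: ij; rewrite j0 orbF ltnNge Ki|rewrite mul1r].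
  rewrite le_max => /orP[h'|]; last by apply: le_trans; exact: ltW.
  by move: (lt_le_trans h (le_trans h' VX)); rewrite ltxx.
have N0 : 0 <= N by lra.
have P1 := @passage_lower_tail _ _ _ P rho N ka B m n mn N0 win U s X s0 ska HU.
have rhU i : (0 < i <= m)%N ->
    boundary_rate (1 - rho - s) rho (i, 0)%N = 1 - rho - be * K%:R / N / 2 by [].
have rbU i j : (0 < i <= m)%N -> (0 < j <= n)%N ->
    boundary_rate (1 - rho - s) rho (i, j) = 1.
  by case: i j => [|i] [|j].
have [_ _ P2] := exit_tail_parabolic mn N1 NX win be0 beka km rhU rbU HU.
apply: (@le_trans _ _ (P E1 + P E2)%E).
  apply: (@le_trans _ _ (P (E1 `|` E2))).
    by apply: le_measure; rewrite ?inE//; exact: measurableU.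
  exact: measureU2.
by rewrite EFinD; apply: leeD.
Qed.

End lower_bound_ingredients.

(** A path through [(x, y)] with [x <= k] and [y > 0] has left the axis within its first [k] sites.
    Everything else it meets is common to both environments, so it gains at most the excess of these
    sites. *)
Lemma lpp_early_exit (R : realType) (c : R) (U V : nat * nat -> R) k m n x y :
  1 <= c -> (forall z, 0 <= U z) ->
  (forall i, (i < k)%N -> V (i.+1, 0)%N = c * U (i.+1, 0)%N) ->
  (forall z, (0 < z.2)%N -> V z = U z) ->
  (x <= k)%N -> (x <= m)%N -> (0 < y <= n)%N ->
  lpp V x y + lpp (shift (x, y) V) (m - x) (n - y) <=
  lpp U m n + (c - 1) * lpp U k 0.
Proof.
move=> c1 U0 VU VUb xk xm /andP[y0 yn].
have -> : lpp (shift (x, y) V) (m - x) (n - y) = lpp (shift (x, y) U) (m - x) (n - y).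
  by apply: eq_lpp => z _ _ _; rewrite !shiftE VUb//= addn_gt0 y0.
have h1 := lpp_superadd U x y (m - x) (n - y).
rewrite !subnKC// in h1.
suff : lpp V x y <= lpp U x y + (c - 1) * lpp U k 0 by lra.
(* [V] is not controlled on the axis beyond [k]. Replacing it by [U] there is invisible at columns
   up to [k] and gives the bound that [lpp_perturb_axis] asks for at all sites. *)
pose V' z := if (z.1 <= k)%N then V z else U z.
pose e i := if (i < k)%N then (c - 1) * U (i.+1, 0)%N else 0.
have c0 : 0 <= c - 1 by lra.
have e0 i : 0 <= e i by rewrite /e; case: ifP => // _; rewrite mulr_ge0.
have -> : lpp V x y = lpp V' x y.
  by apply: eq_lpp => z _ zx _; rewrite /V' (leq_trans zx xk).
apply: (@le_trans _ _ (lpp U x y + \sum_(i < x) e i)).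
  apply: lpp_perturb_axis => //.
  - by move=> i j; rewrite /V'; case: ifP => // _; rewrite VUb.
  - move=> i; rewrite /V' /e /=; case: ifP => ik; last by rewrite addr0.
    by rewrite VU// mulrBl mul1r addrC subrK.
have -> : \sum_(i < x) e i = (c - 1) * lpp U x 0.
  rewrite lpp_axis mulr_sumr; apply: eq_bigr => i _.
  by rewrite /e (leq_trans (ltn_ord i) xk).
rewrite lerD2l ler_wpM2l//.
have -> : lpp U k 0 = lpp U x 0 + lpp (shift (x, 0)%N U) (k - x) 0.
  by rewrite -{1}(subnKC xk) lpp_axis_split.
by rewrite lerDl lpp_ge0// => z; rewrite shiftE.
Qed.

(** [(al - s)^2 = al (al - 2 s) + s^2], so each tilted site costs a factor at most [1 + (s / ka)^2].
    For [K] of order [N^(2/3)] and [s] of order [N^(-1/3)] the total is bounded. *)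
Lemma second_moment_le (R : realType) (al ka s : R) K : 0 < ka -> 2 * ka <= al ->
  0 <= s -> 2 * s <= ka ->
  ((al - s) ^+ 2 / (al * (al - 2 * s))) ^+ K <= expR (K%:R * (s / ka) ^+ 2).
Proof.
move=> ka0 kaal s0 ska; rewrite expRM_natl.
have d0 : 0 < al * (al - 2 * s) by rewrite mulr_gt0; lra.
have kad : ka ^+ 2 <= al * (al - 2 * s) by rewrite expr2 ler_pM; lra.
have ka20 : 0 < ka ^+ 2 by rewrite exprn_gt0.
apply: lerXn2r; rewrite ?nnegrE ?expR_ge0//.
  by rewrite divr_ge0 ?sqr_ge0// ltW.
apply: le_trans (expR_ge1Dx _).
rewrite (_ : (al - s) ^+ 2 = al * (al - 2 * s) + s ^+ 2); last by ring.
rewrite mulrDl divff ?gt_eqF// lerD2l expr_div_n ler_wpM2l ?sqr_ge0//.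
by rewrite lef_pV2 ?posrE.
Qed.

(** * Constants and scales of the tilt *)

Section late_exit_constants.
Context (R : realType) (ka B be : R).

(** An upper bound for [s h], where [s] is the tilt and [h] the cube root of the scale. The part
    [16 * (B + 37)] lets the gain [(s h)^2 h / 4] exceed the upper deviation level [(B + 36) h] by
    at least [h]; the 11 lifts the total above 600, which brings the exponents of the lower tail
    below -32. *)
Definition tilt_size := 11 + 16 * (B + 37).
(** Within the first [exit_size * h^2] axis sites, the tilt is worth at most [h]. *)
Definition exit_size := ka ^+ 2 / (2 * tilt_size).
(** Bounds the second moment of the likelihood ratio: [K (s / ka)^2] becomes [2 (s h)^3 / (be ka^2)]
    after expressing [K] through [s], and [s h <= tilt_size]. *)
Definition density_size := expR (2 * tilt_size ^+ 3 / (be * ka ^+ 2)).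
(** A sum of positive terms dominates each of them, and each term is one requirement on [h]. The
    last one makes the [K] tilted sites fit into the rectangle. *)
Definition scale_threshold :=
  1 + 4 * tilt_size / ka + ka^-1 + 16 / exit_size +
  (tilt_size / be + 3) / (4 * ka ^+ 2).

End late_exit_constants.

Lemma scale_threshold_ge (R : realType) (ka B be : R) : 0 < ka -> 0 < B -> 0 < be ->
  [/\ 1 <= scale_threshold ka B be, 4 * tilt_size B / ka <= scale_threshold ka B be,
      ka^-1 <= scale_threshold ka B be,
      16 / exit_size ka B <= scale_threshold ka B be &
      (tilt_size B / be + 3) / (4 * ka ^+ 2) <= scale_threshold ka B be].
Proof.
move=> ka0 B0 be0.
have S0 : 0 < tilt_size B by rewrite /tilt_size; lra.
have e0 : 0 < exit_size ka B by rewrite /exit_size divr_gt0 ?exprn_gt0// mulr_gt0.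
have p1 : 0 < 4 * tilt_size B / ka by rewrite divr_gt0// mulr_gt0.
have p2 : 0 < ka^-1 by rewrite invr_gt0.
have p3 : 0 < 16 / exit_size ka B by rewrite divr_gt0.
have p4 : 0 < tilt_size B / be by rewrite divr_gt0.
have p5 : 0 < (tilt_size B / be + 3) / (4 * ka ^+ 2).
  by rewrite divr_gt0 ?mulr_gt0 ?exprn_gt0//; lra.
rewrite /scale_threshold; move: p1 p2 p3 p5; clear => p1 p2 p3 p5.
by split; lra.
Qed.

Lemma late_exit_scales (R : realType) (rho ka B be h : R) m n K :
  let N := h ^+ 3 in let s := be * K%:R / N / 2 in
  let S := tilt_size B in
  [/\ 0 < ka, 2 * ka <= rho, 2 * ka <= 1 - rho & ka * B = 2] ->
  0 < be -> 32 * be <= ka ->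
  scale_threshold ka B be <= h -> characteristic rho N m n ->
  S / be * h ^+ 2 <= K%:R < S / be * h ^+ 2 + 1 ->
  [/\ [/\ 1 <= h, (0 < K <= m)%N, 0 < s & 2 * s <= ka / 2],
      [/\ S / 2 <= s * h, s * h <= S & K%:R * (s / ka) ^+ 2 <= 2 * S ^+ 3 / (be * ka ^+ 2)],
      [/\ 16 <= exit_size ka B * h ^+ 2, exit_size ka B * h ^+ 2 < K%:R & h^-1 <= ka] &
      [/\ 600 <= S, 16 * (B + 37) <= S & 0 < exit_size ka B]].
Proof.
move=> N s S [ka0 kr kr' kaB] be0 beka hh [mE _] /andP[K1 K2].
have B0 : 0 < B by rewrite -(pmulr_rgt0 _ ka0) kaB.
have [t1 t2 t3 t4 t5] := scale_threshold_ge ka0 B0 be0.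
have := le_trans t5 hh; have := le_trans t4 hh; have := le_trans t3 hh.
have := le_trans t2 hh; have h1 := le_trans t1 hh; rewrite -/S.
clear hh t1 t2 t3 t4 t5 => hS hka hD hK.
have S600 : 600 <= S by rewrite /S /tilt_size; lra.
have Sy : 16 * (B + 37) <= S by rewrite /S /tilt_size; lra.
have De : exit_size ka B = ka ^+ 2 / (2 * S) by [].
have h0 : 0 < h := lt_le_trans ltr01 h1.
have sE : s * h = be * K%:R / h ^+ 2 / 2 by rewrite /s /N; field; rewrite gt_eqF.
have S0 : 0 < S := lt_le_trans (ltr0n R 600) S600.
have ka1 : ka <= 1 by lra.
have beS : be <= S by lra.
have kr2 : 2 * ka <= `|1 - rho| by rewrite ger0_norm; lra.
rewrite /N in mE; clearbody S s; clear N kaB B0 kr kr'.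
have h20 : 0 < h ^+ 2 by rewrite exprn_gt0.
have h21 : 1 <= h ^+ 2 by rewrite exprn_ege1.
have ka2 : 0 < ka ^+ 2 by rewrite exprn_gt0.
have hk : 4 * S <= h * ka by rewrite -ler_pdivrMr.
have hi : h^-1 <= ka by rewrite -[leRHS]invrK lef_pV2 ?posrE ?invr_gt0.
have e0 : 0 < exit_size ka B by rewrite De divr_gt0// mulr_gt0.
have he : 16 <= exit_size ka B * h ^+ 2.
  have h16 : 16 <= exit_size ka B * h by rewrite mulrC -ler_pdivrMr.
  by apply: le_trans h16 _; rewrite ler_pM2l// expr2 ler_peMr// ltW.
have Sbe : S / be * be = S by rewrite divfK// gt_eqF.
have bK1 : S * h ^+ 2 <= be * K%:R.
  by rewrite -{1}Sbe mulrAC mulrC ler_pM2l.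
have Sbe1 : 1 <= S / be by rewrite ler_pdivlMr// mul1r.
have bK2 : be * K%:R <= 2 * (S * h ^+ 2).
  have b1 : be * K%:R <= be * (S / be * h ^+ 2 + 1) by rewrite ler_pM2l// ltW.
  have b2 : be <= S * h ^+ 2 by rewrite -[leLHS]mulr1 ler_pM// ltW.
  apply: le_trans b1 _; rewrite mulrDr mulr1 mulrA (mulrC be) Sbe.
  by move: b2; clear; lra.
have s1 : S / 2 <= s * h by rewrite sE ler_pM2r// ler_pdivlMr.
have s2 : s * h <= S by rewrite sE !ler_pdivrMr//; move: bK2; clear; lra.
have sh0 : 0 < s * h by apply: lt_le_trans s1; rewrite divr_gt0.
have s0 : 0 < s by rewrite -(pmulr_lgt0 _ h0).
have K0 : 0 < K%:R :> R.
  by rewrite -(pmulr_rgt0 _ be0); apply: lt_le_trans bK1; rewrite mulr_gt0.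
split; split => //.
- apply/andP; split; first by rewrite -(ltr_nat R).
  rewrite -(ler_nat R); move/ler_normlP: mE => [mE _].
  move: hK; rewrite ler_pdivrMr ?mulr_gt0// => /(ler_wpM2r (ltW h20)) H.
  have H1 : 4 * ka ^+ 2 <= (1 - rho) ^+ 2.
    have -> : 4 * ka ^+ 2 = (2 * ka) ^+ 2 by ring.
    by rewrite -[leRHS]real_normK ?num_real// lerXn2r// nnegrE mulr_ge0// ltW.
  have H2 := ler_wpM2l (ltW (exprn_gt0 3 h0)) H1.
  have HE : h * (4 * ka ^+ 2) * h ^+ 2 = h ^+ 3 * (4 * ka ^+ 2) by ring.
  by rewrite HE in H; move: H H2 h21 mE K2; clear; lra.
- by rewrite -(ler_pM2r h0); move: hk s2; clear; lra.
- have KE : K%:R * (s / ka) ^+ 2 = 2 * (s * h) ^+ 3 / (be * ka ^+ 2).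
    have -> : K%:R = 2 * (s * h) * h ^+ 2 / be.
      by rewrite sE; field; rewrite !gt_eqF.
    by field; rewrite !gt_eqF.
  rewrite KE ler_pM2r ?invr_gt0 ?mulr_gt0// ler_pM2l// lerXn2r ?nnegrE// ltW//.
- apply: lt_le_trans K1; rewrite ltr_pM2r//; apply: lt_le_trans Sbe1.
  rewrite De ltr_pdivrMr ?mulr_gt0// mul1r.
  have : ka ^+ 2 <= 1 by rewrite expr_le1// ltW.
  by move: S600; clear; lra.
Qed.

(** The level [X] spends half of the gain [N s^3 / 2] of the lower tail. [Y] is high enough for the
    upper tail with exponent [1 / h]. The level [z] for the first axis weights satisfies
    [ka z = 2 D h^2], twice the bound on the number of sites. An exponent of -32 leaves at most
    [1 / 32] by [exp (- y) <= 1 / y]. *)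
Lemma late_exit_arith (R : realType) (rho ka B S h s : R) :
  let D := ka ^+ 2 / (2 * S) in let N := h ^+ 3 in
  let X := N + (s * h) ^+ 2 / 4 * h in let Y := N + (B + 36) * h in
  let z := 2 * (D * h ^+ 2) / ka in let c := (1 - rho) / (1 - rho - s) in
  [/\ 0 < ka, 2 * ka <= 1 - rho & ka * B = 2] ->
  [/\ 1 <= h, h^-1 <= ka, 0 < s & 4 * s <= ka] ->
  [/\ S / 2 <= s * h, s * h <= S, 600 <= S & 16 * (B + 37) <= S] ->
  [/\ [/\ N <= X, Y + h <= X, 0 <= c - 1 & (c - 1) * z <= h],
      s * (X - N) - N * s ^+ 3 / 2 + 2 * B * s <= - 32,
      - h^-1 * (Y - N) + N * B * h^-1 ^+ 3 + 2 * B * h^-1 <= - 32 &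
      128 <= (s * h) ^+ 3].
Proof.
move=> D N X Y z c [ka0 kr' kaB] [h1 hi s0 ska] [s1 s2 S6 Sy].
have h0 : 0 < h by lra.
have B0 : 0 < B by rewrite -(pmulr_rgt0 _ ka0) kaB.
have S0 : 0 < S by lra.
have D0 : 0 < D by rewrite /D divr_gt0 ?exprn_gt0// mulr_gt0.
have sh0 : 0 < s * h by rewrite mulr_gt0.
have sh3 : s * h <= (s * h) ^+ 3.
  rewrite -[leLHS]mulr1 exprS ler_pM2l// expr_ge1 ?ltW//; lra.
have Bs : B * s <= 1.
  have : B * (4 * s) <= B * ka by rewrite ler_pM2l.
  lra.
have Bh : B * h^-1 <= 2 by rewrite -kaB mulrC ler_pM2r.
split.
- split.
  + by rewrite /X lerDl mulr_ge0 ?divr_ge0 ?sqr_ge0// ltW.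
  + rewrite /Y /X -addrA lerD2l -{2}[h]mul1r -mulrDl ler_pM2r//.
    have h2 : (S / 2) ^+ 2 <= (s * h) ^+ 2.
      by rewrite lerXn2r// nnegrE ?divr_ge0// ltW.
    have h3 : S <= S ^+ 2 by rewrite expr2 ler_peMr; lra.
    rewrite expr_div_n in h2; lra.
  + by rewrite /c subr_ge0 ler_pdivlMr; lra.
  + have -> : c - 1 = s / (1 - rho - s) by rewrite /c; field; rewrite gt_eqF//; lra.
    have z0 : 0 <= z.
      apply: divr_ge0; last exact: ltW.
      by rewrite mulr_ge0// mulr_ge0 ?sqr_ge0// ltW.
    apply: (@le_trans _ _ (s / ka * z)).
      rewrite ler_wpM2r// ler_pM2l// lef_pV2 ?posrE//; lra.
    have -> : s / ka * z = s * h / S * h.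
      by rewrite /z /D; field; rewrite !gt_eqF.
    by rewrite -[leRHS]mul1r ler_pM2r// ler_pdivrMr// mul1r.
- have -> : s * (X - N) - N * s ^+ 3 / 2 = - (s * h) ^+ 3 / 4.
    by rewrite /X /N; field.
  lra.
- have -> : - h^-1 * (Y - N) + N * B * h^-1 ^+ 3 + 2 * B * h^-1 =
      - 36 + 2 * (B * h^-1) by rewrite /Y /N; field; rewrite gt_eqF.
  lra.
- lra.
Qed.

Lemma expR_le_inv (R : realType) (M q : R) : 0 < M -> q <= - M -> expR q <= M^-1.
Proof.
move=> M0 qM; have q0 : 0 < - q by lra.
have := expRN_le q0; rewrite opprK => /le_trans; apply.
by rewrite lef_pV2 ?posrE; lra.
Qed.

(** Three bad events have probability at most [1 / 16] each: the tilted passage time is below [X],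
    the stationary one is above [Y], or the first [k] axis weights sum to more than [z]. *)
Lemma mixed_event d (T : measurableType d) (R : realType) (rho ka B be h : R)
    m n k K (U V : nat * nat -> T -> R) (Q : probability T R) :
  let N := h ^+ 3 in let s := be * K%:R / N / 2 in
  let c := (1 - rho) / (1 - rho - s) in
  [/\ 0 < ka, 2 * ka <= rho, 2 * ka <= 1 - rho & ka * B = 2] ->
  0 < be -> 32 * be <= ka -> scale_threshold ka B be <= h ->
  characteristic rho N m n ->
  tilt_size B / be * h ^+ 2 <= K%:R < tilt_size B / be * h ^+ 2 + 1 -> k%:R <= exit_size ka B * h ^+ 2 ->
  independent_exponentials Q (rect m n) (mixed_rate rho s K) V ->
  independent_exponentials Q (rect m n) (boundary_rate (1 - rho) rho) U ->
  ((1 / 2)%:E <= Q [set w | (passage U m n w + (c - 1) * passage U k 0 w <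
                       passage V m n w)%R])%E.
Proof.
move=> N s c win be0 beka hh mn K12 kD HV HU; have [ka0 kr kr' kaB] := win.
pose S := tilt_size B; pose D := exit_size ka B.
have [[h1 Km s0 ska] [s1 s2 _] [D16 DK hi] [S6 Sy D0]] :=
  late_exit_scales win be0 beka hh mn K12.
rewrite -/N -/s -/S -/D in s0 ska s1 s2 D16 DK S6 Sy D0 kD.
have h0 : 0 < h by lra.
have N1 : 1 <= N by rewrite /N exprn_ege1.
have N0 : 0 < N by lra.
have B0 : 0 < B by rewrite -(pmulr_rgt0 _ ka0) kaB.
have kK : (k < K)%N by rewrite -(ltr_nat R); lra.
have km : (k <= m)%N by move: Km => /andP[_]; apply: leq_trans; exact: ltnW.
have m0 : (0 < m)%N by have /andP[] := Km => /leq_trans; apply.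
have [mV V0 _ _] := HV; have [mU U0 _ _] := HU.
have e32 (q : R) : q <= - 32 -> expR q <= 32^-1 by apply: expR_le_inv.
set X := N + (s * h) ^+ 2 / 4 * h.
set Y := N + (B + 36) * h.
set z := 2 * (D * h ^+ 2) / ka.
have s4 : 4 * s <= ka by lra.
have := @late_exit_arith R rho ka B S h s (And3 ka0 kr' kaB)
  (And4 h1 hi s0 s4) (And4 s1 s2 S6 Sy).
rewrite -/N -/c -/X -/Y -/z => -[[NX YX c1 zh] x1 x2 sh128].
have ska' : s <= ka by lra.
have P1 := @mixed_lower_tail _ _ _ Q rho N ka B be X m n K V
  mn N1 NX win be0 beka Km ska' HV.
have i0 : 0 < h^-1 by rewrite invr_gt0.
have P2 := @passage_upper_tail _ _ _ Q rho N ka B h^-1 Y m n U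
  mn (ltW N0) win i0 hi m0 HU.
have rU i : (0 < i <= k)%N -> boundary_rate (1 - rho) rho (i, 0)%N = 1 - rho by [].
have P3 := @axis_tail _ _ _ Q _ (1 - rho) ka z m n k U ka0 kr' km rU HU.
set E1 := [set w | passage V m n w <= X].
set E2 := [set w | Y <= passage U m n w].
set E3 := [set w | z <= passage U k 0 w].
set F := [set w | _].
have mp W i j : (forall x, measurable_fun setT (W x)) -> measurable_fun setT (@passage _ T R W i j).
  exact: measurable_passage.
have mE1 : measurable E1 by apply: measurable_le_set; [exact: mp|exact: measurable_cst].
have mE2 : measurable E2 by apply: measurable_le_set; [exact: measurable_cst|exact: mp].
have mE3 : measurable E3 by apply: measurable_le_set; [exact: measurable_cst|exact: mp].
have mFC : measurable (~` F).
  rewrite (_ : ~` F = [set w | passage V m n w <= passage U m n w + (c - 1) * passage U k 0 w]).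
    apply: measurable_le_set; first exact: mp.
    apply: measurable_funD; first exact: mp.
    by apply: measurable_funM; [exact: measurable_cst|exact: mp].
  by apply/seteqP; split => w /=; [move/negP; rewrite -leNgt|rewrite /F /= ltNge => ->].
have mF : measurable F by rewrite -(setCK F); exact: measurableC.
have FC : ~` F `<=` E1 `|` E2 `|` E3.
  (* If neither the second nor the third event occurs, the right side of [VU] is at most
     [Y + (c - 1) z <= Y + h <= X], which forces the first one. *)
  move=> w /= /negP; rewrite -leNgt => VU.
  have [h2|h2] := leP z (passage U k 0 w); first by right.
  have [h3|h3] := leP Y (passage U m n w); first by left; right.
  left; left; rewrite /E1 /=.
  have : (c - 1) * passage U k 0 w <= (c - 1) * z
    by apply: ler_wpM2l => //; exact: ltW.
  by move: VU YX zh h3; clear; lra.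
have P1' : (Q E1 <= (1 / 16)%:E)%E.
  apply: (le_trans P1); rewrite lee_fin.
  have -> : be ^+ 3 / 16 * (K%:R ^+ 3 / N ^+ 2) = (s * h) ^+ 3 / 2.
    by rewrite /s /N; field; rewrite !gt_eqF.
  have t2 : 2 - (s * h) ^+ 3 / 2 <= - 32 by move: sh128; clear; lra.
  have := e32 _ t2; have := e32 _ x1.
  by clear; lra.
have P2' : (Q E2 <= (1 / 16)%:E)%E.
  apply: (le_trans P2); rewrite lee_fin.
  by have := e32 _ x2; clear; lra.
have P3' : (Q E3 <= (1 / 16)%:E)%E.
  apply: (le_trans P3); rewrite lee_fin.
  have -> : k%:R - ka * z = - (2 * (D * h ^+ 2) - k%:R).
    by rewrite /z; field; rewrite gt_eqF.
  have q16 : 16 <= 2 * (D * h ^+ 2) - k%:R by move: D16 kD; clear; lra.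
  have q0 : 0 < 2 * (D * h ^+ 2) - k%:R by apply: lt_le_trans q16.
  by apply: le_trans (expRN_le q0) _; rewrite mul1r lef_pV2 ?posrE.
have mE12 : measurable (E1 `|` E2) by exact: measurableU.
have QFC : (Q (~` F) <= (1 / 2)%:E)%E.
  apply: (@le_trans _ _ (Q (E1 `|` E2 `|` E3))).
    by apply: le_measure; rewrite ?inE//; exact: measurableU.
  apply: (@le_trans _ _ (Q (E1 `|` E2) + Q E3)%E); first exact: measureU2.
  apply: (@le_trans _ _ (Q E1 + Q E2 + Q E3)%E).
    by apply: leeD => //; exact: measureU2.
  apply: (le_trans (leeD (leeD P1' P2') P3')).
  by rewrite -!EFinD lee_fin; clear; lra.
have QF : Q F = (1 - Q (~` F))%E.
  by have := probability_setC Q mFC; rewrite setCK.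
rewrite QF; have fQ : Q (~` F) \is a fin_num by exact: fin_num_measure.
rewrite -(fineK fQ) -EFinB lee_fin.
move: QFC; rewrite -(fineK fQ) lee_fin; clear; lra.
Qed.

(* The boundary weights of the first sites of the axis are made larger by an
   exponential tilt. Under the tilted measure the passage time increases enough
   to force a late exit, and the likelihood ratio has a bounded second moment. *)
Lemma late_exit d (T : measurableType d) (R : realType) (P : probability T R)
    (rho ka B be h : R) m n k (V : nat * nat -> T -> R) :
  [/\ 0 < ka, 2 * ka <= rho, 2 * ka <= 1 - rho & ka * B = 2] ->
  0 < be -> 32 * be <= ka -> scale_threshold ka B be <= h ->
  characteristic rho (h ^+ 3) m n ->
  k%:R <= exit_size ka B * h ^+ 2 ->
  independent_exponentials P (rect m n) (boundary_rate (1 - rho) rho) V ->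
  exists F : set T, [/\ measurable F, ((16 * density_size ka B be)^-1%:E <= P F)%E &
    forall w, F w -> forall x y, (x <= k)%N -> (x <= m)%N -> (0 < y <= n)%N ->
      passage V x y w + passage (shifted (x, y) V) (m - x) (n - y) w <
      passage V m n w].
Proof.
move=> win be0 beka hh mn kD HV; have [ka0 kr kr' kaB] := win.
have p0 : 0 <= tilt_size B / be * h ^+ 2.
  have B0 : 0 < B by rewrite -(pmulr_rgt0 _ ka0) kaB.
  rewrite mulr_ge0 ?sqr_ge0// divr_ge0 ?(ltW be0)// /tilt_size; lra.
pose M := density_size ka B be.
have [K K12] := ceil_nat p0.
have [[h1 Km s0 ska] [s1 s2 KM] [D16 DK hi] [S6 Sy D0]] :=
  late_exit_scales win be0 beka hh mn K12.
set N := h ^+ 3 in mn s0 ska s1 s2 KM *.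
set s := be * K%:R / N / 2 in s0 ska s1 s2 KM.
have [mV V0 _ _] := HV.
have kK : (k < K)%N by rewrite -(ltr_nat R); lra.
have [K0 Km'] := andP Km.
(* The sites [(1, 0)] to [(K - 1, 0)], matching the strict inequality in [mixed_rate]. *)
pose l := [seq (i.+1, 0%N) | i <- iota 0 K.-1].
have ul : uniq l by rewrite map_inj_uniq ?iota_uniq// => i j [].
have lD x : x \in l -> rect m n x /\ boundary_rate (1 - rho) rho x = 1 - rho.
  move=> /mapP[i]; rewrite mem_iota add0n /= => iK ->.
  by split => //; rewrite /rect /=; clear -iK Km'; lia.
have s2l : 2 * s < 1 - rho by lra.
have [Q [HQ QP]] := tilt_comparison HV ul s0 s2l lD.
have {}HQ : independent_exponentials Q (rect m n) (mixed_rate rho s K) V.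
  apply: independent_exponentials_rate HQ.
  move=> [i j] /and3P[ij _ _]; rewrite /mixed_rate /=.
  have -> : ((i, j) \in l) = (j == 0%N) && (i < K)%N.
    apply/mapP/andP => [[q]|[/eqP j0 iK]].
      by rewrite mem_iota add0n /= => qK [-> ->]; split => //; clear -qK K0; lia.
    move: ij; rewrite j0; case: i iK => // i iK _.
    by exists i => //; rewrite mem_iota add0n /=; clear -iK; lia.
  by [].
pose c := (1 - rho) / (1 - rho - s).
have c1 : 1 <= c by rewrite /c ler_pdivlMr; lra.
have c0 : 0 < c by lra.
(* Dividing the tilted weights by [c] restores the stationary law under [Q]. [U] is thus a
   stationary process coupled to [V], equal to it off the tilted sites. *)
pose e (x : nat * nat) : R := if (x.2 == 0%N) && (x.1 < K)%N then c^-1 else 1.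
have e0 x : 0 < e x by rewrite /e; case: ifP; rewrite ?invr_gt0.
pose U x w := e x * V x w.
have HU : independent_exponentials Q (rect m n) (boundary_rate (1 - rho) rho) U.
  apply: independent_exponentials_rate (independent_exponentials_scale e0 HQ).
  move=> [i j] _; rewrite /mixed_rate /e /=; case: ifP => [/andP[/eqP -> _]|_].
    rewrite /boundary_rate /= invrK /c mulrCA divff ?mulr1// gt_eqF//; lra.
  by rewrite divr1.
have QF := mixed_event win be0 beka hh mn K12 kD HQ HU.
rewrite -/N -/s -/c in QF.
set F := [set w | _] in QF.
have mF : measurable F.
  rewrite (_ : F = ~` [set w | passage V m n w <= passage U m n w + (c - 1) * passage U k 0 w]).
    have [mU _ _ _] := HU; apply: measurableC.
    apply: measurable_le_set; first exact: measurable_passage.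
    apply: measurable_funD; first exact: measurable_passage.
    by apply: measurable_funM; [exact: measurable_cst|exact: measurable_passage].
  by apply/seteqP; split => w /=; rewrite /F /= ltNge => /negP.
have M0 : 0 < M by exact: expR_gt0.
exists F; split => //.
(* At level [4 * M] the second moment term is at most [1 / 4]. As [Q F >= 1 / 2], there remains
   [4 * M * P F >= 1 / 4], the origin of the 16. *)
- have M40 : 0 < 4 * M by rewrite mulr_gt0.
  have {}QP := QP F (4 * M) mF M40.
  have fP : P F \is a fin_num by exact: fin_num_measure.
  have {}QP := le_trans QF QP.
  rewrite -(fineK fP) -EFinM -EFinD lee_fin in QP.
  rewrite -(fineK fP) lee_fin; clear HQ HU HV mV V0 ul lD e0.
  have sm : ((1 - rho - s) ^+ 2 / ((1 - rho) * (1 - rho - 2 * s))) ^+ size l <= M.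
    have ska2 : 2 * s <= ka by lra.
    have := second_moment_le (size l) ka0 kr' (ltW s0) ska2.
    move=> /le_trans; apply; rewrite ler_expR; apply: le_trans KM.
    rewrite ler_wpM2r ?sqr_ge0// ler_nat size_map size_iota; clear; lia.
  have sm' : ((1 - rho - s) ^+ 2 / ((1 - rho) * (1 - rho - 2 * s))) ^+ size l
      / (4 * M) <= 1 / 4.
    by rewrite ler_pdivrMr//; lra.
  have PF4 : 1 / 4 <= 4 * M * fine (P F) by lra.
  rewrite -/M -[leLHS]mul1r ler_pdivrMr ?mulr_gt0//; lra.
- move=> w; rewrite /F /= => Fw x y xk xm yn; apply: le_lt_trans Fw.
  apply: lpp_early_exit => //.
  + by move=> z; rewrite /U mulr_ge0 ?(ltW (e0 _)).
  + move=> i ik; rewrite /U /e /= ifT; last by clear -ik kK; lia.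
    by rewrite mulrA divff ?mul1r// gt_eqF.
  + by move=> z z0; rewrite /U /e gtn_eqF//= mul1r.
Qed.

(** A late exit along the horizontal ray from a corner just below the square is enough: every
    lattice site of the square lies strictly above this ray and within [k] columns of the corner, so
    a geodesic through it would be an early exit. The bound on the probability is free of [t], which
    enters only [delta] and the threshold. *)
Lemma geodesic_misses_lower (R : realType) (rho ka B be t : R) :
  0 < rho < 1 ->
  [/\ 0 < ka, 2 * ka <= rho, 2 * ka <= 1 - rho & ka * B = 2] ->
  0 < be -> 32 * be <= ka -> 0 < t < 1 ->
  exists2 delta : R, 0 < delta & exists N0 : R,
    forall (d : measure_display) (T : measurableType d) (P : probability T R)
           (omega : nat * nat -> {RV P >-> R}) (I J : nat -> {RV P >-> R}),
      increment_stationary rho omega I J -> forall N : R, N0 <= N ->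
        ((16 * density_size ka B be)^-1%:E <=
         P (geodesic_misses omega I J rho N t (delta * N `^ (2 / 3))))%E.
Proof.
move=> rho01 win be0 beka t01; have [ka0 kr kr' kaB] := win.
have [t0 t1] := andP t01; have [rho0 rho1] := andP rho01.
have B0 : 0 < B by rewrite -(pmulr_rgt0 _ ka0) kaB.
pose D := exit_size ka B; pose th := scale_threshold ka B be.
have D0 : 0 < D.
  by rewrite /D /exit_size divr_gt0 ?exprn_gt0 ?mulr_gt0// /tilt_size; lra.
have [th1 _ _ thD _] := scale_threshold_ge ka0 B0 be0; rewrite -/D -/th in th1 thD.
have t'0 : 0 < 1 - t by lra.
exists (D * (1 - t) `^ (2 / 3) / 2).
  by apply: divr_gt0 => //; apply: mulr_gt0 => //; exact: powR_gt0.
exists (th ^+ 3 / (1 - t) + ((1 - rho) ^+ 2)^-1 + (rho ^+ 2)^-1).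
move=> d T P omega I J HW N NN0.
have q1 : 0 < (1 - rho) ^+ 2 by rewrite exprn_gt0//; lra.
have q2 : 0 < rho ^+ 2 by rewrite exprn_gt0.
have q1i : 0 < ((1 - rho) ^+ 2)^-1 by rewrite invr_gt0.
have q2i : 0 < (rho ^+ 2)^-1 by rewrite invr_gt0.
have th3 : 1 <= th ^+ 3 by rewrite exprn_ege1.
have q3 : 0 < th ^+ 3 / (1 - t) by rewrite divr_gt0//; lra.
have N0 : 0 < N by lra.
have N1 : 1 <= N * (1 - rho) ^+ 2 by rewrite -ler_pdivrMr// mul1r; lra.
have N2 : 1 <= N * rho ^+ 2 by rewrite -ler_pdivrMr// mul1r; lra.
have N3 : th ^+ 3 <= (1 - t) * N by rewrite mulrC -ler_pdivrMr//; lra.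
pose h := ((1 - t) * N) `^ (1 / 3).
have hE : h ^+ 3 = (1 - t) * N.
  rewrite /h -powR_mulrn ?powR_ge0// -powRrM (_ : 1 / 3 * 3%:R = 1); last by field.
  by rewrite powRr1// mulr_ge0// ?ltW.
have h2E : h ^+ 2 = (1 - t) `^ (2 / 3) * N `^ (2 / 3).
  rewrite -powRM ?ltW// /h -powR_mulrn ?powR_ge0// -powRrM.
  by congr (_ `^ _); field.
have hth : th <= h.
  have th0 : 0 <= th := le_trans ler01 th1.
  by rewrite -(@ler_pXn2r _ 3) ?nnegrE ?powR_ge0 ?hE.
have Dh : 16 <= D * h ^+ 2.
  have h1 : 1 <= h := le_trans th1 hth.
  have h0 : 0 < h := lt_le_trans ltr01 h1.
  have : 16 <= D * h by rewrite mulrC -ler_pdivrMr//; exact: le_trans hth.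
  by move=> /le_trans; apply; rewrite ler_pM2l// expr2 ler_peMr// ltW.
clear thD.
set m := Num.truncn (N * (1 - rho) ^+ 2).
set n := Num.truncn (N * rho ^+ 2).
have m_itv : m%:R <= N * (1 - rho) ^+ 2 < m.+1%:R.
  by apply: truncn_itv; exact: le_trans N1.
have n_itv : n%:R <= N * rho ^+ 2 < n.+1%:R.
  by apply: truncn_itv; exact: le_trans N2.
have m1 : (0 < m)%N by rewrite truncn_gt0.
have n1 : (0 < n)%N by rewrite truncn_gt0.
(* The corner is rounded strictly below [(t m, t n)], in contrast to the upper bound: sites on the
   lower side of the square then have positive height over the ray. *)
have below (q : nat) : (0 < q)%N ->
    exists2 a : nat, (a <= q)%N & t * q%:R - 1 <= a%:R < t * q%:R.
  move=> q0; have q0' : 0 < q%:R :> R by rewrite ltr0n.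
  have tq : 0 < t * q%:R by rewrite mulr_gt0.
  have [[|a]] := ceil_nat (ltW tq); first by move=> /andP[/(lt_le_trans tq)]; rewrite ltxx.
  have tq1 : t * q%:R < q%:R by rewrite gtr_pMl.
  rewrite -natr1; move: tq1; clear => tq1 /andP[a1 a2].
  by exists a; [rewrite -(ler_nat R); lra|apply/andP; split; lra].
have [a am a_itv] := below _ m1; have [b bn b_itv] := below _ n1.
have ch : characteristic rho (h ^+ 3) (m - a) (n - b).
  have t01' : 0 <= t <= 1 by rewrite !ltW.
  have dist1 (c : nat) (y : R) : y - 1 <= c%:R < y -> `|c%:R - y| <= 1.
    by clear => /andP[c1 c2]; rewrite ler_norml; apply/andP; split; lra.
  by rewrite hE; split; rewrite -mulrA; apply: remaining_distance => //; exact: dist1.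
pose W := positive_weight omega I J.
have HP : independent_exponentials P (rect (a + (m - a)) (b + (n - b)))
    (boundary_rate (1 - rho) rho) W by exact: positive_weight_independent.
have rr1 : 1 - rho + rho = 1 by ring.
have HV := rebased_stationary rr1 HP.
set V := rebased W a b in HV.
pose k := Num.truncn (D * h ^+ 2).
have /andP[kD Dk] : k%:R <= D * h ^+ 2 < k.+1%:R.
  by apply: truncn_itv; exact: le_trans Dh.
have [F [mF PF FP]] := late_exit win be0 beka hth ch kD HV.
apply: (le_trans PF).
have [Om [mO PO] OW] := weight_nonneg_as HW rho01 m n.
set l := _ * N `^ (2 / 3).
have lE : l = D * h ^+ 2 / 2 by rewrite /l h2E; field.
set A := geodesic_misses _ _ _ _ _ _ _.
have mA : measurable A.
  exact: (@measurable_geodesic _ T R (weight omega I J) m n (fun p =>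
    @path_sites R m n p `&` closed_square l (t * m%:R, t * n%:R) = set0)
    (measurable_weight omega I J)).
apply: (le_probability_as mO PO mF mA) => w [Fw Ow].
have W00 : W (0, 0)%N w = 0 by rewrite /W /positive_weight /= maxxx.
rewrite /A /geodesic_misses /= -/m -/n.
rewrite (@eq_geodesic R _ (W^~ w)); last by move=> x xm xn; exact: OW.
apply/seteqP; split => // z [[q _]].
have := geodesic_through W00 (surjective_pairing (site (geodesic (W^~ w) m n) q)).
case: (site _ q) => x y /= [xm yn g] <- [/= /andP[x1 x2] /andP[y1 y2]].
have ax : (a <= x)%N by rewrite -(ler_nat R); move: x1 a_itv; clear; lra.
have byl : (b < y)%N by rewrite -(ltr_nat R); move: y1 b_itv; clear; lra.
have xk : (x - a <= k)%N.
  rewrite -natr1 in Dk; rewrite lE in x2; rewrite -ltnS -(ltr_nat R) natrB// -natr1.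
  by move: x2 a_itv Dk Dh; clear; lra.
have xma : (x - a <= m - a)%N by rewrite leq_sub2r.
have yb : (0 < y - b <= n - b)%N by rewrite subn_gt0 byl leq_sub2r.
have := FP w Fw (x - a)%N (y - b)%N xk xma yb.
rewrite ltNge => /negP; apply.
have e1 := lpp_rebase (W^~ w) a b (m - a) (n - b).
have e2 := lpp_rebase (W^~ w) a b (x - a) (y - b).
have e3 := shift_le_rebase (W^~ w) a b (x - a) (y - b) (m - x) (n - y).
rewrite !subnKC// ?(ltnW byl)// in e1 e2 e3.
rewrite -[leLHS]/(lpp (rebase (W^~ w) a b) (m - a) (n - b)).
rewrite -[X in _ <= X + _]/(lpp (rebase (W^~ w) a b) (x - a) (y - b)).
have -> : (m - a - (x - a) = m - x)%N by rewrite -subnDA subnKC.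
have -> : (n - b - (y - b) = n - y)%N by rewrite -subnDA subnKC// ltnW.
rewrite -[X in _ <= _ + X]/(lpp (shift ((x - a)%N, (y - b)%N) (rebase (W^~ w) a b)) (m - x) (n - y)).
by move: g e1 e2 e3; clear; lra.
Qed.

Theorem theorem5p3 (R : realType) (rho : R) (hrho : 0 < rho < 1) :
  (exists C : R,
     forall (d : measure_display) (T : measurableType d) (P : probability T R)
            (omega : nat * nat -> {RV P >-> R}) (I J : nat -> {RV P >-> R}),
       increment_stationary rho omega I J ->
       forall delta : R, 0 < delta < 1 ->
       forall r N : R, 1 <= r -> delta^-1 <= N ->
         (ereal_sup [set P (geodesic_misses omega I J rho N t
                              (r * N `^ (2 / 3)))
                    | t in [set t : R | (0 <= t <= 1 - delta)%R]]
          <= (C / r ^+ 3)%:E)%E)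
  /\
  (exists2 eps : R, 0 < eps &
   forall t : R, 0 < t < 1 ->
     exists2 delta : R, 0 < delta &
     exists N0 : R,
     forall (d : measure_display) (T : measurableType d) (P : probability T R)
            (omega : nat * nat -> {RV P >-> R}) (I J : nat -> {RV P >-> R}),
       increment_stationary rho omega I J ->
       forall N : R, N0 <= N ->
         (eps%:E <= P (geodesic_misses omega I J rho N t
                         (delta * N `^ (2 / 3))))%E).
Proof.
have [rho0 rho1] := andP hrho.
(* [ka] is the largest value that fits the window on both sides of [rho], and [be] below is the
   largest value with [32 * be <= ka]. *)
pose ka := Num.min rho (1 - rho) / 2.
have mle : Num.min rho (1 - rho) <= rho by rewrite ge_min lexx.
have mle' : Num.min rho (1 - rho) <= 1 - rho by rewrite ge_min lexx orbT.
have ka0 : 0 < ka by rewrite divr_gt0// lt_min rho0 subr_gt0.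
have win : [/\ 0 < ka, 2 * ka <= rho, 2 * ka <= 1 - rho & ka * (2 / ka) = 2].
  by split; rewrite /ka; [|lra|lra|rewrite mulrC divfK// gt_eqF].
pose be := ka / 32.
have be0 : 0 < be by rewrite divr_gt0.
have beka : 32 * be <= ka by rewrite /be; lra.
split.
- exists (4 * expR 2 * (be ^+ 3 / 128)^-1).
  move=> d T P omega I J HW delta de01 r N r1 deN.
  apply: ge_ereal_sup => _ [t tI <-].
  have H := geodesic_misses_upper HW hrho win be0 beka de01 r1 deN tI.
  apply: (le_trans H).
  have c0 : 0 < be ^+ 3 / 128 by rewrite divr_gt0// exprn_gt0.
  have r0 : 0 < r ^+ 3 by rewrite exprn_gt0//; lra.
  have -> : 2 - be ^+ 3 / 16 * (r ^+ 3 / 8) = 2 + - (be ^+ 3 / 128 * r ^+ 3) by field.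
  (* The exponential bound in [r ^+ 3] is weakened to its inverse by [exp (- y) <= 1 / y]. *)
  rewrite lee_fin expRD mulrA -[leRHS]mulrA ler_pM2l ?mulr_gt0 ?expR_gt0//.
  by rewrite -invfM; apply: expRN_le; exact: mulr_gt0.
- exists (16 * density_size ka (2 / ka) be)^-1.
    by rewrite invr_gt0 mulr_gt0// expR_gt0.
  by move=> t t01; exact: geodesic_misses_lower win be0 beka t01.
Qed.
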